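(* Let $\alpha(x)$ be a positive sub-polynomial such that, for every $\kappa>0$, the sequence $(\kappa\alpha(n))_{n\in\mathbb{N}}$ is uniformly distributed mod $1$. Then there exists a sequence $w\colon\mathbb{N}\to(0,+\infty)$ with $w(N)\searrow0$ such that, for every $N\in\mathbb{N}$, every measure-preserving system $(X,\mathcal{B},\mu,T)$, and every $f\in L^2(X,\mu)$, we have $$\left\|\frac{1}{\alpha(N)}\sum_{n=1}^N\alpha'(n)U_T^{\lfloor\alpha(n)\rfloor}f-\frac{1}{\alpha(N)}\sum_{1\leq m\leq\alpha(N)}U_T^mf\right\|_2\leq w(N)\|f\|_2.$$
   Context: $\mathbb{N}=\{1,2,\dots\}$. A measure-preserving system is a quadruple $(X,\mathcal{B},\mu,T)$ where $(X,\mathcal{B},\mu)$ is a probability space and $T:X\to X$ is measurable and invertible with measurable inverse, and $\mu(T(A))=\mu(A)$ for all $A\in\mathcal{B}$; $U_T:L^2(X,\mu)\to L^2(X,\mu)$ is the unitary operator $U_Tf=f\circ T$. $w(N)\searrow 0$ means that $w$ decreases to $0$. Let $\mathcal{G}$ be the ring (under pointwise addition and multiplication) of germs at $+\infty$ of continuous real-valued functions defined on half-lines $(a,+\infty)$; two functions have the same germ if they agree for all sufficiently large $x$. A Hardy field is a subfield of $\mathcal{G}$ closed under differentiation (each element is eventually differentiable and its derivative's germ lies in the field). A sub-polynomial is a function $\alpha$ whose germ belongs to some Hardy field and which satisfies $\lim_{x\to+\infty}\alpha(x)/x^l=0$ for some $l>0$. Functions and germs are not distinguished; when values $\alpha(n)$,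 $\alpha'(n)$, $n\in\mathbb{N}$, appear, $\alpha$ denotes a fixed real-valued representative defined, positive and differentiable on $[1,+\infty)$. *)

(* Defs.v *)
From HB Require Import structures.
From mathcomp Require Import all_boot all_order all_algebra.
From mathcomp Require Import all_classical all_reals all_analysis.
From mathcomp Require Import complex.

Set Implicit Arguments.
Unset Strict Implicit.
Unset Printing Implicit Defensive.

Import Order.TTheory GRing.Theory Num.Theory.
Import numFieldNormedType.Exports.

Local Open Scope classical_set_scope.
Local Open Scope ring_scope.
Local Open Scope complex_scope.

(* Germs at +oo are represented by total functions R -> R, two of which are
   identified when they agree near +oo; a set of germs is a set of functions
   saturated for this relation.  Values (and regularity) away from +oo are
   irrelevant, including the junk values of [derive1 f] where [f] is not
   derivable. *)
Definition germ_eq {R : realType} (f g : R -> R) : Prop :=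
  \forall x \near +oo, f x = g x.

Record hardy_field {R : realType} (H : set (R -> R)) : Prop := HardyField {
  hardy_sat : forall f g, H f -> germ_eq f g -> H g ;
  hardy_continuous : forall f, H f -> \forall x \near +oo, {for x, continuous f} ;
  hardy1 : H (fun=> 1) ;
  hardyB : forall f g, H f -> H g -> H (fun x => f x - g x) ;
  hardyM : forall f g, H f -> H g -> H (fun x => f x * g x) ;
  hardyV : forall f, H f -> ~ germ_eq f (fun=> 0) ->
    exists2 g, H g & germ_eq (fun x => f x * g x) (fun=> 1) ;
  hardy_derivable : forall f, H f -> \forall x \near +oo, derivable f x 1 ;
  hardy_derive : forall f, H f -> H (derive1 f)
}.

Definition subpolynomial {R : realType} (a : R -> R) : Prop :=
  (exists2 H : set (R -> R), hardy_field H & H a) /\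
  (exists2 l : R, 0 < l & a x / (x `^ l) @[x --> +oo] --> (0 : R)).

(* Differentiation of a function regarded as defined on [1, +oo[ only: at the
   endpoint 1 the difference quotient is one-sided. *)
Definition diff_quotient {R : realType} (a : R -> R) (x y : R) : R :=
  (a y - a x) / (y - x).

Definition derivable_ge1 {R : realType} (a : R -> R) : Prop :=
  forall x : R, 1 <= x ->
    cvg (diff_quotient a x y @[y --> within `[1, +oo[ x^']).

Definition deriv_ge1 {R : realType} (a : R -> R) (x : R) : R :=
  lim (diff_quotient a x y @[y --> within `[1, +oo[ x^']).

Definition frac_part {R : realType} (x : R) : R := x - (Num.floor x)%:~R.

(* The sequence is indexed from 1; its value at 0 is ignored. *)
Definition uniformly_distributed_mod1 {R : realType} (u : nat -> R) : Prop :=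
  forall c d : R, 0 <= c -> c < d -> d <= 1 ->
    (\sum_(1 <= n < N.+1) (c <= frac_part (u n) < d)%R)%N%:R / N%:R
      @[N --> \oo] --> d - c.

Definition measure_preserving_system {R : realType} {d : measure_display}
    {X : measurableType d} (mu : probability X R) (T : X -> X) : Prop :=
  [/\ measurable_fun [set: X] T,
      exists2 S : X -> X, measurable_fun [set: X] S & cancel T S /\ cancel S T
    & forall A : set X, measurable A -> mu (T @` A) = mu A].

Definition koopman {R : realType} {X : Type} (T : X -> X) (f : X -> R[i]) :
  X -> R[i] := f \o T.

Definition L2norm {R : realType} {d : measure_display} {X : measurableType d}
    (mu : probability X R) (f : X -> R[i]) : \bar R :=
  ('N[mu]_2%:E[EFin \o (fun x => ComplexField.Normc.normc (f x))])%E.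

(* Complex-valued L^2, by representatives: measurability of [f : X -> R[i]] is
   that of its real and imaginary parts. *)
Definition L2 {R : realType} {d : measure_display} {X : measurableType d}
    (mu : probability X R) (f : X -> R[i]) : Prop :=
  [/\ measurable_fun [set: X] (fun x => complex.Re (f x)),
      measurable_fun [set: X] (fun x => complex.Im (f x))
    & (L2norm mu f < +oo)%E].

(* The values a n are positive for n >= 1, so [Num.truncn] is the floor and the
   powers of the Koopman operator have natural exponents. *)
Definition weighted_average {R : realType} {X : Type} (a : R -> R) (T : X -> X)
    (f : X -> R[i]) (N : nat) (x : X) : R[i] :=
  ((a N%:R)^-1)%:C * \sum_(1 <= n < N.+1)
    (deriv_ge1 a n%:R)%:C * iter (Num.truncn (a n%:R)) (koopman T) f x.

Definition uniform_average {R : realType} {X : Type} (a : R -> R) (T : X -> X)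
    (f : X -> R[i]) (N : nat) (x : X) : R[i] :=
  ((a N%:R)^-1)%:C * \sum_(1 <= m < (Num.truncn (a N%:R)).+1)
    iter m (koopman T) f x.

(* Main.v *)
(* Write e(x) = exp(2 pi i x).  Transference: by Parseval on Z/MZ along orbit segments of
   length M -> oo, the L^2 operator norm of a polynomial in U_T is at most the supremum of
   the polynomial on the unit circle.  It therefore suffices that, uniformly in theta,
     sum_(n <= N) a'(n) e(theta floor(a(n))) - sum_(m <= a(N)) e(theta m) = o(a(N)).
   Expanding e(- theta {v}) by Fejer means reduces this to
     sum_(n <= N) a'(n) e(t a(n)) = int_0^a(N) e(t s) ds + o(a(N)),
   uniformly for |t| <= K.
   If a' -> 0 this is a comparison of a sum with an integral.  Otherwise cut the sum into
   blocks [M, M + L) with L about rho M, on which a' is nearly constant.  If |t| a'(M) is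
   small, compare again with the integral; if not, the block has to cancel.  Let j be the
   order of the first derivative of a that tends to 0.  Either x^j |a^(j)(x)| -> oo, and
   then some derivative of t a of order 2, ..., j has the right size for van der Corput's
   derivative test; or a = p + b with p a polynomial and b'(x) = O(1/x), and then Weyl's
   inequality applies on the block: without cancellation the nonconstant coefficients of a
   multiple kappa p would all be integers, whence kappa' a(n) would vary too slowly mod 1,
   for some kappa' > 0, to be uniformly distributed. *)
Require Import Defs.
From mathcomp Require Import all_boot all_order all_algebra.
From mathcomp Require Import all_classical all_reals all_analysis.
From mathcomp Require Import measurable_realfun complex.
From mathcomp Require Import ring lra zify.

Import Order.TTheory GRing.Theory Num.Theory ComplexField.Normc.
Import numFieldNormedType.Exports.

Local Open Scope classical_set_scope.
Local Open Scope ring_scope.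

Set Implicit Arguments.
Unset Strict Implicit.
Unset Printing Implicit Defensive.

(** * Moduli of complex numbers and the character e(x) *)

Section Modulus.
Context {R : realType}.
Implicit Types (z w : R[i]) (x y t : R).

(** No bound may depend on the frequency, so thresholds and additive constants are always fixed
    before t or theta: a block has a fixed proportion of M as length, and the initial range of n,
    where a' is not controlled, enters only through a constant that a(N) -> oo absorbs.

    The function e(- theta {v}) jumps at the integers, and there no Fejer mean is close to it. The
    total weight of the n with a(n) near an integer is bounded by means of a short Fejer kernel,
    hence again by exponential sums, now at integer frequencies, where the integral is at most 1
    unless the frequency is 0. The main term left by the Fejer means is never evaluated: the points
    n / B with weights 1 / B, whose floors produce the unweighted sum, leave the same one.

    A Hardy field need not contain x, so a comparison of an element with a power of x is not the
    sign of an element and needs its own argument.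

    Uniform distribution acts through one fact: between N and (1 + rho) N the sequence takes two
    values more than 1/4 apart mod 1. This gives both a -> oo and the arithmetic condition on the
    polynomial p. *)

Lemma normcC_norm z : (normc z)%:C%C = `|z|.
Proof. by rewrite normc_def; case: z. Qed.

Lemma normc_ge0 z : 0 <= normc z.
Proof. by case: z => a b; exact: sqrtr_ge0. Qed.

Lemma normcD_le z w : normc (z + w) <= normc z + normc w.
Proof. exact: le_normcD. Qed.

Lemma normc_opp z : normc (- z) = normc z.
Proof. by case: z => a b /=; rewrite !sqrrN. Qed.

Lemma normcB_le z w : normc (z - w) <= normc z + normc w.
Proof. by rewrite -(normc_opp w) normcD_le. Qed.

Lemma normc_sum_le (I : Type) (r : seq I) (P : pred I) (F : I -> R[i]) :
  normc (\sum_(i <- r | P i) F i) <= \sum_(i <- r | P i) normc (F i).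
Proof.
elim/big_rec2: _ => [|i y z _ h]; first by rewrite normc0.
by apply: (le_trans (normcD_le _ _)); rewrite lerD2l.
Qed.

Lemma normc_conj z : normc z^*%C = normc z.
Proof. by case: z => a b /=; rewrite sqrrN. Qed.

Lemma normc_real x : normc x%:C%C = `|x|.
Proof. by rewrite /= expr0n /= addr0 sqrtr_sqr. Qed.

Lemma normc_sqr z : ((normc z) ^+ 2)%:C%C = z * z^*%C.
Proof. by rewrite rmorphXn /= normcC_norm sqr_normc. Qed.

Lemma normc_sqrE z : (normc z) ^+ 2 = complex.Re z ^+ 2 + complex.Im z ^+ 2.
Proof. by case: z => a b /=; rewrite sqr_sqrtr // addr_ge0 ?sqr_ge0. Qed.

Definition expi x : R[i] := (cos (2 * pi * x) +i* sin (2 * pi * x))%C.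

Lemma expiD x y : expi (x + y) = expi x * expi y.
Proof.
rewrite /expi mulrDr cosD sinD; apply/eqP; rewrite eq_complex /=.
by apply/andP; split; apply/eqP; ring.
Qed.

Lemma expi0 : expi 0 = 1.
Proof. by rewrite /expi mulr0 cos0 sin0. Qed.

Lemma normc_expi x : normc (expi x) = 1.
Proof. by rewrite /= cos2Dsin2 sqrtr1. Qed.

Lemma expi_nat n : expi n%:R = 1.
Proof.
elim: n => [|n IHn]; first exact: expi0.
rewrite -addn1 natrD expiD IHn mul1r /expi mulr1.
by rewrite mulr_natl cos2pi sin2pi.
Qed.

Lemma expiN x : expi (- x) = (expi x)^*%C.
Proof. by rewrite /expi mulrN cosN sinN. Qed.

Lemma expi_int (m : int) : expi m%:~R = 1.
Proof.
case: m => n; first exact: expi_nat.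
by rewrite NegzE mulrNz expiN expi_nat conjc1.
Qed.

Lemma expiB1 x : normc (expi x - 1) = 2 * `|sin (pi * x)|.
Proof.
have -> : expi x = ((1 - 2 * sin (pi * x) ^+ 2) +i* (2 * (cos (pi * x) * sin (pi * x))))%C.
  have E : 2 * pi * x = (pi * x) *+ 2 by rewrite -[RHS]mulr_natl mulrA.
  rewrite /expi E cos_mulr2n sin_mulr2n; apply/eqP; rewrite eq_complex /=.
  by rewrite cos2sin2; apply/andP; split; apply/eqP; ring.
rewrite /=; set s := sin _; set c := cos _.
rewrite (_ : _ + _ = (2 * s) ^+ 2); first by rewrite sqrtr_sqr normrM ger0_norm.
have : c ^+ 2 = 1 - s ^+ 2 by exact: cos2sin2.
rewrite oppr0 addr0 !exprMn => ->; ring.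
Qed.

Lemma cos_mono_ge x y  : 0 <= x -> x <= y -> y <= pi -> cos y <= cos x.
Proof.
move=> x0 xy ypi; move: xy; rewrite le_eqVlt => /predU1P[-> //|xy].
by apply/ltW; rewrite ltr_cos // in_itv /=; apply/andP; split; lra.
Qed.

Lemma sin_le_id x : 0 <= x -> sin x <= x.
Proof.
rewrite le_eqVlt => /predU1P[<-|x0]; first by rewrite sin0.
have [c cx] := @MVT R sin cos 0 x x0 (fun y _ => is_derive_sin y)
   (continuous_subspaceT (fun y => @continuous_sin R y)).
rewrite sin0 !subr0 => ->; rewrite ler_piMl ?cos_le1 //; exact: ltW.
Qed.

Lemma norm_sin_le x : `|sin x| <= `|x|.
Proof.
wlog x0 : x / 0 <= x.
  move=> W; have [/W //|/ltW x0] := leP 0 x.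
  by rewrite -normrN -sinN -[leRHS]normrN W // oppr_ge0.
have [xpi|xpi] := leP x pi.
  rewrite ger0_norm ?sin_ge0_pi ?x0 // ger0_norm //; exact: sin_le_id.
apply: (le_trans (sin_max x)); rewrite ger0_norm //.
by have := pi_ge2 R; lra.
Qed.

Lemma pi_lt4 : pi < 4 :> R.
Proof. by have := @pihalf_lt2 R; lra. Qed.

Lemma expiB1_le x : normc (expi x - 1) <= 8 * `|x|.
Proof.
rewrite expiB1; have := norm_sin_le (pi * x); rewrite normrM (ger0_norm (pi_ge0 R)).
have := pi_lt4; have := normr_ge0 x; nra.
Qed.

Lemma cos1_ge_half : 2^-1 <= cos 1 :> R.
Proof.
have -> : 1 = (2^-1 : R) *+ 2 by lra.
rewrite cos_mulr2n cos2sin2.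
have h : 0 <= sin (2^-1 : R) by apply: sin_ge0_pi; have := pi_ge2 R; lra.
have : sin (2^-1 : R) <= 2^-1 by apply: sin_le_id; lra.
by nra.
Qed.

(** On [0, 1] the mean value theorem and cos 1 >= 1/2 give the slope 1/2; beyond 1 the sine is at
    least 1/2, while x / 4 < 1/2 because pi < 4. *)
Lemma sin_ge_quarter x : 0 <= x -> x <= pi / 2 -> x / 4 <= sin x.
Proof.
have sin_ge_half y : 0 <= y -> y <= 1 -> y / 2 <= sin y.
  rewrite le_eqVlt => /predU1P[<-|y0 y1]; first by rewrite sin0 mul0r.
  have [c /[!in_itv]/= /andP[c0 cy]] := @MVT R sin cos 0 y y0
    (fun y _ => is_derive_sin y)
    (continuous_subspaceT (fun y => @continuous_sin R y)).
  rewrite sin0 !subr0 => ->.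
  have c1 : cos 1 <= cos c by apply: cos_mono_ge; have := pi_ge2 R; lra.
  by have := cos1_ge_half; nra.
move=> x0 xpi; have pi4 := pi_lt4; have pi2 := pi_ge2 R.
have [x1|x1] := leP x 1; first by have := sin_ge_half x x0 x1; lra.
have : sin 1 <= sin x.
  apply/ltW; rewrite ltr_sin // in_itv /=; apply/andP; split; lra.
by have := sin_ge_half 1 ler01 (lexx 1); lra.
Qed.

Lemma expiB1_ge x : `|x| <= 2^-1 -> `|x| <= normc (expi x - 1).
Proof.
have pi2 := pi_ge2 R; wlog x0 : x / 0 <= x.
  move=> W; have [/W //|/ltW x0] := leP 0 x.
  rewrite -normrN => h; apply: le_trans (W (- x) _ h) _; first by rewrite oppr_ge0.
  have -> : expi (- x) - 1 = ((expi x - 1)^*)%C.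
    by rewrite rmorphB rmorph1 expiN.
  by rewrite normc_conj.
rewrite ger0_norm // => xh; rewrite expiB1.
have h : pi * x / 4 <= sin (pi * x) by apply: sin_ge_quarter; nra.
have := ler_norm (sin (pi * x)); nra.
Qed.

End Modulus.

(** * Geometric sums and van der Corput's inequality *)

Section ExponentialSums.
Context {R : realType}.
Implicit Types (z : nat -> R[i]) (u : nat -> R) (x y t c : R).

Lemma expi_lip x y : normc (expi x - expi y) <= 8 * `|x - y|.
Proof.
have -> : expi x - expi y = expi y * (expi (x - y) - 1).
  by rewrite mulrBr -expiD mulr1; congr (expi _ - _); ring.
by rewrite normcM normc_expi mul1r expiB1_le.
Qed.

Lemma normc_expi_sum (L : nat) u : normc (\sum_(n < L) expi (u n)) <= L%:R.
Proof.
apply: (le_trans (normc_sum_le _ _ _)).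
under eq_bigr do rewrite normc_expi.
by rewrite sumr_const card_ord.
Qed.

(** Multiplication by e(c) - 1 makes the sum telescope up to replacing e(u n + c) by e(u n.+1), at a
    cost of 8 eta per term. Two boundary contributions of modulus at most 2 give the 4. *)
Lemma almost_geometric_sum (L : nat) u c (eta : R) :
  (forall n, (n.+1 < L)%N -> `|u n.+1 - u n - c| <= eta) -> 0 <= eta ->
  normc (\sum_(n < L) expi (u n)) * normc (expi c - 1) <= 4 + 8 * eta * L%:R.
Proof.
move=> hu eta0; rewrite -normcM mulr_suml.
case: L hu => [|L] hu.
  by rewrite big_ord0 normc0 mulr0 addr0.
rewrite big_ord_recr /=.
have E : \sum_(i < L) expi (u i) * (expi c - 1) =
    (expi (u L) - expi (u 0%N)) + \sum_(i < L) (expi (u i + c) - expi (u i.+1)).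
  rewrite -(telescope_sumr (fun n => expi (u n)) (leq0n L)) big_mkord -big_split /=.
  by apply: eq_bigr => i _; rewrite mulrBr -expiD mulr1 addrC subrKA.
rewrite E; apply: (le_trans (normcD_le _ _)).
have b1 : normc (expi (u L) * (expi c - 1)) <= 2.
  rewrite normcM normc_expi mul1r.
  by apply: (le_trans (normcB_le _ _)); rewrite normc_expi normc1; lra.
have b2 : normc (expi (u L) - expi (u 0%N)) <= 2.
  by apply: (le_trans (normcB_le _ _)); rewrite !normc_expi; lra.
have b3 : normc (\sum_(i < L) (expi (u i + c) - expi (u i.+1))) <= 8 * eta * L%:R.
  apply: (le_trans (normc_sum_le _ _ _)).
  rewrite mulr_natr -[X in _ *+ X]card_ord -sumr_const; apply: ler_sum => i _.
  apply: (le_trans (expi_lip _ _)); rewrite ler_pM2l // distrC.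
  by rewrite opprD addrA hu // ltnS.
have b4 := normcD_le (expi (u L) - expi (u 0%N)) (\sum_(i < L) (expi (u i + c) - expi (u i.+1))).
have : 8 * eta * L%:R <= 8 * eta * L.+1%:R.
  by rewrite ler_wpM2l ?ler_nat //; lra.
by lra.
Qed.

Lemma geometric_sum (L : nat) c x :
  normc (\sum_(n < L) expi (x + c * n%:R)) * normc (expi c - 1) <= 4.
Proof.
have := @almost_geometric_sum L (fun n => x + c * n%:R) c 0.
rewrite mulr0 mul0r addr0; apply => // n _.
rewrite -addn1 natrD [X in `|X|](_ : _ = 0) ?normr0 //. ring.
Qed.

(** The variance about the mean m is nonnegative; this is Cauchy-Schwarz against the constant 1. *)
Lemma sqr_sum_le (n : nat) (f : nat -> R) :
  (\sum_(i < n) f i) ^+ 2 <= n%:R * \sum_(i < n) f i ^+ 2.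
Proof.
case: n => [|n]; first by rewrite !big_ord0 expr0n mulr0.
set s := \sum_(i < _) f i; set Q := \sum_(i < _) _.
have [k k0 kE] : exists2 k : R, 0 < k & n.+1%:R = k by exists n.+1%:R; rewrite ?ltr0n.
rewrite kE.
pose m := s / k.
have : 0 <= \sum_(i < n.+1) (f i - m) ^+ 2 by apply: sumr_ge0 => i _; exact: sqr_ge0.
have -> : \sum_(i < n.+1) (f i - m) ^+ 2 = Q - m * s *+ 2 + m ^+ 2 * k.
  rewrite -kE mulr_sumr -sumrMnl -sumrB mulr_natr -[X in _ *+ X]card_ord -sumr_const -big_split /=.
  by apply: eq_bigr => i _; ring.
have -> : Q - m * s *+ 2 + m ^+ 2 * k = (k * Q - s ^+ 2) / k.
  by rewrite /m; field; rewrite gt_eqF.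
by rewrite pmulr_lge0 ?invr_gt0 // subr_ge0.
Qed.

(** A function supported in [H, L + H) loses nothing under a shift by at most H. *)
Lemma shift_sum (V : zmodType) (F : nat -> V) (L H h : nat) : (h <= H)%N ->
  (forall n, (n < H)%N -> F n = 0) -> (forall n, (L + H <= n)%N -> F n = 0) ->
  \sum_(n < L + H) F (n + h)%N = \sum_(m < L) F (m + H)%N.
Proof.
move=> hH F0 F1.
rewrite -(big_mkord xpredT (fun n => F (n + h)%N)) -(big_mkord xpredT (fun m => F (m + H)%N)).
have -> : \sum_(0 <= i < L + H) F (i + h)%N = \sum_(h <= i < L + H + h) F i.
  by rewrite -{2}[h]add0n big_addn addnK.
have -> : \sum_(0 <= i < L) F (i + H)%N = \sum_(H <= i < L + H) F i.
  by rewrite -{2}[H]add0n big_addn addnK.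
rewrite (big_cat_nat hH) /=; last by lia.
rewrite [X in X + _]big_nat_cond big1 ?add0r; last by move=> i /andP[/andP[_ /F0]].
rewrite (@big_cat_nat _ _ _ (L + H)%N) /=; [|lia|lia].
by rewrite [X in _ + X]big_nat_cond [X in _ + X]big1 ?addr0 // => i /andP[/andP[/F1]].
Qed.

(** H times the sum is a double sum over H shifts. Cauchy-Schwarz and opening the square leave
    correlations of lag |h - k|, each lag occurring at most twice for a given h; this 2 and L + H <=
    2 L make the 4. *)
Lemma van_der_corput (L H : nat) z : (forall n, normc (z n) <= 1) ->
  (0 < H)%N -> (H <= L)%N ->
  H%:R * normc (\sum_(n < L) z n) ^+ 2 <=
    4 * L%:R * \sum_(k < H) normc (\sum_(n < L - k) z (n + k)%N * (z n)^*%C).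
Proof.
move=> z1 H0 HL.
(* [zt] extends z by 0 beyond L, and [y] is [zt] moved right by H, which leaves room for every shift
   by at most H inside the natural numbers. *)
pose zt n := if (n < L)%N then z n else 0.
pose y n := if (n < H)%N then 0 else zt (n - H)%N.
pose c k := normc (\sum_(n < L - k) z (n + k)%N * (z n)^*%C).
rewrite -/(c _).
have yH n : y (n + H)%N = zt n by rewrite /y ltnNge leq_addl addnK.
have y0 n : (n < H)%N -> y n = 0 by rewrite /y => ->.
have y1 n : (L + H <= n)%N -> y n = 0.
  move=> h; rewrite /y ltnNge (leq_trans (leq_addl L H) h) /= /zt ltnNge.
  by rewrite (_ : (L <= n - H)%N) //; lia.
have cE k : (k <= L)%N -> \sum_(n < L) y (n + H + k)%N * (y (n + H)%N)^*%C =
    \sum_(n < L - k) z (n + k)%N * (z n)^*%C.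
  move=> kL; under eq_bigr => n _ do rewrite addnAC !yH.
  rewrite -(big_mkord xpredT (fun n => zt (n + k)%N * (zt n)^*%C)).
  rewrite (@big_cat_nat _ _ _ (L - k)%N) ?leq_subr //=.
  rewrite [X in _ + X]big_nat_cond [X in _ + X]big1 ?addr0; last first.
    move=> i /andP[/andP[h1 h2] _]; rewrite /zt (_ : (i + k < L)%N = false) ?mul0r //; lia.
  rewrite big_mkord; apply: eq_bigr => i _; rewrite /zt.
  have := ltn_ord i => hi; rewrite (_ : (i + k < L)%N) 1?(_ : (i < L)%N) //; lia.
have C1 h k : (h + k < H)%N -> \sum_(n < L + H) y (n + (h + k))%N * (y (n + h)%N)^*%C =
    \sum_(n < L - k) z (n + k)%N * (z n)^*%C.
  move=> hk; under eq_bigr => n _ do rewrite addnA.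
  rewrite (@shift_sum _ (fun n => y (n + k)%N * (y n)^*%C)); first by apply: cE; lia.
  - by lia.
  - by move=> n /y0 ->; rewrite conjc0 mulr0.
  - by move=> n /y1 ->; rewrite conjc0 mulr0.
have HS : H%:R * \sum_(n < L) z n = \sum_(n < L + H) \sum_(h < H) y (n + h)%N.
  rewrite exchange_big /= -[H in LHS]card_ord mulr_natl -sumr_const.
  apply: eq_bigr => h _; rewrite (@shift_sum _ y) //; last exact: ltnW.
  by apply: eq_bigr => n _; rewrite yH /zt ltn_ord.
have CS : H%:R ^+ 2 * normc (\sum_(n < L) z n) ^+ 2 <=
   (L + H)%:R * \sum_(n < L + H) normc (\sum_(h < H) y (n + h)%N) ^+ 2.
  have -> : H%:R ^+ 2 * normc (\sum_(n < L) z n) ^+ 2 =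
      normc (\sum_(n < L + H) \sum_(h < H) y (n + h)%N) ^+ 2.
    rewrite -HS normcM exprMn; congr (_ ^+ 2 * _).
    by rewrite (_ : H%:R = (H%:R)%:C%C) ?normc_real ?ger0_norm // rmorph_nat.
  apply: le_trans (@sqr_sum_le _ (fun n => normc (\sum_(h < H) y (n + h)%N))).
  rewrite lerXn2r ?nnegrE ?normc_ge0 ?sumr_ge0 //; last exact: normc_sum_le.
  by move=> i _; exact: normc_ge0.
have D : \sum_(n < L + H) normc (\sum_(h < H) y (n + h)%N) ^+ 2 <=
    \sum_(h < H) \sum_(k < H) normc (\sum_(n < L + H) y (n + h)%N * (y (n + k)%N)^*%C).
  rewrite -lecR rmorph_sum /=.
  under eq_bigr => n _ do rewrite normc_sqr rmorph_sum /= mulr_suml.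
  rewrite exchange_big /=.
  under eq_bigr => h _ do under eq_bigr => n _ do rewrite mulr_sumr.
  under eq_bigr => h _ do rewrite exchange_big /=.
  set S := (X in X <= _).
  have S0 : 0 <= S.
    rewrite /S; under eq_bigr => h _ do rewrite exchange_big /=.
    under eq_bigr => h _ do under eq_bigr => n _ do rewrite -mulr_sumr.
    rewrite exchange_big /=; apply: sumr_ge0 => n _.
    by rewrite -mulr_suml -rmorph_sum mulcJ_ge0.
  have -> : S = (normc S)%:C%C by rewrite normcC_norm ger0_norm.
  rewrite lecR /S; apply: (le_trans (normc_sum_le _ _ _)).
  by apply: ler_sum => h _; exact: normc_sum_le.
have E : \sum_(h < H) \sum_(k < H) normc (\sum_(n < L + H) y (n + h)%N * (y (n + k)%N)^*%C)
   <= H%:R * (2 * \sum_(k < H) c k).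
  rewrite mulr_natl -[X in _ *+ X]card_ord -sumr_const; apply: ler_sum => h _.
  (* The lag is h - k or k - h, the second case being reached by conjugation. On the diagonal both
     summands are present, which only enlarges the bound. *)
  have cond (k : 'I_H) : normc (\sum_(n < L + H) y (n + h)%N * (y (n + k)%N)^*%C) <=
     (if (k <= h)%N then c (h - k)%N else 0) + (if (h <= k)%N then c (k - h)%N else 0).
    have [kh|hk] := leqP k h.
      have := C1 k (h - k)%N; rewrite subnKC // => -> //.
      by rewrite lerDl; case: ifP => // _; exact: normc_ge0.
    rewrite (ltnW hk) add0r -normc_conj rmorph_sum /=.
    have := C1 h (k - h)%N; rewrite (subnKC (ltnW hk)) => /(_ (ltn_ord k)).
    by rewrite /c => <-; rewrite le_eqVlt; apply/orP; left; apply/eqP; congr normc;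
      apply: eq_bigr => n _; rewrite rmorphM /= conjcK mulrC.
  apply: (le_trans (ler_sum _ (fun k _ => cond k))); rewrite big_split /=.
  have cpos k : 0 <= c k by exact: normc_ge0.
  have -> : 2 * \sum_(k < H) c k = \sum_(k < H) c k + \sum_(k < H) c k by ring.
  apply: lerD.
    rewrite -(big_mkord xpredT (fun k => if (k <= h)%N then c (h - k)%N else 0)).
    rewrite (@big_cat_nat _ _ _ h.+1) ?ltn_ord //=.
    rewrite [X in _ + X]big_nat_cond [X in _ + X]big1 ?addr0; last first.
      by move=> i /andP[/andP[h1 h2] _]; rewrite leqNgt h1.
    rewrite big_nat_rev /= add0n -(big_mkord xpredT c).
    rewrite [leRHS](@big_cat_nat _ _ _ h.+1) ?ltn_ord //=.
    rewrite ler_wpDr ?sumr_ge0 // le_eqVlt; apply/orP; left; apply/eqP.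
    apply: eq_big_nat => i /andP[_ hi]; rewrite subSS leq_subr; congr c; lia.
  rewrite -(big_mkord xpredT (fun k => if (h <= k)%N then c (k - h)%N else 0)).
  rewrite (@big_cat_nat _ _ _ h) ?(ltnW (ltn_ord h)) //=.
  rewrite [X in X + _]big_nat_cond [X in X + _]big1 ?add0r; last first.
    by move=> i /andP[/andP[h1 h2] _]; rewrite leqNgt h2.
  rewrite -{1}[val h]add0n big_addn -(big_mkord xpredT c).
  rewrite [leRHS](@big_cat_nat _ _ _ (H - h)%N) ?leq_subr //=.
  rewrite ler_wpDr ?sumr_ge0 // le_eqVlt; apply/orP; left; apply/eqP.
  by apply: eq_big_nat => i _; rewrite leq_addl addnK.
have H0' : 0 < H%:R :> R by rewrite ltr0n.
have : (L + H)%:R <= 2 * L%:R :> R by rewrite natrD mulr2n mulrDl mul1r lerD2l ler_nat.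
set X := normc _ ^+ 2 in CS *; set Sc := \sum_(k < H) c k in E *.
move=> LH; have Sc0 : 0 <= Sc by apply: sumr_ge0 => k _; exact: normc_ge0.
have DE := le_trans D E.
have : H%:R ^+ 2 * X <= (2 * L%:R) * (H%:R * (2 * Sc)).
  apply: (le_trans CS); apply: ler_pM => //.
  by apply: sumr_ge0 => n _; exact: sqr_ge0.
move=> h; rewrite -(ler_pM2l H0') mulrA -expr2; apply: le_trans h _.
by rewrite le_eqVlt; apply/orP; left; apply/eqP; ring.
Qed.

End ExponentialSums.

Ltac nneg := repeat first
  [ done | assumption | exact: ler0n | (apply: ltW; assumption) | exact: normr_ge0
  | exact: sqr_ge0 | rewrite invr_ge0 | apply: exprn_ge0 | apply: addr_ge0 | apply: divr_ge0 | apply: mulr_ge0 ].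

(** * Van der Corput's test with differences of higher order *)

Section DerivativeTest.
Context {R : realType}.
Implicit Types (u : nat -> R) (x y t c lam delta : R).

Definition fdiff u : nat -> R := fun n => u n.+1 - u n.

Lemma fdiff_iter_shift u (h k n : nat) :
  iter k fdiff (fun n => u (n + h)%N - u n) n =
  iter k fdiff u (n + h)%N - iter k fdiff u n.
Proof.
elim: k n => [//|k IHk] n; rewrite !iterS /fdiff !IHk addSn; ring.
Qed.

(** Telescoping over unit shifts. In the induction for the test it turns differences close to lam
    into differences of one order less close to h lam. *)
Lemma fdiff_iter_shift_sum u (h k n : nat) :
  iter k fdiff (fun n => u (n + h)%N - u n) n =
  \sum_(i < h) iter k.+1 fdiff u (n + i)%N.
Proof.
rewrite fdiff_iter_shift.
rewrite -[X in _ - iter k fdiff u X]addn0.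
rewrite -(telescope_sumr (fun i => iter k fdiff u (n + i)%N) (leq0n h)) big_mkord.
by apply: eq_bigr => i _; rewrite iterS /fdiff addnS.
Qed.

Lemma correlation_expi (L h : nat) u :
  \sum_(n < L - h) expi (u (n + h)%N) * (expi (u n))^*%C =
  \sum_(n < L - h) expi (u (n + h)%N - u n).
Proof. by apply: eq_bigr => n _; rewrite -expiN -expiD. Qed.

(** Lags below delta H are bounded trivially; since delta H >= 1 there are at most 2 delta H of
    them, and the others add at most delta H L. *)
Lemma sum_correlation_le (L H : nat) (c : nat -> R) delta : 0 <= delta ->
  1 <= delta * H%:R -> (forall h, (h < H)%N -> c h <= L%:R) ->
  (forall h, (h < H)%N -> delta * H%:R <= h%:R -> c h <= delta * L%:R) ->
  \sum_(h < H) c h <= 3 * delta * H%:R * L%:R.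
Proof.
move=> d0 dH cL cd; pose m := (Num.truncn (delta * H%:R)).+1.
have mle : m%:R <= 2 * (delta * H%:R).
  by rewrite /m -natr1; have := truncn_le (delta * H%:R); rewrite ?mulr_ge0 //; lra.
have cond (h : 'I_H) : c h <= (if (h < m)%N then L%:R else 0) + delta * L%:R.
  case: ifPn => [_|]; first by rewrite ler_wpDr ?cL ?mulr_ge0.
  rewrite -leqNgt add0r => mh; apply: cd => //.
  by apply/ltW/(lt_le_trans (truncnS_gt _)); rewrite ler_nat.
apply: (le_trans (ler_sum _ (fun h _ => cond h))).
rewrite big_split /= sumr_const card_ord -[_ *+ H]mulr_natr -big_mkcond /=.
have : \sum_(i < H | (i < m)%N) L%:R <= m%:R * L%:R :> R.
  have [mH|Hm] := leqP m H.
    by rewrite (big_ord_narrow mH) sumr_const card_ord mulr_natl.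
  apply: (@le_trans _ _ (H%:R * L%:R)); last by rewrite ler_wpM2r // ler_nat ltnW.
  by rewrite mulr_natl -[H in leRHS]card_ord -sumr_const big_mkcond ler_sum // => i _; case: ifP.
have : m%:R * L%:R <= 2 * (delta * H%:R) * L%:R :> R by rewrite ler_wpM2r.
lra.
Qed.

(* The k-th derivative test of van der Corput, qualitatively and with k-th
   differences instead of derivatives. *)
Lemma difference_test (k : nat) delta : 0 < delta ->
  exists2 C : R, 1 <= C & forall (L : nat) lam u, 0 < lam -> lam * C <= 1 ->
    C <= lam * L%:R ^+ k.+1 ->
    (forall n, (n + k.+1 < L)%N -> `|iter k.+1 fdiff u n - lam| <= lam / C) ->
    normc (\sum_(n < L) expi (u n)) <= delta * L%:R.
Proof.
elim: k delta => [|k IHk] delta d0.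
  (* Here S lam C <= 4 C + 8 lam L <= 12 lam L, so C >= 12 / delta suffices; the summand 2 ensures
     lam <= 1/2, as [expiB1_ge] requires. *)
  exists (12 / delta + 2); first by have := divr_ge0 (ler0n R 12) (ltW d0); lra.
  set C := _ + _; have C2 : 2 <= C by rewrite /C lerDr divr_ge0 ?ltW //.
  have Cd : 12 <= delta * C by rewrite /C mulrDr mulrCA divff ?gt_eqF //; lra.
  move=> L lam u l0 lC CL hu.
  have h2 : lam / C <= 1 / C * lam by rewrite mul1r mulrC.
  have := @almost_geometric_sum R L u lam (lam / C); rewrite expr1 in CL.
  have C0 : 0 < C by lra.
  move=> /(_ _ (divr_ge0 (ltW l0) (ltW C0))) h.
  have {}h := h (fun n hn => hu n (eq_ind_r (fun m => (m < L)%N) hn (addn1 n))).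
  have lh : `|lam| <= 2^-1 by rewrite gtr0_norm //; nra.
  have := expiB1_ge lh; rewrite gtr0_norm // => le.
  set S := normc _ in h *; have S0 : 0 <= S by exact: normc_ge0.
  have : S * lam <= 4 + 8 * (lam / C) * L%:R by apply: le_trans h; rewrite ler_wpM2l.
  have -> : 4 + 8 * (lam / C) * L%:R = (4 * C + 8 * (lam * L%:R)) / C by field; rewrite gt_eqF.
  rewrite ler_pdivlMr // => h3.
  have : S * lam * C <= 12 * lam * L%:R by lra.
  have : 12 * (lam * L%:R) <= delta * C * (lam * L%:R) by rewrite ler_wpM2r //; nneg.
  have lC0 : 0 < lam * C by rewrite mulr_gt0.
  move=> h4 h5; rewrite -(ler_pM2l lC0).
  have -> : lam * C * S = S * lam * C by ring.
  have -> : lam * C * (delta * L%:R) = delta * C * (lam * L%:R) by ring.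
  lra.
(* Van der Corput's inequality and [sum_correlation_le] give S^2 <= 4 L * 3 d1 L, which is (delta
   L)^2 for this d1. *)
pose d1 := delta ^+ 2 / 12; have d10 : 0 < d1 by rewrite divr_gt0 // exprn_gt0.
have [C1 C11 IH] := IHk d1 d10; have C10 : 0 < C1 by lra.
pose B := 2 ^+ k.+2 * C1 ^+ 2 / d1 + 4 / d1 + 1.
have B1 : 1 <= B.
  by rewrite lerDr; nneg.
pose C := B ^+ k.+2 + 2 * C1 / d1 + C1 * 2 ^+ k.+3 / d1 + C1.
have t1 : 0 <= 2 * C1 / d1 by nneg.
have t2 : 0 <= C1 * 2 ^+ k.+3 / d1 by nneg.
have t3 : 1 <= B ^+ k.+2 by exact: exprn_ege1.
exists C; first by rewrite /C; lra.
move=> L lam u l0 lC CL hu.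
have C0 : 0 < C by rewrite /C; lra.
(* lam C <= 1 and C <= lam L^(k+2) together force L to be large. *)
have LB : B <= L%:R.
  rewrite leNgt; apply/negP => LB.
  have : L%:R ^+ k.+2 <= B ^+ k.+2 by rewrite lerXn2r ?nnegrE // ?ltW //; lra.
  have BC : B ^+ k.+2 <= C by rewrite /C; lra.
  have : lam * L%:R ^+ k.+2 <= lam * B ^+ k.+2 -> False.
    move=> h; have h1 : lam * B ^+ k.+2 <= lam * C by rewrite ler_wpM2l //; nneg.
    have C1' : C <= 1 by lra.
    by move: C1'; rewrite /C; lra.
  by move=> F h; apply: F; rewrite ler_wpM2l //; nneg.
have L0 : 0 < L%:R :> R by lra.
(* H is as large as permitted: H <= L / 2 keeps L - h comparable with L, and H <= 1 / (lam C1) keeps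
   h lam in the range of the induction hypothesis. *)
pose y : R := Num.min (L%:R / 2) (1 / (lam * C1)).
have lC1 : 0 < lam * C1 by rewrite mulr_gt0.
have y1 : 2 / d1 <= y.
  rewrite /y le_min; apply/andP; split.
    rewrite ler_pdivlMr //; apply: le_trans LB; rewrite /B.
    have : 0 <= 2 ^+ k.+2 * C1 ^+ 2 / d1 by nneg.
    by lra.
  rewrite ler_pdivlMr // mulrAC ler_pdivrMr // mul1r.
  have : lam * (2 * C1 / d1) <= 1 by apply: le_trans lC; rewrite ler_wpM2l // ?ltW // /C; lra.
  rewrite mulrA ler_pdivrMr // mul1r; lra.
have y0 : 0 <= y by apply: le_trans y1; nneg.
have d11 : 1 <= 1 / d1 \/ 1 < d1.
  by have [h|h] := leP d1 1; [left; rewrite ler_pdivlMr // mul1r|right].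
have [dle|dgt] := leP delta 1; last first.
  apply: (le_trans (normc_expi_sum _ _)); rewrite ler_peMl //; lra.
have d1le : d1 <= 1 by rewrite /d1; nra.
have y2 : 2 <= y by apply: le_trans y1; rewrite ler_pdivlMr //; lra.
pose H := Num.truncn y.
have Hy : H%:R <= y by rewrite /H truncn_le.
have yH : y < H%:R + 1 by rewrite natr1; exact: truncnS_gt.
have Hy2 : y / 2 <= H%:R by lra.
have dH : 1 <= d1 * H%:R.
  have : 1 <= d1 * (y / 2); last by move=> h; apply: le_trans h _; rewrite ler_wpM2l //; nneg.
  by rewrite mulrA ler_pdivlMr // mul1r mulrC -ler_pdivrMr.
have H0 : (0 < H)%N by rewrite -(ltr_nat R); lra.
have HL2 : H%:R <= L%:R / 2 :> R by apply: (le_trans Hy); rewrite /y ge_min lexx.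
have HlC : H%:R * (lam * C1) <= 1.
  by rewrite -ler_pdivlMr //; apply: (le_trans Hy); rewrite /y ge_min lexx orbT.
have HL : (H <= L)%N by rewrite -(ler_nat R); lra.
(* Even the smallest lag to be treated, about d1 H, must meet the length condition of the induction
   hypothesis. For y = L / 2 this follows from the assumption on lam L^(k+2), for y = 1 / (lam C1)
   from L >= B. *)
have key : C1 <= d1 * H%:R * lam * (L%:R / 2) ^+ k.+1.
  have : y = L%:R / 2 \/ y = 1 / (lam * C1) by rewrite /y; case: leP; [left|right].
  have P0 : 0 < (L%:R / 2) ^+ k.+1 :> R by rewrite exprn_gt0 // divr_gt0.
  case=> yE.
    apply: (@le_trans _ _ (d1 * (L%:R / 2 / 2) * lam * (L%:R / 2) ^+ k.+1)).
      have -> : d1 * (L%:R / 2 / 2) * lam * (L%:R / 2) ^+ k.+1 =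
          (d1 / 2 ^+ k.+3) * (lam * L%:R ^+ k.+2) :> R.
        rewrite expr_div_n !exprS; field; rewrite ?expf_neq0 //; lra.
      apply: (@le_trans _ _ (d1 / 2 ^+ k.+3 * C)); last first.
        by rewrite ler_wpM2l //; nneg.
      have -> : C1 = d1 / 2 ^+ k.+3 * (C1 * 2 ^+ k.+3 / d1).
        by field; rewrite gt_eqF //= expf_neq0 //; lra.
      apply: ler_wpM2l; first by nneg.
      by rewrite /C; lra.
    rewrite ler_wpM2r ?(ltW P0) // ler_wpM2r ?(ltW l0) // ler_wpM2l ?(ltW d10) //.
    by rewrite -yE.
  apply: (@le_trans _ _ (d1 * (1 / (lam * C1) / 2) * lam * (L%:R / 2) ^+ k.+1)).
    have -> : d1 * (1 / (lam * C1) / 2) * lam * (L%:R / 2) ^+ k.+1 =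
        (d1 / (2 ^+ k.+2 * C1)) * L%:R ^+ k.+1 :> R.
      rewrite expr_div_n !exprS; field; rewrite ?expf_neq0 ?gt_eqF //.
    have LL : L%:R <= L%:R ^+ k.+1 :> R by rewrite exprS ler_peMr ?exprn_ege1 //; lra.
    rewrite [leLHS](_ : _ = (d1 / (2 ^+ k.+2 * C1)) * (2 ^+ k.+2 * C1 ^+ 2 / d1)); last first.
      by field; rewrite !gt_eqF //= exprn_gt0.
    apply: ler_wpM2l; first by nneg.
    apply: le_trans LL; apply: le_trans LB; rewrite /B.
    by rewrite -addrA lerDl; nneg.
  rewrite ler_wpM2r ?(ltW P0) // ler_wpM2r ?(ltW l0) // ler_wpM2l ?(ltW d10) //.
  by rewrite -yE.
have e1 n : normc (expi (u n)) <= 1 by rewrite normc_expi.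
pose c h := normc (\sum_(n < L - h) expi (u (n + h)%N - u n)).
have := van_der_corput e1 H0 HL.
rewrite (eq_bigr (fun h : 'I_H => c h)); last by move=> h _; rewrite correlation_expi.
move=> vdc.
have cb : \sum_(h < H) c h <= 3 * d1 * H%:R * L%:R.
  apply: sum_correlation_le => //; first exact: ltW.
    by move=> h hH; apply: (le_trans (normc_expi_sum _ (fun n => u (n + h)%N - u n))); rewrite ler_nat leq_subr.
  move=> h hH dh.
  have h0 : 0 < h%:R :> R by apply: lt_le_trans dh; lra.
  have hl : h%:R <= H%:R :> R by rewrite ler_nat ltnW.
  have Lh : (L - h)%:R = L%:R - h%:R :> R by rewrite natrB // (leq_trans (ltnW hH)).
  apply: (@le_trans _ _ (d1 * (L - h)%:R)); last first.
    by rewrite ler_wpM2l ?(ltW d10) // Lh; clear -h0; lra.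
  apply: (IH (L - h)%N (h%:R * lam) (fun n => u (n + h)%N - u n)).
  - by rewrite mulr_gt0.
  - by apply: le_trans HlC; rewrite -mulrA ler_wpM2r //; nneg.
  - apply: (le_trans key); apply: ler_pM.
    + by nneg.
    + by rewrite exprn_ge0 // divr_ge0.
    + by rewrite ler_wpM2r //; nneg.
    + by rewrite lerXn2r ?nnegrE ?divr_ge0 //; lra.
  move=> n hn; rewrite fdiff_iter_shift_sum.
  have G (F : nat -> R) : \sum_(i < h) F i - h%:R * lam = \sum_(i < h) (F i - lam).
    by rewrite sumrB sumr_const card_ord mulr_natl.
  rewrite (G (fun i => iter k.+2 fdiff u (n + i)%N)).
  apply: (le_trans (ler_norm_sum _ _ _)).
  have -> : h%:R * lam / C1 = \sum_(i < h) (lam / C1).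
    by rewrite sumr_const card_ord -[RHS]mulr_natl mulrA.
  apply: ler_sum => i _; apply: (@le_trans _ _ (lam / C)).
    by apply: hu; have hi := ltn_ord i; clear -hn hi; lia.
  rewrite ler_wpM2l ?(ltW l0) // lef_pV2 ?posrE //; rewrite /C; lra.
set S := normc _ in vdc *.
have S0 : 0 <= S by exact: normc_ge0.
have Hp : 0 < H%:R :> R by rewrite ltr0n.
have : H%:R * S ^+ 2 <= H%:R * (delta * L%:R) ^+ 2.
  apply: (le_trans vdc).
  apply: (@le_trans _ _ (4 * L%:R * (3 * d1 * H%:R * L%:R))).
    by rewrite ler_wpM2l // mulr_ge0.
  by rewrite le_eqVlt; apply/orP; left; apply/eqP; rewrite /d1; field.
by rewrite ler_pM2l // ler_pXn2r // nnegrE; nneg.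
Qed.

End DerivativeTest.

(** * Nearness to integers and pigeonhole in dense sets *)

Section WeylInverse.
Context {R : realType}.
Implicit Types (u : nat -> R) (x y t c delta rho eps : R).

Definition near_int x eps : Prop := exists k : int, `|x - k%:~R| <= eps.

Lemma near_int_half x : near_int x 2^-1.
Proof.
exists (Num.floor (x + 2^-1)); have /andP[h1 h2] := floor_itv (x + 2^-1).
by rewrite ler_norml; rewrite intrD in h2; apply/andP; split; lra.
Qed.

Lemma near_intW x eps eps' : eps <= eps' -> near_int x eps -> near_int x eps'.
Proof. by move=> h [k hk]; exists k; apply: le_trans hk h. Qed.

Lemma near_intB x y eps eps' : near_int x eps -> near_int y eps' ->
  near_int (x - y) (eps + eps').
Proof.
move=> [k hk] [l hl]; exists (k - l); rewrite intrB.
have -> : x - y - (k%:~R - l%:~R) = (x - k%:~R) - (y - l%:~R) by ring.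
by apply: (le_trans (ler_normB _ _)); exact: lerD.
Qed.

Lemma near_intM (n : nat) x eps : near_int x eps -> near_int (n%:R * x) (n%:R * eps).
Proof.
move=> [k hk]; exists (n%:Z * k); rewrite intrM -mulrBr normrM.
by rewrite ger0_norm ?ler0n //; apply: ler_wpM2l => //; exact: ler0n.
Qed.

Lemma near_int_small x eps : near_int x eps -> eps < 2^-1 -> `|x| <= 2^-1 -> `|x| <= eps.
Proof.
move=> [k hk] e2 x2; suff k0 : k = 0 by move: hk; rewrite k0 subr0.
have : `|k%:~R : R| < 1.
  have -> : k%:~R = x - (x - k%:~R) by ring.
  by apply: (le_lt_trans (ler_normB _ _)); lra.
by rewrite -intr_norm ltrz1; case: k {hk} => [[|n]|n].
Qed.

Lemma window_count (A : pred nat) (w n X : nat) :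
  (forall x : nat, (\sum_(x <= m < x + w) A m <= X)%N) ->
  (\sum_(0 <= m < n * w) A m <= n * X)%N.
Proof.
move=> h; elim: n => [|n IHn]; first by rewrite !mul0n big_geq.
rewrite !mulSn addnC (@big_cat_nat _ _ _ (n * w)) //=; last exact: leq_addr.
by rewrite addnC leq_add.
Qed.

(** If m is the least element of A in the window, [m, m + t) holds at most t elements, so another
    one is at least m + t. *)
Lemma spread_in_window (A : pred nat) (x w t : nat) :
  (t < \sum_(x <= m < x + w) A m)%N ->
  exists m m', [/\ A m, A m', (m + t <= m')%N & (m' < m + w)%N].
Proof.
move=> ht.
have ex : exists m, [&& A m, (x <= m)%N & (m < x + w)%N].
  apply: contrapT => nex; move: ht; rewrite big_nat_cond big1 //.
  move=> i /andP[/andP[h1 h2] _]; case: (boolP (A i)) => // Ai.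
  by exfalso; apply: nex; exists i; rewrite Ai h1 h2.
case: (ex_minnP ex) => m /and3P[Am xm mw] min.
apply: contrapT => nex; move: ht; rewrite ltnNge => /negP; apply.
apply: (@leq_trans (\sum_(x <= i < x + w) (if (m <= i < m + t)%N then 1 else 0))).
  rewrite big_nat_cond [leqRHS]big_nat_cond; apply: leq_sum => i /andP[/andP[h1 h2] _].
  case: (boolP (A i)) => //= Ai; case: ifPn => // /nandP[|].
    by rewrite (min i) // Ai h1 h2.
  rewrite -leqNgt => mt; exfalso; apply: nex; exists m, i; split => //.
  by lia.
rewrite -big_mkcond /= -big_filter sum1_size.
rewrite -[leqRHS](size_iota m t).
apply: uniq_leq_size; first by rewrite filter_uniq // iota_uniq.
by move=> i; rewrite mem_filter mem_iota => /andP[].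
Qed.

(** Averaging over about L / w windows yields one with more than rho w / 4 elements of A, and two of
    these are that far apart. The condition rho w >= 8 absorbs the rounding of t. *)
Lemma dense_pair (A : pred nat) (L w : nat) rho : (0 < w)%N -> (w <= L)%N ->
  8 <= rho * w%:R -> rho * L%:R <= (\sum_(0 <= m < L) A m)%:R ->
  exists m m', [/\ A m, A m', rho * w%:R / 4 <= m'%:R - m%:R & (m' < m + w)%N].
Proof.
move=> w0 wL rw rL.
have rho0 : 0 < rho.
  by rewrite ltNge; apply/negP => h; have := mulr_le0_ge0 h (ler0n R w); lra.
pose B m := A m && (m < L)%N.
pose n := (L %/ w).+1; pose t := Num.truncn (rho * w%:R / 4 + 1).
have tle : t%:R <= rho * w%:R / 4 + 1 by rewrite /t truncn_le //; lra.
have tgt : rho * w%:R / 4 < t%:R.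
  by have := truncnS_gt (rho * w%:R / 4 + 1); rewrite -/t -[t.+1%:R]natr1; lra.
have [x hx] : exists x : nat, (t < \sum_(x <= m < x + w) B m)%N.
  apply: contrapT => nex.
  have h (x : nat) : (\sum_(x <= m < x + w) B m <= t)%N.
    by rewrite leqNgt; apply/negP => hx; apply: nex; exists x.
  have := window_count n h.
  have Ln : (L <= n * w)%N by rewrite ltnW // ltn_ceil.
  rewrite (@big_cat_nat _ _ _ L) //= => h1.
  have : (\sum_(0 <= m < L) A m <= n * t)%N.
    apply: leq_trans h1; apply: leq_trans (leq_addr _ _).
    by rewrite !big_mkord; apply: leq_sum => i _; rewrite /B ltn_ord andbT.
  rewrite -(ler_nat R) natrM => h2.
  have nw : n%:R * w%:R <= 2 * L%:R :> R.
    rewrite -natrM -[2]/(2%:R) -natrM ler_nat /n mulSn.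
    by have := leq_trunc_div L w; lia.
  have n1 : 1 <= n%:R :> R by rewrite ler1n.
  have e0 : n%:R * t%:R <= n%:R * (rho * w%:R / 4 + 1) :> R by apply: ler_wpM2l.
  have e1 : n%:R * (rho * w%:R) <= 2 * rho * L%:R.
    by have := ler_wpM2l (ltW rho0) nw; clear; lra.
  have e2 : 8 * n%:R <= n%:R * (rho * w%:R).
    by rewrite mulrC; apply: ler_wpM2l => //; clear -n1; lra.
  have L0 : 0 < L%:R :> R by rewrite ltr0n; clear -w0 wL; lia.
  have := mulr_gt0 rho0 L0; move: rL h2; clear -e1 e2 e0; lra.
have [m [m' [/andP[Am _] /andP[Am' _] h1 h2]]] := spread_in_window hx.
exists m, m'; split => //.
have : (m + t)%:R <= m'%:R :> R by rewrite ler_nat.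
by rewrite natrD; lra.
Qed.
End WeylInverse.

(** * Vinogradov's lemma and the leading coefficient of a polynomial phase *)

Section WeylLeading.
Context {R : realType}.
Implicit Types (u : nat -> R) (x y t c delta rho eps : R).

(* Vinogradov's lemma: a point c with many small multiples mod 1 is much closer to a
   rational of bounded denominator than those multiples show. *)
Lemma vinogradov rho : 0 < rho ->
  exists2 B : nat, (0 < B)%N & forall (L : nat) c eps (A : pred nat),
    (B <= L)%N -> 0 <= eps -> eps * B%:R <= 1 ->
    rho * L%:R <= (\sum_(0 <= m < L) A m)%:R ->
    (forall m, A m -> near_int (m%:R * c) eps) ->
    exists2 q : nat, (0 < q <= B)%N & near_int (q%:R * c) (B%:R * eps / L%:R).
Proof.
move=> r0; pose w0 := (Num.truncn (8 / rho)).+1.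
have w0r : 8 <= rho * w0%:R.
  rewrite mulrC -ler_pdivrMr //; apply/ltW; exact: truncnS_gt.
pose B := (w0 + (Num.truncn (64 * w0%:R / rho)).+1)%N.
have Bw : w0%:R <= B%:R :> R by rewrite ler_nat leq_addr.
have Br : 64 * w0%:R <= rho * B%:R.
  rewrite [leRHS]mulrC -ler_pdivrMr //; apply: (@le_trans _ _ (Num.truncn (64 * w0%:R / rho)).+1%:R).
    by apply/ltW; exact: truncnS_gt.
  by rewrite ler_nat leq_addl.
have w01 : 1 <= w0%:R :> R by rewrite ler1n.
exists B; first by rewrite -(ltr_nat R); lra.
clearbody B w0.
move=> L c eps A BL e0 eB rL hA.
have BL' : B%:R <= L%:R :> R by rewrite ler_nat.
have w0L : (w0 <= L)%N by rewrite -(ler_nat R) (le_trans Bw).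
have w0p : (0 < w0)%N by rewrite -(ltr_nat R); lra.
have e1 : eps <= eps * w0%:R by rewrite ler_peMr.
have e2 : eps * (64 * w0%:R) <= rho.
  have := ler_wpM2l e0 Br; have := ler_wpM2l (ltW r0) eB; clear; lra.
have e3 : eps * w0%:R <= 1 by apply: le_trans eB; rewrite ler_wpM2l.
have rho1 : rho <= 1.
  have : (\sum_(0 <= m < L) A m <= L)%N.
    by rewrite -[leqRHS]subn0 -[leqRHS]muln1 -sum_nat_const_nat; apply: leq_sum => i _; case: (A i).
  have Lp : 0 < L%:R :> R by rewrite ltr0n (leq_trans w0p).
  by move=> h; rewrite -(ler_pM2r Lp) mul1r; apply: (le_trans rL); rewrite ler_nat.
(* A pair at distance q <= w0 already puts q c within 2 eps of an integer k; the signed error s is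
   then improved by the factor L. *)
have [m1 [m2 [Am1 Am2 d1 d2]]] := dense_pair w0p w0L w0r rL.
have m12 : (m1 < m2)%N by rewrite -(ltr_nat R); clear -d1 w0r; lra.
pose q := (m2 - m1)%N.
have qE : q%:R = m2%:R - m1%:R :> R by rewrite natrB // ltnW.
have q0 : (0 < q)%N by rewrite subn_gt0.
have qw : (q <= w0)%N by clear -d2 m12; rewrite /q; lia.
have qw' : q%:R <= w0%:R :> R by rewrite ler_nat.
have q1 : 1 <= q%:R :> R by rewrite ler1n.
exists q; first by rewrite q0 (leq_trans qw) // -(ler_nat R).
have [k hk] := near_intB (hA _ Am2) (hA _ Am1).
rewrite -mulrBl -qE in hk; set s := q%:R * c - k%:~R in hk.
exists k; rewrite -/s.
have Lp : 0 < L%:R :> R by rewrite ltr0n (leq_trans w0p).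
have [->|s0] := eqVneq s 0; first by rewrite normr0; nneg.
have sp : 0 < `|s| by rewrite normr_gt0.
have s64 : 32 * `|s| <= rho.
  by clear -hk e2 e1; lra.
(* For d <= w one has d |s| <= 1/2, so that d |s| is the distance from d s to the nearest
   integer. *)
pose w := minn L (Num.truncn (1 / (2 * `|s|))).
have ws : w%:R * (2 * `|s|) <= 1.
  rewrite -ler_pdivlMr ?mulr_gt0 //; apply: (@le_trans _ _ (Num.truncn (1 / (2 * `|s|)))%:R).
    by rewrite ler_nat geq_minr.
  by rewrite truncn_le // divr_ge0 // mulr_ge0.
have wcase : w = L \/ 1 <= 4 * (w%:R * `|s|).
  rewrite /w; case: leqP => h; [by left|right].
  have := truncnS_gt (1 / (2 * `|s|)); rewrite ltr_pdivrMr ?mulr_gt0 //.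
  set T := Num.truncn _; rewrite -[T.+1%:R]natr1; clear -s64 rho1; lra.
have w8 : 8 <= rho * w%:R.
  case: wcase => [->|h]; first by apply: (le_trans w0r); rewrite ler_wpM2l ?(ltW r0) // ler_nat.
  rewrite -(ler_pM2r sp); have := ler_wpM2l (ltW r0) h; have := sp; clear -s64; lra.
have wp : (0 < w)%N.
  by rewrite -(ltr_nat R) ltNge; apply/negP => h; have := mulr_ge0_le0 (ltW r0) h; clear -w8; lra.
(* For d = m4 - m3 >= rho w / 4, d s is q d c minus an integer, hence within 2 q eps of an integer,
   so d |s| <= 2 q eps. If w = L this is the claim; a shorter w has w |s| >= 1/4, against the
   smallness of eps. *)
have [m3 [m4 [Am3 Am4 d3 d4]]] := dense_pair wp (geq_minl _ _) w8 rL.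
have m34 : (m3 < m4)%N by rewrite -(ltr_nat R); clear -d3 w8; lra.
pose d := (m4 - m3)%N.
have dE : d%:R = m4%:R - m3%:R :> R by rewrite natrB // ltnW.
have dw : d%:R <= w%:R :> R by rewrite ler_nat; clear -d4 m34; rewrite /d; lia.
have d0 : 0 <= d%:R :> R by exact: ler0n.
have ds : near_int (d%:R * s) (q%:R * (eps + eps)).
  have [l hl] := near_intM q (near_intB (hA _ Am4) (hA _ Am3)).
  exists (l - d%:Z * k); rewrite intrB intrM.
  rewrite [X in `|X|](_ : _ = q%:R * (m4%:R * c - m3%:R * c) - l%:~R) //.
  by rewrite -mulrBl -dE /s -[d%:Z%:~R]/(d%:R); ring.
have qe : q%:R * (eps + eps) <= 2 * (w0%:R * eps).
  by have := ler_wpM2r e0 qw'; clear; lra.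
have h1 : `|d%:R * s| <= q%:R * (eps + eps).
  apply: near_int_small => //.
    apply: (le_lt_trans qe); have : eps * w0%:R * 64 <= 1 by clear -e2 rho1; lra.
    by clear; lra.
  rewrite normrM (ger0_norm d0); have := ler_wpM2r (ltW sp) dw; clear -ws; lra.
rewrite normrM (ger0_norm d0) in h1.
have h2 : rho * w%:R * `|s| <= 8 * (w0%:R * eps).
  have := ler_wpM2r (ltW sp) d3; rewrite -dE; clear -h1 qe; lra.
case: wcase => [wL|h].
  rewrite ler_pdivlMr // -(ler_pM2l r0); rewrite wL in h2.
  have := ler_wpM2r e0 Br; have : 0 <= w0%:R * eps by nneg.
  clear -h2; lra.
exfalso; have := ler_wpM2l (ltW r0) h; have : eps * w0%:R * 64 <= rho by clear -e2; lra.
by have := r0; clear -h2; lra.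
Qed.

Lemma fact_multiple (q Q : nat) : (0 < q <= Q)%N -> exists2 r, (r <= Q`!)%N & (Q`! = r * q)%N.
Proof.
move=> /andP[q0 qQ]; have /dvdnP[r rE] : (q %| Q`!)%N by rewrite dvdn_fact // q0.
by exists r => //; rewrite rE leq_pmulr.
Qed.

(** Van der Corput's inequality with H = L. With rho = delta^2 / 8, if fewer than rho L lags had a
    correlation of size rho L, all correlations together would stay below 2 rho L^2 = (delta L)^2 /
    4. *)
Lemma large_correlations (L : nat) u delta : (0 < L)%N -> 0 < delta ->
  delta * L%:R <= normc (\sum_(n < L) expi (u n)) ->
  delta ^+ 2 / 8 * L%:R <= (\sum_(0 <= h < L)
    (delta ^+ 2 / 8 * L%:R <= normc (\sum_(n < L - h) expi (u (n + h)%N - u n)) :> R)%R : nat)%:R.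
Proof.
move=> L0 d0 hS; pose rho := delta ^+ 2 / 8; rewrite -/rho.
pose c h := normc (\sum_(n < L - h) expi (u (n + h)%N - u n)).
have Lp : 0 < L%:R :> R by rewrite ltr0n.
have e1 n : normc (expi (u n)) <= 1 by rewrite normc_expi.
have := van_der_corput e1 L0 (leqnn L).
rewrite (eq_bigr (fun h : 'I_L => c h)); last by move=> h _; rewrite correlation_expi.
set S := normc _ in hS *; set N := (\sum_(0 <= h < L) _ : nat)%N => vdc.
have cb : \sum_(h < L) c h <= L%:R * N%:R + L%:R * (rho * L%:R).
  have -> : L%:R * N%:R + L%:R * (rho * L%:R) =
      \sum_(h < L) (L%:R * (rho * L%:R <= c h)%R%:R + rho * L%:R).
    rewrite big_split /=; congr (_ + _); last by rewrite sumr_const card_ord mulr_natl.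
    by rewrite /N big_mkord natr_sum mulr_sumr.
  apply: ler_sum => h _; have [hc|hc] := leP (rho * L%:R) (c h).
    rewrite mulr1 ler_wpDr //; first by rewrite /rho; nneg.
    apply: (le_trans (normc_expi_sum _ (fun n => u (n + h)%N - u n))).
    by rewrite ler_nat leq_subr.
  by rewrite mulr0 add0r ltW.
have h0 : (delta * L%:R) ^+ 2 <= S ^+ 2.
  by rewrite ler_pXn2r ?nnegrE //; [nneg | exact: normc_ge0].
have : L%:R * S ^+ 2 <= L%:R * (4 * (L%:R * N%:R + L%:R * (rho * L%:R))).
  by apply: (le_trans vdc); rewrite [4 * L%:R]mulrC -mulrA ler_wpM2l // ler_wpM2l.
rewrite ler_pM2l // => h1; rewrite -(ler_pM2l Lp).
by move: (le_trans h0 h1); rewrite /rho; clear; lra.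
Qed.

(** Induction on the order of the constant difference. Many correlations are large, and the one of
    lag h has constant difference h c of one order less; so bounded multiples of h c are near
    integers for a positive proportion of h, and [vinogradov] passes from these h to c. *)
Lemma weyl_leading (k : nat) delta : 0 < delta ->
  exists2 Q : nat, (0 < Q)%N & forall (L : nat) u c, (0 < L)%N ->
    (forall n, iter k.+1 fdiff u n = c) ->
    delta * L%:R <= normc (\sum_(n < L) expi (u n)) ->
    exists2 q : nat, (0 < q <= Q)%N & near_int (q%:R * c) (Q%:R / L%:R ^+ k.+1).
Proof.
elim: k delta => [|k IHk] delta d0.
  exists (Num.truncn (4 / delta)).+1 => // L u c L0 hu hS.
  have Lp : 0 < L%:R :> R by rewrite ltr0n.
  exists 1%N => //; rewrite mul1r expr1.
  have [m hm] := near_int_half c; exists m; set c' := c - m%:~R in hm *.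
  have ce : expi c = expi c' by rewrite -[c in LHS](subrK m%:~R) expiD expi_int mulr1.
  have := @almost_geometric_sum R L u c 0.
  rewrite mulr0 mul0r addr0 ce => /(_ _ (lexx 0)) h.
  have {}h := h (fun n _ => eq_ind_r (fun z => `|z - c| <= 0)
     (eq_ind_r (fun z => `|z| <= 0) (eq_ind_r (fun z => z <= 0) (lexx 0) (normr0 _)) (subrr c)) (hu n)).
  have h2 : delta * L%:R * `|c'| <= 4.
    by apply: le_trans h; apply: ler_pM (expiB1_ge hm) => //; nneg.
  rewrite ler_pdivlMr //; apply: (@le_trans _ _ (4 / delta)).
    by rewrite ler_pdivlMr //; move: h2; clear; lra.
  by apply/ltW; exact: truncnS_gt.
pose rho := delta ^+ 2 / 8.
have r0 : 0 < rho by rewrite divr_gt0 // exprn_gt0.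
have [Q1 Q10 IH] := IHk rho r0; have [B B0 V] := vinogradov r0.
(* The factorial of Q1 clears every denominator q <= Q1, so that [vinogradov] applies to one number,
   Q1! c. The power of rho pays for a correlation having only L - h >= rho L terms. *)
pose Q2 : R := Q1`!%:R * (Q1%:R / rho ^+ k.+1).
have Q20 : 0 <= Q2 by rewrite /Q2; nneg.
pose K : nat := (B + (Num.truncn (B%:R * Q2)).+1)%N.
pose Q := (B * Q1`! + (Num.truncn (B%:R * Q2)).+1 + K ^ k.+2)%N.
have BQ : B%:R * Q2 <= Q%:R.
  by apply/ltW/(lt_le_trans (truncnS_gt _)); rewrite ler_nat /Q -addnA addnCA leq_addr.
have Q0 : (0 < Q)%N by rewrite /Q -addnA addnCA addSn.
exists Q; first exact: Q0.
move=> L u c L0 hu hS; have Lp : 0 < L%:R :> R by rewrite ltr0n.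
(* For L < K the conclusion is trivial, because Q >= K^(k+2). *)
have [LK|KL] := ltnP L K.
  exists 1%N => //.
  rewrite mul1r; apply: near_intW (near_int_half c).
  rewrite ler_pdivlMr ?exprn_gt0 //; apply: (@le_trans _ _ (K ^ k.+2)%:R).
    rewrite natrX; apply: (@le_trans _ _ (L%:R ^+ k.+2)).
      by rewrite ler_piMl ?exprn_ge0 //; lra.
    by rewrite lerXn2r ?nnegrE // ler_nat ltnW.
  by rewrite ler_nat leq_addl.
pose eps := Q2 / L%:R ^+ k.+1.
have e0 : 0 <= eps by rewrite /eps; nneg.
have eB : eps * B%:R <= 1.
  rewrite /eps mulrAC ler_pdivrMr ?exprn_gt0 // mul1r [leLHS]mulrC.
  apply: (@le_trans _ _ L%:R).
    by apply/ltW/(lt_le_trans (truncnS_gt _)); rewrite ler_nat (leq_trans _ KL) // leq_addl.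
  by rewrite exprS ler_peMr // exprn_ege1 // ler1n.
have BL : (B <= L)%N by rewrite (leq_trans _ KL) // leq_addr.
have LC := large_correlations L0 d0 hS; rewrite -/rho in LC.
have [|q /andP[q0 qB] hq] := V L (Q1`!%:R * c) eps _ BL e0 eB LC; last first.
  exists (q * Q1`!)%N.
    rewrite muln_gt0 q0 fact_gt0 /=; apply: (@leq_trans (B * Q1`!)); first by rewrite leq_mul2r qB orbT.
    by rewrite /Q -addnA leq_addr.
  rewrite natrM -mulrA; apply: near_intW hq; rewrite /eps.
  rewrite mulrA -mulrA -invfM -exprSr ler_wpM2r //; nneg.
move=> h Ah; have hL : (h < L)%N.
  rewrite ltnNge; apply/negP => Lh; move: Ah; rewrite (_ : L - h = 0)%N; last by apply/eqP.
  by rewrite big_ord0 normc0 leNgt mulr_gt0.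
have Lh0 : (0 < L - h)%N by rewrite subn_gt0.
have rL : rho * L%:R <= (L - h)%:R.
  by apply: (le_trans Ah); exact: (normc_expi_sum _ (fun n => u (n + h)%N - u n)).
have [||q /andP[q0 qQ] hq] := IH (L - h)%N (fun n => u (n + h)%N - u n) (h%:R * c) Lh0.
- move=> n; rewrite fdiff_iter_shift_sum.
  under eq_bigr do rewrite hu.
  by rewrite sumr_const card_ord mulr_natl.
- by apply: le_trans Ah; rewrite ler_wpM2l ?(ltW r0) // ler_nat leq_subr.
have [r rQ rE] := @fact_multiple q Q1 (introT andP (conj q0 qQ)).
have := near_intM r hq; rewrite mulrA -natrM -rE => h1.
rewrite mulrCA; apply: near_intW h1.
rewrite /eps /Q2 -!mulrA; apply: ler_pM; [nneg | nneg | by rewrite ler_nat |].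
rewrite ler_wpM2l // -invfM -exprMn lef_pV2 ?posrE ?exprn_gt0 ?mulr_gt0 ?ltr0n //.
by rewrite lerXn2r ?nnegrE //; nneg.
Qed.

End WeylLeading.

(** * Iterated differences and derivatives *)

Section IteratedMVT.
Context {R : realType}.
Implicit Types (x y h : R).

Lemma mvt_ge (f f' : R -> R) (X x y : R) :
  (forall z, X <= z -> is_derive z 1 f (f' z)) -> X <= x -> x <= y ->
  exists2 c, x <= c <= y & f y - f x = f' c * (y - x).
Proof.
move=> df Xx; rewrite le_eqVlt => /predU1P[<-|xy].
  by exists x; rewrite ?lexx // !subrr mulr0.
have [z /[!in_itv]/= /andP[xz _]||z /[!in_itv]/= /andP[h1 h2] E] := @MVT R f f' x y xy _ _.
- by apply: df; apply: le_trans Xx (ltW xz).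
- apply: derivable_within_continuous => z /[!in_itv]/= /andP[xz _].
  by have [] := df z (le_trans Xx xz).
- by exists z => //; rewrite !ltW.
Qed.

Lemma is_derive_translate (f : R -> R) (h y d : R) :
  is_derive (y + h) 1 f d -> is_derive y 1 (fun z => f (z + h)) d.
Proof.
move=> df; have := @is_derive1_comp R f (shift h) y d 1 df (is_derive_shift y 1 h).
by rewrite mulr1.
Qed.

(** Induction through f(x + h) - f(x): its k-th difference is given by the induction hypothesis, and
    a mean value step on the k-th derivative supplies the last factor h. *)
Lemma iter_fdiff_mvt (k : nat) (f : nat -> R -> R) (X x h : R) :
  (forall i y, (i < k)%N -> X <= y -> is_derive y 1 (f i) (f i.+1 y)) ->
  X <= x -> 0 <= h ->
  exists2 z, x <= z <= x + k%:R * h &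
    iter k fdiff (fun n => f 0%N (x + h * n%:R)) 0%N = h ^+ k * f k z.
Proof.
elim: k f => [|k IHk] f df Xx h0.
  exists x; first by rewrite mul0r addr0 lexx.
  by rewrite /= mulr0 addr0 expr0 mul1r.
have [|z /andP[xz zx] zE] := IHk (fun i y => f i (y + h) - f i y) _ Xx h0.
  move=> i y ik Xy; apply: is_deriveB.
    by apply: is_derive_translate; apply: df; [exact: ltnW|rewrite ler_wpDr].
  by apply: df => //; exact: ltnW.
have [|||c /andP[zc cz] cE] := @mvt_ge (f k) (f k.+1) X z (z + h).
- by move=> y Xy; apply: df.
- exact: le_trans xz.
- by rewrite lerDl.
exists c.
  by rewrite (le_trans xz zc) -natr1 mulrDl mul1r addrA (le_trans cz) // lerD2r.
rewrite iterSr (_ : fdiff _ = (fun n => f 0%N (x + h * n%:R + h) - f 0%N (x + h * n%:R))); last first.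
  by apply/funext => n; rewrite /fdiff -addn1 natrD mulrDr mulr1 addrA.
rewrite zE cE (addrC z h) addrK exprSr; ring.
Qed.

(** The mean value form is explicit here, the k-th derivative being the constant k! p_k. *)
Lemma iter_fdiff_poly (k : nat) (p : {poly R}) (q M : R) (n : nat) : (size p <= k.+1)%N -> 0 <= q ->
  iter k fdiff (fun m => p.[q * m%:R + M]) n = q ^+ k * (p`_k *+ k`!).
Proof.
move=> sp q0.
have sh u j m : iter j fdiff u (m + n)%N = iter j fdiff (fun i => u (i + n)%N) m :> R.
  by elim: j m => // j IH m; rewrite !iterS /fdiff -!IH addSn.
have := sh (fun m => p.[q * m%:R + M]) k 0%N; rewrite add0n => ->.
pose x := q * n%:R + M.
have -> : (fun i => p.[q * (i + n)%:R + M]) = (fun i => p.[x + q * i%:R]).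
  by apply/funext => i; rewrite /x natrD; congr (p.[_]); ring.
have [i y _ _|z _ ->] := @iter_fdiff_mvt k (fun i y => (p^`(i)).[y]) x x q _ (lexx _) q0.
  rewrite derivnS.
  have -> : horner (p^`(i))^`() y = (horner p^`(i))^`()%classic y by rewrite derivE.
  by rewrite derive1E; apply: DeriveDef => //; exact: derivable_horner.
congr (_ * _); suff -> : p^`(k) = (p`_k *+ k`!)%:P by rewrite hornerC.
apply/polyP => i; rewrite coef_derivn coefC.
case: i => [|i]; first by rewrite addn0 ffactnn.
by rewrite nth_default ?mul0rn // (leq_trans sp) // addnS ltnS leq_addr.
Qed.

End IteratedMVT.

(** * Passing to progressions on which the leading term is nearly constant *)

Section PolynomialWeyl.
Context {R : realType}.
Implicit Types (p : {poly R}) (delta eta : R).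

Lemma sum_ord_mul (V : zmodType) (a b : nat) (F : nat -> V) :
  \sum_(m < a * b) F m = \sum_(i < a) \sum_(j < b) F (i * b + j)%N.
Proof.
elim: a => [|a IHa]; first by rewrite mul0n !big_ord0.
rewrite big_ord_recr /= -IHa -(big_mkord xpredT F) mulSn addnC.
rewrite (@big_cat_nat _ _ _ (a * b)) ?leq_addr //= big_mkord; congr (_ + _).
by rewrite -{1}[(a * b)%N]add0n big_addn addKn big_mkord; apply: eq_bigr => j _; rewrite addnC.
Qed.

(** The range is cut into runs of length l inside the residue classes mod q, with at most l q <=
    delta L / 4 terms left over. If every run had a sum below delta l / 2, the total would be below
    delta L. *)
Lemma large_cell (L l q : nat) (z : nat -> R[i]) delta : 0 < delta ->
  (forall n, normc (z n) <= 1) -> (0 < q)%N -> (0 < l)%N -> (0 < L)%N ->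
  4 * (q * l)%:R <= delta * L%:R ->
  delta * L%:R <= normc (\sum_(m < L) z m) ->
  exists i r, [/\ (i.+1 * (l * q) <= L)%N, (r < q)%N &
    delta / 2 * l%:R <= normc (\sum_(j < l) z ((i * l + j) * q + r)%N)].
Proof.
move=> d0 z1 q0 l0 L0 ql hS; pose n := (L %/ (l * q))%N.
have Lp : 0 < L%:R :> R by rewrite ltr0n.
have lq0 : (0 < l * q)%N by rewrite muln_gt0 l0.
have nL : (n * (l * q) <= L)%N by exact: leq_trunc_div.
have Ln : (L < n.+1 * (l * q))%N by exact: ltn_ceil.
apply: contrapT => nex.
have small (i : 'I_n) (r : 'I_q) :
    normc (\sum_(j < l) z ((i * l + j) * q + r)%N) <= delta / 2 * l%:R.
  rewrite leNgt; apply/negP => h; apply: nex; exists i, r; split => //; last exact: ltW.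
  by apply: leq_trans nL; rewrite leq_mul2r ltn_ord orbT.
have T : normc (\sum_(m < n * (l * q)) z m) <= delta / 2 * L%:R.
  rewrite mulnA sum_ord_mul.
  under eq_bigr => i _ do rewrite (eq_bigr (fun j : 'I_q => (fun i j => z (i * q + j)%N) (nat_of_ord i) j)) //.
  rewrite (sum_ord_mul n l (fun i => \sum_(j < q) z (i * q + j)%N)).
  under eq_bigr => i _ do rewrite exchange_big /=.
  apply: (le_trans (normc_sum_le _ _ _)).
  apply: (@le_trans _ _ (\sum_(i < n) \sum_(r < q) delta / 2 * l%:R)).
    apply: ler_sum => i _; apply: (le_trans (normc_sum_le _ _ _)).
    by apply: ler_sum => r _; exact: small.
  rewrite !sumr_const !card_ord -mulrnA -[leLHS]mulr_natr -mulrA -natrM.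
  rewrite ler_wpM2l ?divr_ge0 ?(ltW d0) // ler_nat; apply: leq_trans nL.
  by rewrite mulnA [leqRHS]mulnC.
have TT : normc (\sum_(n * (l * q) <= m < L) z m) <= (l * q)%:R.
  apply: (le_trans (normc_sum_le _ _ _)).
  apply: (@le_trans _ _ (\sum_(n * (l * q) <= m < L) 1)); first by apply: ler_sum.
  rewrite sumr_const_nat; rewrite ler_nat leq_subLR.
  by move: Ln; rewrite mulSn addnC => /ltnW.
have := normcD_le (\sum_(m < n * (l * q)) z m) (\sum_(n * (l * q) <= m < L) z m).
rewrite -[X in normc (X + _)](big_mkord xpredT z) -big_cat_nat //= big_mkord.
have := mulr_gt0 d0 Lp; move: hS ql T TT; rewrite [(q * l)%N]mulnC; clear; lra.
Qed.

Lemma natX_mod (a b c n : nat) : exists K, ((a + b * c) ^ n = a ^ n + b * K)%N.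
Proof.
elim: n => [|n [K hK]]; first by exists 0%N; rewrite muln0 addn0.
exists (c * a ^ n + (a + b * c) * K)%N; rewrite !expnS hK; ring.
Qed.

Lemma exprB_le (x y : R) (n : nat) : 0 <= y -> y <= x ->
  x ^+ n.+1 - y ^+ n.+1 <= n.+1%:R * x ^+ n * (x - y).
Proof.
move=> y0 yx; have x0 := le_trans y0 yx.
elim: n => [|n IHn]; first by rewrite !expr1 expr0 mulr1 mul1r.
have h1 : y ^+ n.+1 <= x ^+ n.+1 by rewrite lerXn2r ?nnegrE.
have h2 : y ^+ n.+1 * (x - y) <= x ^+ n.+1 * (x - y) by rewrite ler_wpM2r // subr_ge0.
have h3 := ler_wpM2l x0 IHn.
have -> : x ^+ n.+2 - y ^+ n.+2 = x * (x ^+ n.+1 - y ^+ n.+1) + y ^+ n.+1 * (x - y).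
  by rewrite !(exprS _ n.+1); ring.
have -> : n.+2%:R * x ^+ n.+1 * (x - y) = x * (n.+1%:R * x ^+ n * (x - y)) + x ^+ n.+1 * (x - y).
  by rewrite -[n.+2%:R]natr1 exprS; ring.
lra.
Qed.

(* On a progression of step q, if q c = a + eta then c n^(d+1) is constant mod 1 up to
   the contribution of eta. *)
Lemma leading_term_removal (d q q0 l M : nat) p (c : R) (a : int) (E : R) : (0 < q)%N ->
  (size p <= d.+1)%N -> (forall m, (m < l)%N ->
    `|q%:R * c - a%:~R| * d.+1%:R * (M + q * q0 * l)%:R ^+ d * (q * q0 * l)%:R <= E) ->
  normc (\sum_(m < l) expi (p.[(q * q0)%:R * m%:R + M%:R] + c * ((q * q0)%:R * m%:R + M%:R) ^+ d.+1))
   <= normc (\sum_(m < l) expi (p.[(q * q0)%:R * m%:R + M%:R])) + 8 * E * l%:R.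
Proof.
move=> q_gt0 sp hE; pose eta := q%:R * c - a%:~R.
have qr : 0 < q%:R :> R by rewrite ltr0n.
pose w := expi (c * M%:R ^+ d.+1).
pose n m := (M + q * (q0 * m))%N.
have nE m : (q * q0)%:R * m%:R + M%:R = (n m)%:R :> R by rewrite /n -!natrM -natrD mulnA addnC.
under eq_bigr do rewrite nE.
under [in leRHS]eq_bigr do rewrite nE.
have key (m : 'I_l) : normc (expi (c * (n m)%:R ^+ d.+1) - w) <= 8 * E.
  have [K hK] := natX_mod M q (q0 * m) d.+1.
  have mono : M%:R <= (n m)%:R :> R by rewrite ler_nat leq_addr.
  have -> : expi (c * (n m)%:R ^+ d.+1) =
      expi (c * M%:R ^+ d.+1 + eta / q%:R * ((n m)%:R ^+ d.+1 - M%:R ^+ d.+1)).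
    have -> : c * (n m)%:R ^+ d.+1 = a%:~R * K%:R + (c * M%:R ^+ d.+1 +
        eta / q%:R * ((n m)%:R ^+ d.+1 - M%:R ^+ d.+1)).
      have -> : (n m)%:R ^+ d.+1 = M%:R ^+ d.+1 + q%:R * K%:R :> R.
        by rewrite -!natrX hK natrD natrM.
      by rewrite /eta; field; rewrite gt_eqF.
    by rewrite expiD -[K%:R]/((Posz K)%:~R) -intrM expi_int mul1r.
  apply: (le_trans (expi_lip _ _)); rewrite addrAC subrr add0r ler_pM2l //.
  rewrite normrM normrM normfV (ger0_norm (ltW qr)).
  have D0 : 0 <= (n m)%:R ^+ d.+1 - M%:R ^+ d.+1 :> R.
    by rewrite subr_ge0 lerXn2r ?nnegrE.
  rewrite (ger0_norm D0); apply: le_trans (hE m (ltn_ord m)); rewrite -/eta.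
  rewrite -!mulrA ler_wpM2l // mulrC ler_pdivrMr // .
  apply: (le_trans (exprB_le _ _ _)) => //; rewrite mulrA.
  have nl : (n m)%:R <= (M + q * q0 * l)%:R :> R.
    by rewrite ler_nat /n leq_add2l mulnA leq_mul2l ltnW ?orbT.
  apply: (@le_trans _ _ (d.+1%:R * (M + q * q0 * l)%:R ^+ d * (q * q0 * l)%:R)).
    apply: ler_pM; first by nneg.
    - by rewrite subr_ge0.
    - by rewrite ler_wpM2l // lerXn2r ?nnegrE.
    by rewrite -natrB ?leq_addr // ler_nat; rewrite /n addKn mulnA leq_mul2l ltnW ?orbT.
  by rewrite -mulrA ler_peMr ?ler1n //; nneg.
have -> : normc (\sum_(m < l) expi p.[(n m)%:R]) = normc (w * \sum_(m < l) expi p.[(n m)%:R]).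
  by rewrite normcM normc_expi mul1r.
have -> : \sum_(m < l) expi (p.[(n m)%:R] + c * (n m)%:R ^+ d.+1) =
    w * \sum_(m < l) expi p.[(n m)%:R] +
    \sum_(m < l) expi p.[(n m)%:R] * (expi (c * (n m)%:R ^+ d.+1) - w).
  by rewrite mulr_sumr -big_split /=; apply: eq_bigr => m _; rewrite expiD; ring.
apply: (le_trans (normcD_le _ _)); rewrite lerD2l.
apply: (le_trans (normc_sum_le _ _ _)).
rewrite mulr_natr -[X in _ *+ X]card_ord -sumr_const; apply: ler_sum => m _.
by rewrite normcM normc_expi mul1r key.
Qed.

End PolynomialWeyl.

(** * Weyl's inequality in inverse form, for all nonconstant coefficients *)

Section PolynomialWeylInverse.
Context {R : realType}.
Implicit Types (p : {poly R}) (delta eta : R).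

Lemma horner_leading (d : nat) p (x : R) : (size p <= d.+2)%N ->
  p.[x] = (take_poly d.+1 p).[x] + p`_d.+1 * x ^+ d.+1.
Proof.
move=> sp; rewrite -[p in LHS](poly_take_drop d.+1 p) hornerD hornerM hornerXn.
congr (_ + _ * _); rewrite [drop_poly _ _]size1_polyC; last first.
  by rewrite size_drop_poly leq_subLR addn1.
by rewrite hornerC coef_drop_poly.
Qed.

Lemma nat_above (x : R) : exists2 n : nat, (0 < n)%N & x <= n%:R.
Proof. by exists (Num.truncn x).+1 => //; apply/ltW/truncnS_gt. Qed.

Lemma block_length (sigma : R) (L : nat) : 0 < sigma -> 2 <= sigma * L%:R ->
  exists l : nat, [/\ (0 < l)%N, l%:R <= sigma * L%:R & sigma / 2 * L%:R <= l%:R].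
Proof.
move=> s0 sL; exists (Num.truncn (sigma * L%:R)).
have h1 : (Num.truncn (sigma * L%:R))%:R <= sigma * L%:R by rewrite truncn_le //; lra.
have h2 : sigma * L%:R < (Num.truncn (sigma * L%:R))%:R + 1.
  by rewrite natr1; exact: truncnS_gt.
by split => //; [rewrite -(ltr_nat R) | ]; lra.
Qed.

Lemma polynomial_weyl_inverse (d : nat) delta (D : nat) : 0 < delta -> (0 < D)%N ->
  exists2 Q : nat, (0 < Q)%N & forall p (L q M : nat), (size p <= d.+1)%N ->
    (0 < L)%N -> (0 < q <= D)%N -> (M <= D * L)%N ->
    delta * L%:R <= normc (\sum_(m < L) expi p.[q%:R * m%:R + M%:R]) ->
    exists2 q' : nat, (0 < q' <= Q)%N & forall j, (0 < j <= d)%N ->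
      near_int (q'%:R * p`_j) (Q%:R / L%:R ^+ j).
Proof.
elim: d delta D => [|d IHd] delta D d0 D0.
  by exists 1%N => // p L q M _ _ _ _ _; exists 1%N => // j; case: j.
have [Q1 Q10 V] := @weyl_leading R d delta d0.
(* Bounds q2 = q1 (d+1)! q^(d+1): q1 comes from [weyl_leading], and the rest is the factor between
   the (d+1)-st difference and the leading coefficient. *)
pose D2 := (Q1 * (d.+1)`! * D ^ d.+1)%N.
have D20 : (0 < D2)%N by rewrite !muln_gt0 Q10 fact_gt0 expn_gt0 D0.
pose Z : R := D2%:R + D2%:R * (Q1%:R * (d.+1%:R * (3 * D)%:R ^+ d * D%:R)).
have D2r : 1 <= D2%:R :> R by rewrite ler1n.
have Z1 : 1 <= Z by rewrite /Z; apply: (le_trans D2r); rewrite lerDl; nneg.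
have Z0 : 0 < Z by lra.
(* Runs of length at most sigma L: the leading phase then drifts by at most delta / 64 along a run,
   and 4 q2 l <= delta L as [large_cell] requires. *)
pose sigma := delta / (64 * Z).
have s0 : 0 < sigma by rewrite divr_gt0 // mulr_gt0.
have sZ : sigma * Z * 64 = delta by rewrite /sigma; field; rewrite gt_eqF.
have [L0 L00 hL0] := nat_above (2 / sigma).
have [X X0 hX] := nat_above (6 * D%:R / sigma).
have d4 : 0 < delta / 4 by rewrite divr_gt0.
have D'0 : (0 < D * D2 + X)%N by rewrite addn_gt0 X0 orbT.
have [Q3 Q30 IH] := IHd (delta / 4) (D * D2 + X)%N d4 D'0.
have [Y Y0 hY] := nat_above (D2%:R * Q3%:R * ((2 / sigma) ^+ d.+1 + 1)).
pose Q := (D2 * Q3 + Y + Q3 * Q1 + L0 ^ d.+1)%N.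
exists Q; first by rewrite /Q -!addnA addn_gt0 muln_gt0 D20 Q30.
move=> p L q M sp Lp /andP[q0 qD] MD hS.
have Lr : 0 < L%:R :> R by rewrite ltr0n.
have L1 : 1 <= L%:R :> R by rewrite ler1n.
have [LL0|LL0] := ltnP L L0.
  exists 1%N; first by rewrite /= /Q -!addnA addn_gt0 muln_gt0 D20 Q30.
  move=> j /andP[j0 jd]; rewrite mul1r; apply: near_intW (near_int_half _).
  rewrite ler_pdivlMr ?exprn_gt0 //; apply: (@le_trans _ _ (L%:R ^+ d.+1)).
    have h1 : L%:R ^+ j <= L%:R ^+ d.+1 :> R by rewrite ler_weXn2l.
    have : 0 <= L%:R ^+ j :> R by nneg.
    by move: h1; clear; lra.
  rewrite -natrX ler_nat; apply: leq_trans (leq_addl _ _).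
  by rewrite leq_exp2r // ltnW.
have L0r : L0%:R <= L%:R :> R by rewrite ler_nat.
have sL : 2 <= sigma * L%:R.
  by rewrite mulrC -ler_pdivrMr //; apply: (le_trans hL0).
have [l [l0 ls sl]] := block_length s0 sL.
have [|q1 /andP[q10 q1Q] [a ha]] := V L (fun m => p.[q%:R * m%:R + M%:R])
  (q%:R ^+ d.+1 * (p`_d.+1 *+ (d.+1)`!)) Lp _ hS.
  by move=> n; apply: iter_fdiff_poly.
pose q2 := (q1 * (d.+1)`! * q ^ d.+1)%N.
have q20 : (0 < q2)%N by rewrite !muln_gt0 q10 fact_gt0 expn_gt0 q0.
have q2D : (q2 <= D2)%N.
  by rewrite /q2 /D2 !leq_mul // leq_exp2r.
have q2r : q2%:R <= D2%:R :> R by rewrite ler_nat.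
have hq2 : `|q2%:R * p`_d.+1 - a%:~R| <= Q1%:R / L%:R ^+ d.+1.
  apply: le_trans ha; rewrite le_eqVlt; apply/orP; left; apply/eqP; congr `|_ - _|.
  by rewrite /q2 (natrM _ (q1 * _)) (natrM _ q1) natrX -[p`_d.+1 *+ _]mulr_natr; ring.
clearbody q2 D2.
have sD2 : sigma * D2%:R <= sigma * Z.
  by rewrite ler_wpM2l ?(ltW s0) // /Z lerDl; nneg.
have ql4 : 4 * (q2 * l)%:R <= delta * L%:R.
  rewrite natrM; apply: (@le_trans _ _ (4 * (D2%:R * (sigma * L%:R)))).
    by rewrite ler_wpM2l //; apply: ler_pM.
  by have := ler_wpM2r (ltW Lr) sD2; rewrite -sZ; have := mulr_gt0 (mulr_gt0 s0 Z0) Lr; clear; lra.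
have e1 m : normc (expi p.[q%:R * m%:R + M%:R]) <= 1 by rewrite normc_expi.
have [i [r [iL rq hcell]]] := large_cell d0 e1 q20 l0 Lp ql4 hS.
pose M' := (q * (i * l * q2 + r) + M)%N.
have {}hcell : delta / 2 * l%:R <= normc (\sum_(m < l) expi ((take_poly d.+1 p).[(q2 * q)%:R * m%:R + M'%:R]
     + p`_d.+1 * ((q2 * q)%:R * m%:R + M'%:R) ^+ d.+1)).
  apply: (le_trans hcell); rewrite le_eqVlt; apply/orP; left; apply/eqP; congr normc.
  apply: eq_bigr => m _; rewrite -horner_leading //; congr (expi p.[_]).
  by rewrite /M' !(natrD, natrM); ring.
have M'D : (M' + q2 * q * l <= 3 * D * L)%N.
  have h : ((i * l * q2 + r) + q2 * l <= 2 * L)%N.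
    have := iL; rewrite mulSn mulnA; have : (r <= l * q2)%N.
      by apply: leq_trans (ltnW rq) _; rewrite leq_pmull.
    rewrite (mulnC q2 l); clear; lia.
  apply: (@leq_trans (D * (2 * L) + D * L)); last by apply/eq_leq; ring.
  rewrite /M' addnAC; apply: leq_add => //.
  have -> : (q * (i * l * q2 + r) + q2 * q * l = q * (i * l * q2 + r + q2 * l))%N by ring.
  exact: leq_mul.
pose E : R := delta / 64.
have hE m : (m < l)%N -> `|q2%:R * p`_d.+1 - a%:~R| * d.+1%:R * (M' + q2 * q * l)%:R ^+ d * (q2 * q * l)%:R <= E.
  move=> _; apply: (@le_trans _ _ (Q1%:R / L%:R ^+ d.+1 * d.+1%:R * (3 * D * L)%:R ^+ d * (D2%:R * D%:R * (sigma * L%:R)))).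
    apply: ler_pM; [nneg | nneg | |].
    - apply: ler_pM; [nneg | nneg | |].
      + by rewrite ler_wpM2r.
      + by rewrite lerXn2r ?nnegrE // ler_nat.
    - rewrite !natrM; apply: ler_pM; [nneg | nneg | | exact: ls].
      by apply: ler_pM => //; rewrite ler_nat.
  have Ld : 0 < L%:R ^+ d :> R by rewrite exprn_gt0.
  have -> : Q1%:R / L%:R ^+ d.+1 * d.+1%:R * (3 * D * L)%:R ^+ d * (D2%:R * D%:R * (sigma * L%:R))
     = sigma * (Z - D2%:R) :> R.
    rewrite (natrM _ _ L) exprMn exprS /Z; field.
    by rewrite gt_eqF //= gt_eqF.
  have := mulr_gt0 s0 (lt_le_trans ltr01 D2r); move: sZ; rewrite /E; clearbody sigma Z; clear; lra.
have {}hcell := le_trans hcell (leading_term_removal q20 (size_take_poly _ _) hE).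
have {}hcell : delta / 4 * l%:R <= normc (\sum_(m < l) expi (take_poly d.+1 p).[(q2 * q)%:R * m%:R + M'%:R]).
  have : 0 <= l%:R :> R by [].
  have := d0; move: hcell; rewrite /E; clear; nra.
have M'l : (M' <= X * l)%N.
  apply: leq_trans (leq_trans (leq_addr _ _) M'D) _.
  rewrite -(ler_nat R) !natrM; have lr : 0 <= l%:R :> R by [].
  apply: le_trans (ler_wpM2r lr hX); rewrite [leRHS]mulrAC ler_pdivlMr //.
  have D1 : 0 <= D%:R :> R by [].
  have := ler_wpM2r D1 sl; clear; lra.
have lr0 : 0 < l%:R :> R by rewrite ltr0n.
have [||q3 /andP[q30 q3Q] hq3] := IH (take_poly d.+1 p) l (q2 * q)%N M' (size_take_poly _ _) l0 _ _ hcell.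
- rewrite muln_gt0 q20 q0 /=; apply: leq_trans (leq_addr _ _).
  by rewrite mulnC leq_mul.
- by apply: (leq_trans M'l); rewrite leq_mul2r leq_addl orbT.
exists (q2 * q3)%N.
  rewrite muln_gt0 q20 q30 /= /Q -!addnA; apply: leq_trans (leq_addr _ _).
  exact: leq_mul.
move=> j /andP[j0 jd].
have Q3r : q3%:R <= Q3%:R :> R by rewrite ler_nat.
(* The coefficient of index d + 1 is already located; the lower ones come from the induction
   hypothesis, where replacing l by L costs a power of 2 / sigma. *)
have [jd1|jd1] := leqP j d; last first.
  have {jd1}-> : j = d.+1 by apply/eqP; rewrite eqn_leq jd jd1.
  rewrite mulnC natrM -mulrA; apply: near_intW (near_intM q3 (ex_intro _ a hq2)).
  rewrite mulrA; apply: ler_wpM2r; first by nneg.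
  rewrite -natrM ler_nat /Q.
  by rewrite (leq_trans (leq_mul q3Q (leqnn Q1))) // -[leqLHS]add0n -addnA leq_add // leq_addr.
have := near_intM q2 (hq3 j (introT andP (conj j0 jd1))).
rewrite coef_take_poly ltnS jd1 mulrA -natrM; apply: near_intW.
have sl' : L%:R <= 2 / sigma * l%:R.
  rewrite mulrAC ler_pdivlMr //; move: sl; clear; lra.
have b1 : L%:R ^+ j <= ((2 / sigma) ^+ d.+1 + 1) * l%:R ^+ j.
  apply: (@le_trans _ _ ((2 / sigma) ^+ j * l%:R ^+ j)).
    rewrite -exprMn lerXn2r ?nnegrE //; nneg.
  apply: ler_wpM2r; first by nneg.
  have t0 : 0 <= 2 / sigma by nneg.
  have [t1|t1] := leP 1 (2 / sigma).
    by rewrite ler_wpDr // ler_weXn2l.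
  rewrite ler_wpDl //; first by nneg.
  by apply: exprn_ile1 => //; exact: ltW.
rewrite ler_pdivlMr ?exprn_gt0 // mulrA mulrAC ler_pdivrMr ?exprn_gt0 //.
apply: (@le_trans _ _ (D2%:R * Q3%:R * ((2 / sigma) ^+ d.+1 + 1) * l%:R ^+ j)).
  rewrite -[leRHS]mulrA; apply: ler_pM => //.
  by rewrite ler_wpM2r.
apply: ler_wpM2r; first by nneg.
by apply: (le_trans hY); rewrite ler_nat /Q -!addnA addnCA leq_addr.
Qed.

End PolynomialWeylInverse.

(** * Calculus on half-lines *)

Section Calculus.
Context {R : realType}.
Implicit Types (f g : R -> R) (x y c C : R).

Lemma der_mul f g x a b : is_derive x 1 f a -> is_derive x 1 g b ->
  is_derive x 1 (fun y => f y * g y) (f x * b + a * g x).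
Proof.
move=> df dg; have := is_deriveM df dg.
by rewrite [g x *: a]mulrC.
Qed.

Lemma der_sub f g x a b : is_derive x 1 f a -> is_derive x 1 g b ->
  is_derive x 1 (fun y => f y - g y) (a - b).
Proof. by move=> df dg; exact: is_deriveB. Qed.

Lemma der_add f g x a b : is_derive x 1 f a -> is_derive x 1 g b ->
  is_derive x 1 (fun y => f y + g y) (a + b).
Proof. by move=> df dg; exact: is_deriveD. Qed.

Lemma der_opp f x a : is_derive x 1 f a -> is_derive x 1 (fun y => - f y) (- a).
Proof. by move=> df; exact: is_deriveN. Qed.

Lemma der_cst c x : is_derive x 1 (fun _ : R => c) 0.
Proof. exact: is_derive_cst. Qed.

Lemma der_id x : is_derive x 1 (fun y : R => y) 1.
Proof. exact: is_derive_id. Qed.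

Lemma der_scale f x a c : is_derive x 1 f a -> is_derive x 1 (fun y => c * f y) (c * a).
Proof. by move=> df; have := der_mul (der_cst c x) df; rewrite mul0r addr0. Qed.

Lemma der_pow (n : nat) x : is_derive x 1 (fun y : R => y ^+ n) (n%:R * x ^+ n.-1).
Proof.
have := @is_deriveX R R id n x 1 1 (is_derive_id x 1).
by rewrite exprfctE /GRing.scale /= mulr1.
Qed.

Lemma der_inv f x a : f x != 0 -> is_derive x 1 f a ->
  is_derive x 1 (fun y => (f y)^-1) (- a / f x ^+ 2).
Proof.
move=> fx df; have := is_deriveV fx df.
by rewrite /GRing.scale /= mulNr mulrC -mulNr.
Qed.

(** Equivalent to nearness at +oo by [evyP]; the explicit half-line provides a threshold beyond
    which mean value arguments can be run. *)
Definition evy (P : R -> Prop) : Prop := exists A : R, forall x, A <= x -> P x.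

Lemma evy_and (P Q : R -> Prop) : evy P -> evy Q -> evy (fun x => P x /\ Q x).
Proof.
move=> [A hA] [B hB]; exists (Num.max A B) => x; rewrite ge_max => /andP[? ?].
by split; [exact: hA | exact: hB].
Qed.

Lemma evy_imp (P Q : R -> Prop) : evy P -> (forall x, P x -> Q x) -> evy Q.
Proof. by move=> [A hA] PQ; exists A => x /hA/PQ. Qed.

Lemma evy_ge c : evy (fun x => c <= x).
Proof. by exists c. Qed.

Lemma evyP (P : R -> Prop) : (\forall x \near +oo, P x) <-> evy P.
Proof.
split=> [[M [_ hM]]|[A hA]].
  by exists (M + 1) => x Mx; apply: hM; rewrite (lt_le_trans _ Mx) // ltrDl.
by exists A; split; [exact: num_real | move=> x /ltW/hA].
Qed.

Lemma evy_ex (P : R -> Prop) (A : R) : evy P -> exists2 x, A <= x & P x.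
Proof.
move=> [B hB]; exists (Num.max A B); first by rewrite le_max lexx.
by apply: hB; rewrite le_max lexx orbT.
Qed.

Lemma evy_false : ~ evy (fun _ => False).
Proof. by move=> [A hA]; exact: (hA A (lexx _)). Qed.

Lemma der_ge0_mono f (f' : R -> R) (A : R) x y :
  (forall z, A <= z -> is_derive z 1 f (f' z)) ->
  (forall z, A <= z -> 0 <= f' z) -> A <= x -> x <= y -> f x <= f y.
Proof.
move=> df f0 Ax xy; have [c /andP[xc cy] E] := mvt_ge df Ax xy.
by rewrite -subr_ge0 E mulr_ge0 ?subr_ge0 // f0 // (le_trans Ax).
Qed.

Lemma der_le0_mono f (f' : R -> R) (A : R) x y :
  (forall z, A <= z -> is_derive z 1 f (f' z)) ->
  (forall z, A <= z -> f' z <= 0) -> A <= x -> x <= y -> f y <= f x.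
Proof.
move=> df f0 Ax xy; have [c /andP[xc cy] E] := mvt_ge df Ax xy.
by rewrite -subr_le0 E mulr_le0_ge0 ?subr_ge0 // f0 // (le_trans Ax).
Qed.

Lemma evy_pow_big (n : nat) C : evy (fun x => C <= x ^+ n.+1).
Proof.
apply: evy_imp (evy_ge (Num.max 1 C)) _ => x; rewrite ge_max => /andP[x1 Cx].
by apply: (le_trans Cx); rewrite exprS ler_peMr ?exprn_ege1 //; lra.
Qed.

(** With k = c / (n+1) the function f - k x^(n+1) is nondecreasing; halving k absorbs its initial
    value. *)
Lemma integ_lower f (f' : R -> R) c (n : nat) : 0 < c ->
  evy (fun x => is_derive x 1 f (f' x)) -> evy (fun x => c * x ^+ n <= f' x) ->
  exists2 c', 0 < c' & evy (fun x => c' * x ^+ n.+1 <= f x).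
Proof.
move=> c0 df hf; have [A hA] := evy_and df hf.
pose k := c / n.+1%:R; have k0 : 0 < k by rewrite divr_gt0.
have m y : A <= y -> f A - k * A ^+ n.+1 <= f y - k * y ^+ n.+1.
  move=> Ay; apply: (@der_ge0_mono (fun y => f y - k * y ^+ n.+1)
    (fun y => f' y - k * (n.+1%:R * y ^+ n)) A A y) => //.
    move=> z /hA[dfz _]; apply: (der_sub dfz); apply: der_scale; exact: der_pow.
  move=> z /hA[_ h]; rewrite subr_ge0; apply: le_trans h.
  by rewrite mulrA /k divfK.
exists (k / 2); first by rewrite divr_gt0.
have [B hB] := evy_and (evy_ge A) (evy_pow_big n (2 * (k * A ^+ n.+1 - f A) / k)).
exists B => x /hB[Ax]; rewrite ler_pdivrMr // => h.
by have := m x Ax; move: h; clear; lra.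
Qed.

End Calculus.

(** * Signs, monotonicity and logarithmic derivatives in a Hardy field *)

Section HardyField.
Context {R : realType} (H : set (R -> R)) (HH : hardy_field H).
Implicit Types (f g : R -> R) (x y c C : R).

Lemma hardy_evy_eq f g : H f -> evy (fun x => f x = g x) -> H g.
Proof. by move=> Hf fg; apply: (hardy_sat HH Hf); exact/evyP. Qed.

Lemma hardy0 : H (fun=> 0).
Proof.
apply: hardy_evy_eq (hardyB HH (hardy1 HH) (hardy1 HH)) _.
by exists 0 => x _; rewrite subrr.
Qed.

Lemma hardyN f : H f -> H (fun x => - f x).
Proof.
move=> Hf; apply: hardy_evy_eq (hardyB HH hardy0 Hf) _.
by exists 0 => x _; rewrite sub0r.
Qed.

Lemma hardyD f g : H f -> H g -> H (fun x => f x + g x).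
Proof.
move=> Hf Hg; apply: hardy_evy_eq (hardyB HH Hf (hardyN Hg)) _.
by exists 0 => x _; rewrite opprK.
Qed.

Lemma hardy_nat (n : nat) : H (fun=> n%:R).
Proof.
elim: n => [|n IHn]; first exact: hardy0.
apply: hardy_evy_eq (hardyD IHn (hardy1 HH)) _.
by exists 0 => x _; rewrite natr1.
Qed.

Lemma hardy_int (m : int) : H (fun=> m%:~R).
Proof.
case: m => n; first exact: hardy_nat.
apply: hardy_evy_eq (hardyN (hardy_nat n.+1)) _.
by exists 0 => x _; rewrite NegzE mulrNz.
Qed.

Lemma hardy_is_derive f : H f -> evy (fun x => is_derive x 1 f (derive1 f x)).
Proof.
move=> Hf; have /evyP d := hardy_derivable HH Hf; apply: evy_imp d _ => x dx.
by rewrite derive1E; exact: DeriveDef.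
Qed.

(** A nonzero element has an inverse in the field, hence no zeros near +oo, and by continuity it
    keeps one sign there. *)
Lemma hardy_sign f : H f ->
  [\/ evy (fun x => 0 < f x), evy (fun x => f x < 0) | evy (fun x => f x = 0)].
Proof.
move=> Hf; have [f0|nf0] := EM (germ_eq f (fun=> 0)).
  by apply: Or33; apply/evyP.
have [g Hg /evyP fg] := hardyV HH Hf nf0.
have [A hA] := evy_and fg (hardy_is_derive Hf).
have nz x : A <= x -> f x != 0.
  move=> /hA[E _]; apply/eqP => fx; move: E; rewrite fx mul0r => /esym/eqP.
  by rewrite oner_eq0.
have sgn x y : A <= x -> x <= y -> 0 <= f x * f y.
  move=> Ax xy; rewrite leNgt; apply/negP => neg.
  have [||c /[!in_itv]/= /andP[xc cy] fc] := @IVT R f x y 0 xy.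
  - apply: derivable_within_continuous => z /[!in_itv]/= /andP[xz _].
    by have [_ []] := hA z (le_trans Ax xz).
  - by rewrite ge_min le_max; move: neg; clear; nra.
  - by have := nz c (le_trans Ax xc); rewrite fc eqxx.
have [fA|fA|fA] := ltgtP 0 (f A).
- apply: Or31; exists A => x Ax; have := sgn A x (lexx _) Ax.
  by rewrite pmulr_rge0 // le_eqVlt eq_sym (negPf (nz x Ax)).
- apply: Or32; exists A => x Ax; have := sgn A x (lexx _) Ax.
  by rewrite nmulr_rge0 // le_eqVlt (negPf (nz x Ax)).
- by have := nz A (lexx _); rewrite -fA eqxx.
Qed.

Lemma hardy_sign_le f : H f -> evy (fun x => 0 <= f x) \/ evy (fun x => f x <= 0).
Proof.
move=> /hardy_sign[] h; [left|right|left]; apply: evy_imp h _ => x; try exact: ltW.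
by move=> ->.
Qed.

Lemma hardy_div f g : H f -> H g -> evy (fun x => g x != 0) ->
  exists2 q, H q & evy (fun x => q x = f x / g x).
Proof.
move=> Hf Hg g0; have ng : ~ germ_eq g (fun=> 0).
  move=> /evyP h; apply: (@evy_false R).
  by apply: evy_imp (evy_and g0 h) _ => x [h1 h2]; rewrite h2 eqxx in h1.
have [k Hk /evyP gk] := hardyV HH Hg ng.
exists (fun x => f x * k x); first exact: hardyM.
apply: evy_imp (evy_and g0 gk) _ => x [gx E]; congr (_ * _).
by apply: (mulfI gx); rewrite E divff.
Qed.

(* The identity function need not belong to H, so x g' - m g is not an element of H;
   but m g / g' - x has a derivative in H. *)
Lemma hardy_euler_sign g (m : int) : H g ->
  evy (fun x => 0 <= x * derive1 g x - m%:~R * g x) \/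
  evy (fun x => x * derive1 g x - m%:~R * g x <= 0).
Proof.
move=> Hg; have Hg' := hardy_derive HH Hg.
have nonzero : evy (fun x => derive1 g x != 0) ->
    evy (fun x => 0 <= m%:~R * g x / derive1 g x - x) \/
    evy (fun x => m%:~R * g x / derive1 g x - x <= 0).
  move=> g'0; have [q Hq qE] := hardy_div (hardyM HH (hardy_int m) Hg) Hg' g'0.
  have Hd := hardyB HH (hardy_derive HH Hq) (hardy1 HH).
  have dq : evy (fun x => is_derive x 1 (fun y => q y - y) (derive1 q x - 1)).
    by apply: evy_imp (hardy_is_derive Hq) _ => x dx; apply: der_sub => //; exact: der_id.
  (* q' - 1 lies in H and has a sign, so q - x is monotone and changes sign at most once. *)
  have sg : evy (fun x => 0 <= q x - x) \/ evy (fun x => q x - x <= 0).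
    have [pos|neg] := hardy_sign_le Hd.
      have [A hA] := evy_and dq pos.
      have [[x Ax qx]|nex] := EM (exists2 x, A <= x & 0 <= q x - x).
        left; exists x => y xy; apply: (le_trans qx).
        by apply: (@der_ge0_mono _ (fun y => q y - y) (fun y => derive1 q y - 1) A) => // z /hA[].
      right; exists A => x Ax; rewrite leNgt; apply/negP => h; apply: nex.
      by exists x => //; exact: ltW.
    have [A hA] := evy_and dq neg.
    have [[x Ax qx]|nex] := EM (exists2 x, A <= x & q x - x <= 0).
      right; exists x => y xy; apply: le_trans qx.
      by apply: (@der_le0_mono _ (fun y => q y - y) (fun y => derive1 q y - 1) A) => // z /hA[].
    left; exists A => x Ax; rewrite leNgt; apply/negP => h; apply: nex.
    by exists x => //; exact: ltW.
  by case: sg => h; [left|right]; apply: evy_imp (evy_and qE h) _ => x [<-].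
have [pos|neg|zero] := hardy_sign Hg'.
- have nz : evy (fun x => derive1 g x != 0) by apply: evy_imp pos _ => x /lt0r_neq0.
  case: (nonzero nz) => h; [right|left]; apply: evy_imp (evy_and pos h) _ => x [g0].
    by rewrite subr_ge0 ler_pdivlMr // subr_le0.
  by rewrite subr_le0 ler_pdivrMr // subr_ge0.
- have nz : evy (fun x => derive1 g x != 0) by apply: evy_imp neg _ => x /ltr0_neq0.
  case: (nonzero nz) => h; [left|right]; apply: evy_imp (evy_and neg h) _ => x [g0].
    by rewrite subr_ge0 ler_ndivlMr // subr_ge0.
  by rewrite subr_le0 ler_ndivrMr // subr_le0.
have [h|h] := hardy_sign_le (hardyM HH (hardy_int (- m)) Hg); [left|right];
  by apply: evy_imp (evy_and zero h) _ => x [-> ]; rewrite mulr0 sub0r intrN mulNr.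
Qed.

(** The derivative of x^m f is x^(m-1) (x f' + m f), whose sign is settled by [hardy_euler_sign] at
    -m. So x^m f is eventually monotone: it tends to +oo or is bounded above. *)
Lemma hardy_pow_mono f (m : nat) : H f -> evy (fun x => 0 < f x) ->
  (forall B, evy (fun x => B <= x ^+ m * f x)) \/ (exists C, evy (fun x => x ^+ m * f x <= C)).
Proof.
move=> Hf fpos; pose F x := x ^+ m * f x.
pose F' x := x ^+ m * derive1 f x + m%:R * x ^+ m.-1 * f x.
have dF : evy (fun x => is_derive x 1 F (F' x)).
  by apply: evy_imp (hardy_is_derive Hf) _ => x dx; apply: der_mul => //; exact: der_pow.
have F'E x : x != 0 -> F' x = x ^+ m.-1 * (x * derive1 f x - (- m%:Z)%:~R * f x) \/ m = 0%N.
  move=> x0; rewrite /F'; case: m {F F' dF} => [|n]; [by right|left].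
  by rewrite /= exprS intrN -[n.+1%:Z%:~R]/(n.+1%:R); ring.
have sgnF : evy (fun x => 0 <= F' x) \/ evy (fun x => F' x <= 0).
  have [m0|m0] := eqVneq m 0%N.
    have E x : F' x = derive1 f x by rewrite /F' m0 expr0 mul1r mul0r mul0r addr0.
    have [h|h] := hardy_sign_le (hardy_derive HH Hf); [left|right];
      by apply: evy_imp h _ => x; rewrite E.
  have [h|h] := hardy_euler_sign (- m%:Z) Hf; [left|right];
    apply: evy_imp (evy_and (evy_ge 1) h) _ => x [x1 hx];
    (have [|->|m0'] := F'E x; [by rewrite gt_eqF //; lra | | by rewrite m0' in m0]).
    by rewrite mulr_ge0 // exprn_ge0 //; lra.
  by rewrite mulr_ge0_le0 // exprn_ge0 //; lra.
case: sgnF => h.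
  have [A hA] := evy_and dF h.
  have mono x y : A <= x -> x <= y -> F x <= F y.
    by apply: (@der_ge0_mono _ F F' A) => z /hA[].
  have [bd|nbd] := EM (exists C, evy (fun x => F x <= C)); [by right|left].
  move=> B; apply: contrapT => nB; apply: nbd; exists B; exists A => x Ax.
  rewrite leNgt; apply/negP => h1; apply: nB; exists x => y xy.
  by apply: (le_trans (ltW h1)); exact: mono.
right; have [A hA] := evy_and dF h; exists (F A), A => x Ax.
by apply: (@der_le0_mono _ F F' A) => // z /hA[].
Qed.

Definition tends0 f := forall e, 0 < e -> evy (fun x => `|f x| <= e).

(** Elements are eventually monotone. A positive nondecreasing one stays above one of its values; a
    nonincreasing one that does not tend to 0 stays above some e. *)
Lemma hardy_not_tends0 f : H f -> ~ tends0 f -> exists2 c, 0 < c & evy (fun x => c <= `|f x|).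
Proof.
move=> Hf nt; wlog fpos : f Hf nt / evy (fun x => 0 < f x).
  move=> W; have [h|h|h] := hardy_sign Hf.
  - exact: W.
  - have [||c c0 hc] := W _ (hardyN Hf).
    + by move=> t; apply: nt => e e0; apply: evy_imp (t e e0) _ => x; rewrite normrN.
    + by apply: evy_imp h _ => x; rewrite oppr_gt0.
    by exists c => //; apply: evy_imp hc _ => x; rewrite normrN.
  - by exfalso; apply: nt => e e0; apply: evy_imp h _ => x ->; rewrite normr0 ltW.
have [ge|le] := hardy_sign_le (hardy_derive HH Hf).
  have [A hA] := evy_and (hardy_is_derive Hf) (evy_and ge fpos).
  exists (f A); first by have [_ []] := hA A (lexx _).
  exists A => x Ax; apply: le_trans (ler_norm _).
  by apply: (@der_ge0_mono _ f (derive1 f) A) => // z /hA[? []].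
have [A hA] := evy_and (hardy_is_derive Hf) (evy_and le fpos).
apply: contrapT => nc; apply: nt => e e0; apply: contrapT => ne; apply: nc.
exists e => //; exists A => x Ax; rewrite leNgt; apply/negP => hx; apply: ne.
exists x => y xy; have [_ [_ fy]] := hA y (le_trans Ax xy).
rewrite gtr0_norm //; apply: le_trans (ltW (le_lt_trans (ler_norm _) hx)).
by apply: (@der_le0_mono _ f (derive1 f) A) => // z /hA[? []].
Qed.

End HardyField.

(** Otherwise x^(m+1) g would be nonincreasing, hence bounded above. *)
Lemma hardy_euler_lower {R : realType} (H : set (R -> R)) (HH : hardy_field H)
    (g : R -> R) (m : nat) : H g -> (forall C, ~ evy (fun x => x ^+ m.+1 * g x <= C)) ->
  evy (fun x => - m.+1%:R * g x <= x * derive1 g x).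
Proof.
move=> Hg nb; have [h|h] := hardy_euler_sign HH (- m.+1%:Z) Hg.
  by apply: evy_imp h _ => x; rewrite subr_ge0 intrN.
exfalso; have [A hA] := evy_and (evy_ge 1) (evy_and h (hardy_is_derive HH Hg)).
apply: (nb (A ^+ m.+1 * g A)); exists A => x Ax.
apply: (@der_le0_mono R (fun y => y ^+ m.+1 * g y)
  (fun y => y ^+ m.+1 * derive1 g y + m.+1%:R * y ^+ m * g y) A) => //.
  by move=> z /hA[_ [_ dz]]; apply: der_mul => //; exact: der_pow.
move=> z /hA[z1 [hz _]]; rewrite exprS.
have -> : z * z ^+ m * derive1 g z + m.+1%:R * z ^+ m * g z =
   z ^+ m * (z * derive1 g z - (- m.+1%:Z)%:~R * g z).
  by rewrite intrN -[m.+1%:Z%:~R]/(m.+1%:R); ring.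
by rewrite mulr_ge0_le0 // exprn_ge0 //; lra.
Qed.

(** For g > 0 tending to 0 the derivative is <= 0, and the growth of x^m g bounds x g' from below
    through [hardy_euler_lower]. Negative g reduces to - g. *)
Lemma hardy_euler_decay {R : realType} (H : set (R -> R)) (HH : hardy_field H)
    (g : R -> R) (m : nat) : H g -> tends0 g -> (forall B, evy (fun x => B <= x ^+ m * `|g x|)) ->
  exists C, evy (fun x => `|x * derive1 g x| <= C * `|g x|).
Proof.
move=> Hg t0 big; exists m.+1%:R; wlog gpos : g Hg t0 big / evy (fun x => 0 < g x).
  move=> W; have [h|h|h] := hardy_sign HH Hg; first exact: W.
    have [|||] := W _ (hardyN HH Hg).
    - by move=> e /t0 te; apply: evy_imp te _ => x; rewrite normrN.
    - by move=> B; apply: evy_imp (big B) _ => x; rewrite normrN.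
    - by apply: evy_imp h _ => x; rewrite oppr_gt0.
    move=> A hA; have [B hB] := hardy_is_derive HH Hg.
    apply: evy_imp (evy_and (ex_intro _ A hA) (ex_intro _ B hB)) _ => x [].
    move=> hx dx; have dN := der_opp dx.
    have E : derive1 (fun y => - g y) x = - derive1 g x by rewrite derive1E; exact: derive_val.
    by move: hx; rewrite E mulrN !normrN.
  have [x _ []] := evy_ex 0 (evy_and h (big 1)).
  by move=> ->; rewrite normr0 mulr0; lra.
have nb C : ~ evy (fun x => x ^+ m.+1 * g x <= C).
  move=> h; have [x x1 [h1 [h2 g0]]] := evy_ex 1 (evy_and h (evy_and (big (`|C| + 1)) gpos)).
  rewrite (gtr0_norm g0) in h2; move: h1; rewrite exprS -mulrA.
  by have := ler_norm C; have := normr_ge0 C; nra.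
have low := hardy_euler_lower HH Hg nb.
have up : evy (fun x => derive1 g x <= 0).
  have [h|//] := hardy_sign_le HH (hardy_derive HH Hg).
  exfalso; have [A hA] := evy_and (hardy_is_derive HH Hg) (evy_and h gpos).
  have [_ [_ gA]] := hA A (lexx _).
  have gA2 : 0 < g A / 2 by rewrite divr_gt0.
  have [x Ax hx] := evy_ex A (t0 _ gA2).
  have := @der_ge0_mono R g (derive1 g) A A x (fun z h => (hA z h).1) (fun z h => (hA z h).2.1) (lexx _) Ax.
  by have := ler_norm (g x); lra.
apply: evy_imp (evy_and (evy_ge 0) (evy_and gpos (evy_and low up))) _ => x [x0 [g0 [h1 h2]]].
rewrite (gtr0_norm g0) ler0_norm ?mulr_ge0_le0 //; lra.
Qed.

(** * Successive derivatives of a function of polynomial growth *)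

Section DerivativeGrowth.
Context {R : realType} (H : set (R -> R)) (HH : hardy_field H).
Context (f : nat -> R -> R) (Hf : forall i, H (f i)).
Context (df : forall i, f i.+1 = derive1 (f i)).
Context (fpos : evy (fun x => 0 < f 0%N x)) (l : nat).
Context (fpoly : forall c : R, 0 < c -> ~ evy (fun x => c * x ^+ l <= f 0%N x)).
Context (finfty : forall B : R, evy (fun x => B <= f 0%N x)).
Implicit Types (x y c C : R).

Lemma f_is_derive i : evy (fun x => is_derive x 1 (f i) (f i.+1 x)).
Proof. by rewrite df; exact: (hardy_is_derive HH (Hf i)). Qed.

Lemma fpoly_ge (n : nat) c : (l <= n)%N -> 0 < c -> ~ evy (fun x => c * x ^+ n <= f 0%N x).
Proof.
move=> ln c0 h; apply: (fpoly c0); apply: evy_imp (evy_and (evy_ge 1) h) _ => x [x1 hx].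
by apply: le_trans hx; rewrite ler_wpM2l ?(ltW c0) // ler_weXn2l.
Qed.

Lemma chain_lower (i n : nat) c : 0 < c -> evy (fun x => c * x ^+ n <= f i x) ->
  exists2 c', 0 < c' & evy (fun x => c' * x ^+ (n + i) <= f 0%N x).
Proof.
elim: i n c => [|i IHi] n c c0 h; first by rewrite addn0; exists c.
have [c1 c10 h1] := integ_lower c0 (f_is_derive i) h.
by have [c2 c20 h2] := IHi n.+1 c1 c10 h1; exists c2 => //; rewrite addnS -addSn.
Qed.

(** Integrated i times, such a bound would make f 0 nonpositive. *)
Lemma not_evy_neg (i : nat) c : 0 < c -> ~ evy (fun x => f i x <= - c).
Proof.
move=> c0 h.
have neg k : (k <= i)%N -> exists2 c', 0 < c' & evy (fun x => c' * x ^+ k <= - f (i - k)%N x).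
  elim: k => [_|k IHk ki].
    exists c => //; apply: evy_imp h _ => x hx; rewrite subn0 expr0 mulr1; lra.
  have [c1 c10 h1] := IHk (ltnW ki).
  apply: (integ_lower c10 _ h1).
  apply: evy_imp (f_is_derive (i - k.+1)%N) _ => x dx.
  by apply: der_opp; rewrite -subSn // subSS in dx.
have [c1 c10 h1] := neg i (leqnn i); rewrite subnn in h1.
apply: (@evy_false R); apply: evy_imp (evy_and (evy_ge 0) (evy_and h1 fpos)) _ => x [x0 [h2 h3]].
have : 0 <= c1 * x ^+ i by nneg.
by move: h2 h3; lra.
Qed.

Lemma not_tends0_lower i : ~ tends0 (f i) -> exists2 c, 0 < c & evy (fun x => c <= f i x).
Proof.
move=> nt; have [c c0 hc] := hardy_not_tends0 HH (Hf i) nt; exists c => //.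
have [pos|neg] := hardy_sign_le HH (Hf i).
  by apply: evy_imp (evy_and pos hc) _ => x [h1]; rewrite ger0_norm.
exfalso; apply: (@not_evy_neg i c c0); apply: evy_imp (evy_and neg hc) _ => x [h1].
by rewrite ler0_norm //; lra.
Qed.

(** Otherwise f l would stay above a positive constant and, after l integrations, f 0 above a
    multiple of x^l. *)
Lemma exists_tends0 : exists i, tends0 (f i).
Proof.
apply: contrapT => nt; have [|c c0 hc] := @not_tends0_lower l; first by move=> h; apply: nt; exists l.
have [|c' c'0] := @chain_lower l 0 c c0.
  by apply: evy_imp hc _ => x; rewrite expr0 mulr1.
exact: fpoly.
Qed.

(** Otherwise f i / x^l would be nondecreasing, so f i >= c x^l, and f 0 would exceed a multiple of
    x^(l + i). *)
Lemma euler_upper i : evy (fun x => 0 < f i x) ->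
  exists m : nat, evy (fun x => x * f i.+1 x <= m%:R * f i x).
Proof.
move=> gpos; exists l; have [h|h] := hardy_euler_sign HH l (Hf i); last first.
  by apply: evy_imp h _ => x; rewrite -df subr_le0.
exfalso; have [A hA] := evy_and (evy_ge 1) (evy_and h (evy_and gpos (f_is_derive i))).
pose B := Num.max A 1.
have BA x : B <= x -> A <= x by rewrite ge_max => /andP[].
have B1 : 1 <= B by rewrite le_max lexx orbT.
have mono y : B <= y -> f i B * (B ^+ l)^-1 <= f i y * (y ^+ l)^-1.
  move=> By; apply: (@der_ge0_mono R (fun y => f i y * (y ^+ l)^-1)
    (fun y => f i y * (- (l%:R * y ^+ l.-1) / (y ^+ l) ^+ 2) + f i.+1 y * (y ^+ l)^-1) B) => //.
    move=> z /BA/hA[z1 [_ [_ dz]]]; apply: der_mul => //.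
    by apply: der_inv; [rewrite expf_neq0 // gt_eqF //; lra | exact: der_pow].
  move=> z /BA/hA[z1 [hz _]]; have z0 : 0 < z by lra.
  have zl : 0 < z ^+ l by rewrite exprn_gt0.
  have -> : f i z * (- (l%:R * z ^+ l.-1) / (z ^+ l) ^+ 2) + f i.+1 z * (z ^+ l)^-1
     = (z * f i.+1 z - l%:R * f i z) / (z * z ^+ l).
    case: (l) zl => [|k] zl /=; first by rewrite !expr0; field; rewrite gt_eqF.
    have zk : 0 < z ^+ k by rewrite exprn_gt0.
    by rewrite (exprS z k); field; rewrite gt_eqF //= gt_eqF // exprn_gt0.
  by rewrite divr_ge0 //; [rewrite df | nneg].
have [_ [_ [fB _]]] := hA B (BA B (lexx _)).
pose c := f i B * (B ^+ l)^-1.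
have c0 : 0 < c by rewrite divr_gt0 // exprn_gt0 //; lra.
have [|c' c'0] := @chain_lower i l c c0.
  exists B => x Bx; have := mono x Bx; rewrite -/c ler_pdivlMr // exprn_gt0 //; lra.
by apply: fpoly_ge => //; exact: leq_addr.
Qed.

Lemma euler_lower i (m : nat) : (forall C, ~ evy (fun x => x ^+ m.+1 * f i x <= C)) ->
  evy (fun x => - m.+1%:R * f i x <= x * f i.+1 x).
Proof. by rewrite df; exact: (hardy_euler_lower HH). Qed.

Lemma euler_bound i (m : nat) : evy (fun x => 0 < f i x) ->
  (forall C, ~ evy (fun x => x ^+ m.+1 * f i x <= C)) ->
  exists C, evy (fun x => `|x * f i.+1 x| <= C * `|f i x|).
Proof.
move=> gpos nb; have [n hn] := euler_upper gpos; have hm := euler_lower nb.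
exists (m.+1%:R + n%:R); apply: evy_imp (evy_and gpos (evy_and hn hm)) _ => x [g0 [h1 h2]].
rewrite (gtr0_norm g0) ler_norml mulrDl; apply/andP.
have : 0 <= m.+1%:R * f i x by rewrite mulr_ge0 // ltW.
have : 0 <= n%:R * f i x by rewrite mulr_ge0 // ltW.
by move: h1 h2; split; lra.
Qed.

Lemma bounded_below_unbounded i c : 0 < c -> evy (fun x => c <= f i x) ->
  forall C, ~ evy (fun x => x ^+ 1 * f i x <= C).
Proof.
move=> c0 hc C h; apply: (@evy_false R).
apply: evy_imp (evy_and (evy_ge (`|C| / c + 1)) (evy_and hc h)) _ => x [xC [h1]].
rewrite expr1; have : `|C| < x * c by rewrite -ltr_pdivrMr //; lra.
have := ler_norm C; have : 0 <= `|C| / c by nneg.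
by nra.
Qed.

(* Otherwise ln g + C / x would be nonincreasing. *)
Lemma log_derivative_big i : (forall B, evy (fun x => B <= f i x)) ->
  forall B, evy (fun x => B * f i x <= x ^+ 2 * f i.+1 x).
Proof.
move=> ginf; have gpos : evy (fun x => 0 < f i x).
  by apply: evy_imp (ginf 1) _ => x; lra.
have g'pos : evy (fun x => 0 < f i.+1 x).
  have [//|h|h] := hardy_sign HH (Hf i.+1).
    exfalso; have [A hA] := evy_and h (f_is_derive i).
    have [x Ax hx] := evy_ex A (ginf (f i A + 1)).
    have := @der_le0_mono R (f i) (f i.+1) A A x (fun z h => (hA z h).2)
      (fun z h => ltW (hA z h).1) (lexx _) Ax.
    by move: hx; lra.
  exfalso; have [A hA] := evy_and h (f_is_derive i).
  have [x Ax hx] := evy_ex A (ginf (f i A + 1)).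
  have := @der_le0_mono R (f i) (f i.+1) A A x (fun z h => (hA z h).2)
    (fun z h => eq_ind_r (fun v => v <= 0) (lexx 0) (hA z h).1) (lexx _) Ax.
  by move: hx; lra.
have gnz : evy (fun x => f i x != 0) by apply: evy_imp gpos _ => x /lt0r_neq0.
have [q Hq qE] := hardy_div HH (Hf i.+1) (Hf i) gnz.
have qpos : evy (fun x => 0 < q x).
  by apply: evy_imp (evy_and qE (evy_and gpos g'pos)) _ => x [-> [? ?]]; rewrite divr_gt0.
have [h B|[C hC]] := hardy_pow_mono HH 2 Hq qpos.
  apply: evy_imp (evy_and (h B) (evy_and qE gpos)) _ => x [h1 [h2 h3]].
  by move: h1; rewrite h2 mulrA ler_pdivlMr.
exfalso; have [A hA] := evy_and (evy_ge 1) (evy_and hC (evy_and qE (evy_and gpos (f_is_derive i)))).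
pose D := Num.max A 1; have DA x : D <= x -> A <= x by rewrite ge_max => /andP[].
have mono x : D <= x -> ln (f i x) - C * (- x^-1) <= ln (f i D) - C * (- D^-1).
  move=> Dx; apply: (@der_le0_mono R (fun x => ln (f i x) - C * (- x^-1))
    (fun x => (f i x)^-1 * f i.+1 x - C * (- (- 1 / x ^+ 2))) D) => //.
    move=> z /DA/hA[z1 [_ [_ [gz dz]]]]; apply: der_sub.
      exact: (@is_derive1_comp R (@ln R) (f i) z _ _ (is_derive1_ln gz) dz).
    apply: der_scale; apply: der_opp; apply: (@der_inv R (fun y => y) z 1 _ (der_id z)).
    by rewrite gt_eqF //; lra.
  move=> z /DA/hA[z1 [hz [qz [gz _]]]]; rewrite qz in hz.
  have z2 : 0 < z ^+ 2 by rewrite exprn_gt0 //; lra.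
  rewrite mulNr opprK mul1r subr_le0 ler_pdivlMr // mulrC [_^-1 * _]mulrC //.
pose E := ln (f i D) - C * (- D^-1) + `|C|.
have [x Dx gx] := evy_ex D (ginf (expR E + 1)).
have x1 : 1 <= x by apply: le_trans Dx; rewrite le_max lexx orbT.
have x0 : 0 < x by lra.
have : E < ln (f i x).
  rewrite -[E]expRK ltr_ln ?posrE ?expR_gt0 //; first by move: gx; lra.
  by have := expR_gt0 E; move: gx; lra.
have := mono x Dx; rewrite /E.
have : - `|C| <= C * x^-1.
  have xi : 0 <= x^-1 <= 1 by rewrite invr_ge0 ltW //= invf_le1.
  have := ler_norm (- C); rewrite normrN; move: xi => /andP[]; have := ler_norm C; have := normr_ge0 C; nra.
by rewrite !mulrN; lra.
Qed.

End DerivativeGrowth.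

(** * The three shapes of a sub-polynomial *)

Section Trichotomy.
Context {R : realType}.
Implicit Types (x y c C : R).

Lemma poly_antiderivative (p : {poly R}) : exists P : {poly R}, P^`() = p.
Proof.
exists (\poly_(i < (size p).+1) (p`_i.-1 / i%:R)); apply/polyP => i.
rewrite coef_deriv coef_poly ltnS; case: ltnP => ip.
  by rewrite /= -[_ *+ i.+1]mulr_natr divfK // pnatr_eq0.
by rewrite mul0rn nth_default.
Qed.

Lemma der_horner (p : {poly R}) x : is_derive x 1 (fun y => p.[y]) p^`().[x].
Proof.
have -> : horner p^`() x = (horner p)^`()%classic x by rewrite derivE.
by rewrite derive1E; apply: DeriveDef => //; exact: derivable_horner.
Qed.

Lemma der_negpow (k : nat) x : 0 < x ->
  is_derive x 1 (fun y : R => (y ^+ k.+1)^-1) (- k.+1%:R / x ^+ k.+2).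
Proof.
move=> x0; have xk : x ^+ k.+1 != 0 by rewrite expf_neq0 // gt_eqF.
have := @der_inv R (fun y => y ^+ k.+1) x _ xk (der_pow k.+1 x).
have -> // : - (k.+1%:R * x ^+ k) / (x ^+ k.+1) ^+ 2 = - k.+1%:R / x ^+ k.+2.
by rewrite !(exprS x); field; rewrite ?expf_neq0 gt_eqF.
Qed.

(** h - C / x^(k+1) is nondecreasing, h + C / x^(k+1) is nonincreasing, and the first lies below the
    second; L is the supremum of the first. *)
Lemma cvg_of_small_derivative (h h' : R -> R) C (k : nat) : 0 <= C ->
  evy (fun x => is_derive x 1 h (h' x)) -> evy (fun x => `|h' x| <= C / x ^+ k.+2) ->
  exists L, evy (fun x => `|h x - L| <= C / x ^+ k.+1).
Proof.
move=> C0 dh hh; have [A hA] := evy_and (evy_ge 1) (evy_and dh hh).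
pose B := Num.max A 1; have BA x : B <= x -> A <= x by rewrite ge_max => /andP[].
have B0 x : B <= x -> 0 < x by rewrite ge_max => /andP[_]; lra.
pose u x := h x - C * (x ^+ k.+1)^-1; pose v x := h x + C * (x ^+ k.+1)^-1.
have key z : B <= z -> - (C * (k.+1%:R / z ^+ k.+2)) <= h' z <= C * (k.+1%:R / z ^+ k.+2).
  move=> Bz; have [_ [_ hz]] := hA z (BA z Bz); rewrite -ler_norml; apply: (le_trans hz).
  rewrite ler_wpM2l // -[leLHS]mul1r ler_wpM2r ?ler1n // invr_ge0 exprn_ge0 //.
  exact/ltW/B0.
have um x y : B <= x -> x <= y -> u x <= u y.
  apply: (@der_ge0_mono R u (fun z => h' z - C * (- k.+1%:R / z ^+ k.+2)) B) => z Bz.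
    have [_ [dz _]] := hA z (BA z Bz); apply: der_sub => //; apply: der_scale.
    by apply: der_negpow; exact: B0.
  by have /andP[h1 _] := key z Bz; rewrite mulNr mulrN opprK; lra.
have vm x y : B <= x -> x <= y -> v y <= v x.
  apply: (@der_le0_mono R v (fun z => h' z + C * (- k.+1%:R / z ^+ k.+2)) B) => z Bz.
    have [_ [dz _]] := hA z (BA z Bz); apply: der_add => //; apply: der_scale.
    by apply: der_negpow; exact: B0.
  by have /andP[_ h1] := key z Bz; rewrite mulNr mulrN; lra.
have uv x : B <= x -> u x <= v x.
  move=> Bx; have : 0 <= C * (x ^+ k.+1)^-1.
    by rewrite mulr_ge0 // invr_ge0 exprn_ge0 // ltW // B0.
  by rewrite /u /v; lra.
pose S := [set u x | x in [set x | B <= x]].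
have hS : has_sup S.
  split; first by exists (u B), B => //=.
  exists (v B) => _ [x /= Bx <-]; apply: (le_trans (uv x Bx)); exact: vm.
exists (sup S), B => x Bx.
have h1 : u x <= sup S by apply: ub_le_sup; [exact: hS.2 | exists x].
have h2 : sup S <= v x.
  apply: ge_sup; first exact: hS.1.
  move=> _ [y /= By <-]; have [xy|yx] := leP x y.
    by apply: (le_trans (uv y By)); exact: vm.
  by apply: (le_trans (um y x By (ltW yx))); exact: uv.
by rewrite ler_norml; move: h1 h2; rewrite /u /v => h1 h2; apply/andP; split; lra.
Qed.

(** Descending from f j to f 1, each integration converges and adds a constant to the polynomial.
    The descent stops at f 1 because an error O(1 / x) need not have a convergent integral. *)
Lemma poly_approximation (f : nat -> R -> R) (j : nat) C : (0 < j)%N ->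
  (forall i, evy (fun x => is_derive x 1 (f i) (f i.+1 x))) ->
  evy (fun x => `|f j x| <= C / x ^+ j) ->
  exists p : {poly R}, exists C, evy (fun x => `|f 1%N x - p.[x]| <= C / x).
Proof.
move=> j0 df hj.
suff W k : (k < j)%N -> exists p : {poly R}, exists C,
    evy (fun x => `|f (j - k)%N x - p.[x]| <= C / x ^+ (j - k)).
  have [|p [D hD]] := W j.-1; first by rewrite prednK.
  exists p, D; apply: evy_imp hD _ => x.
  by rewrite (_ : (j - j.-1 = 1)%N) ?expr1 //; lia.
elim: k => [_|k IHk kj].
  exists 0, C; rewrite subn0; apply: evy_imp hj _ => x; by rewrite horner0 subr0.
have [p [D hD]] := IHk (ltnW kj); have [P PE] := poly_antiderivative p.
have [m mE] : exists m, (j - k.+1 = m.+1)%N by exists (j - k.+1).-1; lia.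
have mE' : (j - k = m.+2)%N by lia.
rewrite mE; rewrite mE' in hD.
have [|||L hL] := @cvg_of_small_derivative (fun x => f m.+1 x - P.[x]) (fun x => f m.+2 x - p.[x]) `|D| m.
- exact: normr_ge0.
- apply: evy_imp (df m.+1) _ => x dx; apply: der_sub => //.
  by rewrite -PE; exact: der_horner.
- apply: evy_imp (evy_and (evy_ge 1) hD) _ => x [x1 hx]; apply: (le_trans hx).
  by rewrite ler_wpM2r ?ler_norm // invr_ge0 exprn_ge0 //; lra.
exists (P + L%:P), `|D|; apply: evy_imp hL _ => x.
by rewrite hornerD hornerC opprD addrA.
Qed.

Definition sublinear_case (f : nat -> R -> R) : Prop :=
  tends0 (f 1%N) /\ evy (fun x => f 2%N x <= 0).

(** The last two clauses are what the derivative test consumes: a derivative of order 1, ..., j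
    varies slowly on blocks [x, (1 + rho) x], and f i.-1 is o(x^i |f i|) for 2 <= i <= j. *)
Definition van_der_corput_case (f : nat -> R -> R) : Prop := exists j : nat,
  [/\ (1 < j)%N, tends0 (f j),
     forall i, (0 < i < j)%N -> exists2 c, 0 < c & evy (fun x => c <= f i x),
     forall i, (0 < i <= j)%N -> exists C, evy (fun x => `|x * f i.+1 x| <= C * `|f i x|)
   & forall i B, (1 < i <= j)%N -> evy (fun x => B * f i.-1 x <= x ^+ i * `|f i x|)].

Definition polynomial_case (f : nat -> R -> R) : Prop :=
  [/\ exists p : {poly R}, exists C, evy (fun x => `|f 1%N x - p.[x]| <= C / x),
     exists2 c, 0 < c & evy (fun x => c <= f 1%N x)
   & exists C, evy (fun x => `|x * f 2%N x| <= C * `|f 1%N x|)].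

(** j is the least order with f j -> 0. The value 0 is excluded by a -> oo, the value 1 is the
    sublinear case, and from 2 on the alternative is whether x^j |f j| tends to +oo or stays
    bounded. *)
Lemma derivative_trichotomy (a : R -> R) (f := fun i => iter i (fun g => derive1 g) a) :
  subpolynomial a -> (forall x, 1 <= x -> 0 < a x) -> (forall B, evy (fun x => B <= a x)) ->
  [/\ forall i, evy (fun x => is_derive x 1 (f i) (f i.+1 x)),
      exists C, evy (fun x => `|x * f 1%N x| <= C * `|a x|),
      evy (fun x => 0 < f 1%N x)
    & [\/ sublinear_case f, van_der_corput_case f | polynomial_case f]].
Proof.
move=> [[H HH Ha] [r r0 hr]] apos ainf.
have Hf i : H (f i) by elim: i => [//|i IHi]; exact: (hardy_derive HH).
have df i : f i.+1 = derive1 (f i) by [].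
have fpos : evy (fun x => 0 < f 0%N x) by exists 1.
pose l := (Num.truncn r).+1.
have fpoly c : 0 < c -> ~ evy (fun x => c * x ^+ l <= f 0%N x).
  move=> c0 h; move: hr => /cvgrPdist_lt /(_ _ c0) /evyP hr.
  have [x x1 [h1 h2]] := evy_ex 1 (evy_and hr h).
  have x0 : 0 < x by lra.
  have px : 0 < x `^ r by exact: powR_gt0.
  move: h1; rewrite sub0r normrN normrM normfV (gtr0_norm px) ltr_pdivrMr // => h1.
  have : x `^ r <= x ^+ l.
    rewrite -powR_mulrn ?(ltW x0) // ler_powR //; exact/ltW/truncnS_gt.
  have h3 := ler_norm (a x); move: h2; rewrite /f /= => h2 h4.
  have := ler_wpM2l (ltW c0) h4; lra.
have dfi := f_is_derive HH Hf df.
have f1pos : evy (fun x => 0 < f 1%N x).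
  apply: evy_imp (evy_and (evy_ge 1) (evy_and (log_derivative_big HH Hf df (i := 0%N) ainf 1) fpos)) _.
  move=> x [x1 [h1 h2]]; have : 0 < x ^+ 2 * f 1%N x by lra.
  by rewrite pmulr_rgt0 // exprn_gt0 //; lra.
have ebound i : (exists2 c, 0 < c & evy (fun x => c <= f i x)) ->
    exists C, evy (fun x => `|x * f i.+1 x| <= C * `|f i x|).
  move=> [c c0 hc]; apply: (euler_bound HH Hf df fpoly (m := 0%N)).
    by apply: evy_imp hc _ => x; apply: lt_le_trans.
  exact: (bounded_below_unbounded c0 hc).
split => //.
  by apply: (ebound 0%N); exists 1 => //; exact: ainf.
have exj : exists j, `[< tends0 (f j) >].
  by have [j hj] := exists_tends0 HH Hf df fpos fpoly; exists j; apply/asboolP.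
case: (ex_minnP exj) => j /asboolP tj minj.
have below i : (i < j)%N -> exists2 c, 0 < c & evy (fun x => c <= f i x).
  move=> ij; apply: (not_tends0_lower HH Hf df fpos) => ti.
  by have := minj i (asboolT ti); rewrite leqNgt ij.
case: j tj minj below => [|[|j]] tj minj below.
- have [x _ []] := evy_ex 0 (evy_and (tj 1 ltr01) (ainf 2)).
  by rewrite /f /=; have := ler_norm (a x); lra.
- apply: Or31; split => //.
  have [h|//] := hardy_sign_le HH (Hf 2%N).
  exfalso; have [A hA] := evy_and (dfi 1%N) (evy_and h f1pos).
  have [_ [_ gA]] := hA A (lexx _).
  have gA2 : 0 < f 1%N A / 2 by rewrite divr_gt0.
  have [x Ax hx] := evy_ex A (tj _ gA2).
  have := @der_ge0_mono R (f 1%N) (f 2%N) A A x (fun z h => (hA z h).1) (fun z h => (hA z h).2.1) (lexx _) Ax.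
  by have := ler_norm (f 1%N x); lra.
have growth i B : (0 < i < j.+2)%N -> evy (fun x => B <= f i.-1 x).
  move=> /andP[i0 ij]; have [c c0 hc] := below i ij.
  have [||c' c'0 hc'] := @integ_lower R (f i.-1) (f i) c 0%N c0 _ _.
  - by have := dfi i.-1; rewrite prednK.
  - by apply: evy_imp hc _ => x; rewrite expr0 mulr1.
  apply: evy_imp (evy_and (evy_ge (`|B| / c')) hc') _ => x [h1]; apply: le_trans.
  rewrite expr1 mulrC -ler_pdivrMr //; apply: le_trans h1.
  by rewrite ler_wpM2r ?ler_norm // invr_ge0 ltW.
have dich : (forall B, evy (fun x => B <= x ^+ j.+2 * `|f j.+2 x|)) \/
    (exists C, evy (fun x => x ^+ j.+2 * `|f j.+2 x| <= C)).
  have [h|h|h] := hardy_sign HH (Hf j.+2).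
  - have [big|[C hC]] := hardy_pow_mono HH j.+2 (Hf _) h; [left => B|right; exists C].
      by apply: evy_imp (evy_and h (big B)) _ => x [h1]; rewrite gtr0_norm.
    by apply: evy_imp (evy_and h hC) _ => x [h1]; rewrite gtr0_norm.
  - have hN : evy (fun x => 0 < - f j.+2 x) by apply: evy_imp h _ => x; rewrite oppr_gt0.
    have [big|[C hC]] := hardy_pow_mono HH j.+2 (hardyN HH (Hf _)) hN; [left => B|right; exists C].
      by apply: evy_imp (evy_and h (big B)) _ => x [h1]; rewrite ltr0_norm.
    by apply: evy_imp (evy_and h hC) _ => x [h1]; rewrite ltr0_norm.
  - by right; exists 0; apply: evy_imp h _ => x ->; rewrite normr0 mulr0.
case: dich => [big|[C hC]].
  apply: Or32; exists j.+2; split => //.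
  - by move=> i /andP[_ ij]; exact: below.
  - move=> i /andP[i0]; rewrite leq_eqVlt => /predU1P[->|ij]; last exact/ebound/below.
    exact: (hardy_euler_decay HH (Hf _) tj big).
  (* If f i.-1 -> oo, then x^2 f i / f i.-1 -> oo by [log_derivative_big], and x^2 <= x^i. At the
     last index f i.-1 may be bounded; then the growth of x^i |f i| is used directly. *)
  have viaInf i B : (1 < i)%N -> (forall B, evy (fun x => B <= f i.-1 x)) ->
      evy (fun x => B * f i.-1 x <= x ^+ i * `|f i x|).
    move=> i1 inf; have := log_derivative_big HH Hf df inf B; rewrite prednK 1?ltnW // => h.
    apply: evy_imp (evy_and (evy_ge 1) h) _ => x [x1]; move/le_trans; apply.
    apply: (@le_trans _ _ (x ^+ 2 * `|f i x|)); first by rewrite ler_wpM2l ?ler_norm // sqr_ge0.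
    by rewrite ler_wpM2r // ler_weXn2l.
  move=> i B /andP[i1]; rewrite leq_eqVlt => /predU1P[iE|ij]; last first.
    by apply: viaInf => // D; apply: growth; rewrite ij ltnW.
  rewrite iE in i1 *; have jpos : evy (fun x => 0 < f j.+1 x).
    have [|c c0 hc] := below j.+1; first by [].
    by apply: evy_imp hc _ => x; apply: lt_le_trans.
  have [h|[D hD]] := hardy_pow_mono HH 0 (Hf j.+1) jpos.
    by apply: viaInf => // D; apply: evy_imp (h D) _ => x; rewrite expr0 mul1r.
  apply: evy_imp (evy_and (big (`|B| * D)) (evy_and hD jpos)) _ => x [h1 [h2 h3]].
  apply: le_trans h1; rewrite /= expr0 mul1r in h2.
  apply: (@le_trans _ _ (`|B| * f j.+1 x)); first by rewrite ler_wpM2r ?ler_norm // ltW.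
  by rewrite ler_wpM2l.
apply: Or33; split; [|exact: below|exact/ebound/below].
apply: (@poly_approximation f j.+2 C) => //.
apply: evy_imp (evy_and (evy_ge 1) hC) _ => x [x1 hx].
by rewrite ler_pdivlMr 1?mulrC // exprn_gt0 //; lra.
Qed.

End Trichotomy.

(** * Consequences of uniform distribution *)

Section UniformDistribution.
Context {R : realType}.
Implicit Types (u : nat -> R) (rho : R).

(** Without a visit after N the counts up to N and up to (1 + rho) N would agree, although they are
    close to (d - c) N and (d - c) (1 + rho) N. *)
Lemma ud_visits u (c d rho : R) : uniformly_distributed_mod1 u ->
  0 <= c -> c < d -> d <= 1 -> 0 < rho -> rho <= 1 ->
  exists N0 : nat, forall N, (N0 <= N)%N ->
    exists n : nat, [/\ (N < n)%N, n%:R <= (1 + rho) * N%:R & c <= frac_part (u n) < d].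
Proof.
move=> ud c0 cd d1 r0 r1; pose l := d - c; have l0 : 0 < l by rewrite subr_gt0.
have e0 : 0 < l * rho / 8 by rewrite divr_gt0 // mulr_gt0.
have := ud c d c0 cd d1 => /cvgrPdist_lt /(_ _ e0) [K _ hK].
pose cnt N := (\sum_(1 <= n < N.+1) (c <= frac_part (u n) < d)%R)%N.
have cK N : (K <= N)%N -> `|l - (cnt N)%:R / N%:R| < l * rho / 8 by exact: hK.
pose N0 := maxn (maxn K 1) (Num.truncn (2 / rho)).+1.
exists N0 => N; rewrite !geq_max => /andP[/andP[KN N1] Nr].
have Nr' : 2 <= rho * N%:R.
  rewrite mulrC -ler_pdivrMr //; apply/ltW/(lt_le_trans (truncnS_gt _)).
  by rewrite ler_nat.
have Np : 0 < N%:R :> R by rewrite ltr0n.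
pose N' := Num.truncn ((1 + rho) * N%:R).
have N'le : N'%:R <= (1 + rho) * N%:R by rewrite /N' truncn_le // mulr_ge0 //; lra.
have N'gt : (1 + rho) * N%:R < N'%:R + 1 by rewrite natr1; exact: truncnS_gt.
have NN' : (N < N')%N by rewrite -(ltr_nat R); lra.
have N'p : 0 < N'%:R :> R by rewrite ltr0n (leq_ltn_trans _ NN').
apply: contrapT => nex.
have : cnt N' = cnt N.
  rewrite /cnt (@big_cat_nat _ _ _ N.+1) //=; last exact: ltnW.
  rewrite [X in (_ + X)%N]big_nat_cond [X in (_ + X)%N]big1 ?addn0 // => n /andP[/andP[h1 h2] _].
  case: (boolP (_ && _)) => // hc; exfalso; apply: nex; exists n; split => //.
  by apply: le_trans N'le; rewrite ler_nat.
have := cK N KN; have := cK N' (leq_trans KN (ltnW NN')).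
rewrite !ltr_norml => /andP[_ h1] /andP[h2 _] E; rewrite E in h1.
have h3 : (l - l * rho / 8) * N'%:R < (cnt N)%:R by rewrite -ltr_pdivlMr //; lra.
have h4 : (cnt N)%:R < (l + l * rho / 8) * N%:R by rewrite -ltr_pdivrMr //; lra.
have h5 : (1 + rho / 2) * N%:R <= N'%:R by lra.
have h6 : 0 < l - l * rho / 8 by nra.
have h7 := ler_wpM2l (ltW h6) h5.
have : (l - l * rho / 8) * (1 + rho / 2) < l + l * rho / 8.
  by rewrite -(ltr_pM2r Np); lra.
have lr : 0 < l * rho by rewrite mulr_gt0.
have : l * rho * rho <= l * rho by rewrite ler_piMr // ltW.
lra.
Qed.

(** Both [3/8, 5/8) and [0, 1/8) are visited between N and (1 + rho) N, and points of these two arcs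
    are more than 1/4 apart mod 1. *)
Lemma ud_not_slow u rho : uniformly_distributed_mod1 u -> 0 < rho -> rho <= 1 ->
  exists N0 : nat, forall N, (N0 <= N)%N -> exists n m : nat,
    [/\ (N < n)%N, n%:R <= (1 + rho) * N%:R, (N < m)%N, m%:R <= (1 + rho) * N%:R
      & ~ near_int (u n - u m) (4^-1 : R)].
Proof.
move=> ud r0 r1.
have [|||N1 h1] := @ud_visits u (3 / 8) (5 / 8) rho ud _ _ _ r0 r1; [lra | lra | lra |].
have [|||N2 h2] := @ud_visits u 0 (1 / 8) rho ud _ _ _ r0 r1; [lra | lra | lra |].
exists (maxn N1 N2) => N; rewrite geq_max => /andP[/h1[n [a1 a2 /andP[a3 a4]]] /h2[m [b1 b2 /andP[b3 b4]]]].
exists n, m; split => // -[k].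
pose z : int := k - Num.floor (u n) + Num.floor (u m).
have -> : u n - u m - k%:~R = frac_part (u n) - frac_part (u m) - z%:~R.
  by rewrite /frac_part /z intrD intrB; ring.
rewrite ler_norml => /andP[h3 h4].
have z0 : 0 < z%:~R :> R by lra.
have z1 : z%:~R < 1 :> R by lra.
by move: z0 z1; rewrite ltr0z ltrz1; case: (z) => [[|n']|n'].
Qed.

Lemma bounded_mono_cauchy (f : R -> R) (A C : R) :
  (forall x y, A <= x -> x <= y -> f x <= f y) -> (forall x, A <= x -> f x <= C) ->
  evy (fun x => forall y, x <= y -> `|f x - f y| <= 8^-1).
Proof.
move=> mono bd; pose S := [set f x | x in [set x | A <= x]].
have hS : has_sup S.
  split; first by exists (f A), A => //=.
  by exists C => _ [x /= Ax <-]; exact: bd.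
have e0 : 0 < 8^-1 :> R by lra.
have [_ [X /= AX <-] hX] := sup_adherent e0 hS.
exists X => x Xx y xy.
have up z : X <= z -> f z <= sup S.
  by move=> Xz; apply: ub_le_sup; [exact: hS.2 | exists z => //=; exact: le_trans Xz].
have h1 := up y (le_trans Xx xy); have h2 := mono x y (le_trans AX Xx) xy.
have h3 := mono X x AX Xx.
by rewrite distrC ger0_norm ?subr_ge0 //; lra.
Qed.

(** a is eventually monotone; if it did not tend to +oo it would converge, and vary by at most 1/8
    far out, against [ud_not_slow]. *)
Lemma ud_tends_to_infinity (a : R -> R) : subpolynomial a -> (forall x, 1 <= x -> 0 < a x) ->
  uniformly_distributed_mod1 (fun n => 1 * a n%:R) -> forall B, evy (fun x => B <= a x).
Proof.
move=> [[H HH Ha] _] apos ud.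
have ap : evy (fun x => 0 < a x) by exists 1.
have [h B|[C hC]] := hardy_pow_mono HH 0 Ha ap.
  by apply: evy_imp (h B) _ => x; rewrite expr0 mul1r.
exfalso.
have cauchy : evy (fun x => forall y, x <= y -> `|a x - a y| <= 8^-1).
  have [pos|neg] := hardy_sign_le HH (hardy_derive HH Ha).
    have [A hA] := evy_and (hardy_is_derive HH Ha) (evy_and pos hC).
    apply: (@bounded_mono_cauchy a A C); last first.
      by move=> x /hA[_ [_]]; rewrite expr0 mul1r.
    by move=> x y; apply: (@der_ge0_mono R a (derive1 a) A) => // z /hA[? []].
  have [A hA] := evy_and (hardy_is_derive HH Ha) (evy_and neg ap).
  have [||X hX] := @bounded_mono_cauchy (fun x => - a x) A 0.
  - move=> x y Ax xy; rewrite lerN2.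
    by apply: (@der_le0_mono R a (derive1 a) A) => // z /hA[? []].
  - by move=> x /hA[_ [_]]; rewrite oppr_le0 => /ltW.
  by exists X => x Xx y xy; have := hX x Xx y xy; rewrite opprK addrC distrC.
have [X hX] := cauchy.
have [N0 hN] := ud_not_slow ud ltr01 (lexx 1).
have [K _ XK] := nat_above X.
have [n [m [a1 _ b1 _ []]]] := hN (maxn N0 K) (leq_maxl _ _).
have big k : (maxn N0 K < k)%N -> X <= k%:R.
  by move=> h; apply: (le_trans XK); rewrite ler_nat ltnW // (leq_ltn_trans (leq_maxr _ _) h).
exists 0; rewrite subr0 !mul1r; have [nm|mn] := leqP n m.
  by apply: (le_trans (hX n%:R (big n a1) m%:R _)); [rewrite ler_nat | lra].
by rewrite distrC; apply: (le_trans (hX m%:R (big m b1) n%:R _)); [rewrite ler_nat ltnW | lra].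
Qed.

(* If a were a rational polynomial up to scaling and an error with derivative O(1/x),
   then kappa a(n) would be slowly varying mod 1 for some kappa > 0. *)
Lemma ud_irrational_coef (a a' : R -> R) (P : {poly R}) (C : R) :
  (forall kappa, 0 < kappa -> uniformly_distributed_mod1 (fun n => kappa * a n%:R)) ->
  evy (fun x => is_derive x 1 a (a' x)) -> evy (fun x => `|a' x - P^`().[x]| <= C / x) ->
  forall kappa, kappa != 0 -> ~ (forall i, (0 < i)%N -> exists k : int, kappa * P`_i = k%:~R).
Proof.
move=> ud da ha kappa0 k0 hi; wlog kpos : kappa0 k0 hi / 0 < kappa0.
  move=> W; have [h|h|h] := ltgtP kappa0 0; last by rewrite h eqxx in k0.
    apply: (W (- kappa0)); rewrite ?oppr_eq0 ?oppr_gt0 // => i /hi[k hk].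
    by exists (- k); rewrite mulNr hk intrN.
  exact: (W kappa0).
have [A hA] := evy_and (evy_ge 1) (evy_and da ha).
pose D := `|C| + 1; have D1 : 1 <= D by rewrite lerDr.
(* Between N and (1 + rho) N the difference a - P changes by at most D rho, hence kappa0 (a - P) by
   at most 1/4. *)
pose rho := Num.min 1 (1 / (4 * (kappa0 * D))).
have kD : 0 < kappa0 * D by rewrite mulr_gt0 //; lra.
have r0 : 0 < rho by rewrite lt_min ltr01 divr_gt0 // mulr_gt0.
have r1 : rho <= 1 by rewrite ge_min lexx.
have rk : kappa0 * D * rho <= 4^-1.
  have : rho <= 1 / (4 * (kappa0 * D)) by rewrite ge_min lexx orbT.
  by rewrite ler_pdivlMr ?mulr_gt0 //; lra.
have [N0 hN] := ud_not_slow (ud _ kpos) r0 r1.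
have [K K0 AK] := nat_above A.
pose N := maxn N0 K; have NA : A <= N%:R by rewrite (le_trans AK) // ler_nat leq_maxr.
have Np : 0 < N%:R :> R by rewrite ltr0n leq_max K0 orbT.
have [n [m [a1 a2 b1 b2 []]]] := hN N (leq_maxl _ _).
(* kappa0 P is constant mod 1 on the natural numbers, so mod 1 only kappa0 (a - P) makes kappa0 a(n)
   vary. *)
have Pint i : exists k : int, kappa0 * (P.[i%:R] - P.[0]) = k%:~R.
  have E : P.[i%:R] - P.[0] = \sum_(j < size P) (if (0 < j)%N then P`_j * i%:R ^+ j else 0).
    have -> : P.[0] = \sum_(j < size P) (if (0 < j)%N then 0 else P`_j).
      rewrite horner_coef; apply: eq_bigr => j _; case: (nat_of_ord j) => [|j'].
        by rewrite expr0 mulr1.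
      by rewrite expr0n mulr0.
    rewrite horner_coef -sumrB; apply: eq_bigr => j _; case: (nat_of_ord j) => [|j'] /=.
      by rewrite expr0 mulr1 subrr.
    by rewrite subr0.
  rewrite E mulr_sumr; elim/big_ind: _ => [|x y [k1 e1] [k2 e2]|j _].
  - by exists 0.
  - by exists (k1 + k2); rewrite e1 e2 intrD.
  - case: ifPn => [j0|_]; last by exists 0; rewrite mulr0.
    have [k hk] := hi j j0; exists (k * (i%:Z ^+ j)).
    by rewrite mulrA hk intrM rmorphXn /=.
have beta x y : N%:R <= x -> x <= y -> y <= (1 + rho) * N%:R ->
    kappa0 * `|(a y - P.[y]) - (a x - P.[x])| <= 4^-1.
  move=> Nx xy yN; have [|c /andP[xc cy] ->] := @mvt_ge R (fun z => a z - P.[z]) (fun z => a' z - P^`().[z]) A x y _ (le_trans NA Nx) xy.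
    by move=> z /hA[_ [dz _]]; apply: der_sub => //; exact: der_horner.
  have Nc := le_trans Nx xc; have [c1 [_ hc]] := hA c (le_trans NA Nc).
  rewrite normrM (ger0_norm (_ : 0 <= y - x)) ?subr_ge0 //.
  have cp : 0 < c by lra.
  have h1 : `|a' c - P^`().[c]| <= D / N%:R.
    apply: (le_trans hc); apply: (@le_trans _ _ (D / c)).
      by rewrite ler_wpM2r ?invr_ge0 ?(ltW cp) // /D; have := ler_norm C; lra.
    by rewrite ler_wpM2l ?lef_pV2 ?posrE //; lra.
  have h2 : `|a' c - P^`().[c]| * (y - x) <= D / N%:R * (rho * N%:R).
    by apply: ler_pM => //; [rewrite subr_ge0 | lra].
  apply: le_trans rk; rewrite -mulrA ler_wpM2l ?(ltW kpos) //; apply: (le_trans h2).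
  by rewrite le_eqVlt; apply/orP; left; apply/eqP; field; rewrite gt_eqF.
have [kn hn] := Pint n; have [km hm] := Pint m.
exists (kn - km); rewrite intrB -hn -hm.
rewrite (_ : _ - _ = kappa0 * ((a n%:R - P.[n%:R]) - (a m%:R - P.[m%:R]))); last by ring.
rewrite normrM (gtr0_norm kpos); have Nn : N%:R <= n%:R :> R by rewrite ler_nat ltnW.
have Nm : N%:R <= m%:R :> R by rewrite ler_nat ltnW.
have [nm|mn] := leqP n m; last by apply: beta => //; rewrite ler_nat ltnW.
by rewrite distrC; apply: beta => //; rewrite ler_nat.
Qed.

End UniformDistribution.

(** * The integral of e(t s) and its comparison with single terms *)

Section ExponentialIntegral.
Context {R : realType}.
Implicit Types (t v h x y : R).

(* The integral of exp(2 pi i t s) for s from 0 to v. *)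
Definition expint t v : R[i] :=
  if t == 0 then v%:C%C else (expi (t * v) - 1) / (0 +i* (2 * pi * t))%C.

Lemma normc_le_add (x y : R) : normc (x +i* y)%C <= `|x| + `|y|.
Proof.
rewrite -(ler_pXn2r (ltn0Sn 1)) ?nnegrE ?normc_ge0 ?addr_ge0 // normc_sqrE /=.
rewrite sqrrD !real_normK ?num_real // lerD2r lerDl mulrn_wge0 // mulr_ge0 //.
Qed.

Lemma normc_im x : normc (0 +i* x)%C = `|x|.
Proof. by rewrite /= expr0n /= add0r sqrtr_sqr. Qed.

Lemma normc_div (z w : R[i]) : normc (z / w) = normc z / normc w.
Proof. by rewrite normcM normcV. Qed.

Lemma expintD t v h : expint t (v + h) = expint t v + expi (t * v) * expint t h.
Proof.
rewrite /expint; case: eqVneq => [->|t0]; first by rewrite mul0r expi0 mul1r rmorphD.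
by rewrite mulrDr expiD; ring.
Qed.

Lemma expint0 t : expint t 0 = 0.
Proof. by rewrite /expint; case: eqVneq => // _; rewrite mulr0 expi0 subrr mul0r. Qed.

Lemma pi4 : 4 <= 2 * pi :> R.
Proof. by have := pi_ge2 R; lra. Qed.

Lemma expint_le t v : normc (expint t v) <= `|v|.
Proof.
rewrite /expint; case: eqVneq => [_|t0]; first by rewrite normc_real.
have t1 : 0 < `|t| by rewrite normr_gt0.
have pp := pi_gt0 R.
rewrite normc_div normc_im expiB1 !normrM (ger0_norm (pi_ge0 R)) (@ger0_norm _ 2) //.
rewrite ler_pdivrMr ?mulr_gt0 //.
have := norm_sin_le (pi * (t * v)); rewrite !normrM (ger0_norm (pi_ge0 R)).
by clear; lra.
Qed.

Lemma expint_bound t v : t != 0 -> normc (expint t v) * `|t| <= 1.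
Proof.
move=> t0; rewrite /expint (negPf t0) normc_div normc_im.
have t1 : 0 < `|t| by rewrite normr_gt0.
have pp := pi4.
rewrite normrM ger0_norm; last by lra.
rewrite mulrAC ler_pdivrMr ?mul1r ?mulr_gt0 //; last by lra.
rewrite ler_pM2r //; apply: (le_trans (normcB_le _ _)).
by rewrite normc_expi normc1; lra.
Qed.

Lemma sin_sub_le y : `|sin y - y| <= y ^+ 2.
Proof.
wlog y0 : y / 0 <= y.
  move=> W; have [/W //|/ltW h] := leP 0 y.
  have E : sin (- y) - - y = - (sin y - y) by rewrite sinN; ring.
  by have := W (- y); rewrite E normrN sqrrN oppr_ge0; exact.
have [c /andP[c0 cy] E] := @mvt_ge R (fun z => sin z - z) (fun z => cos z - 1) 0 0 y
   (fun z _ => der_sub (is_derive_sin z) (der_id z)) (lexx 0) y0.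
rewrite /= sin0 !subr0 in E; rewrite E normrM (ger0_norm y0) expr2 ler_wpM2r //.
have -> : cos c - 1 = - (2 * sin (c / 2) ^+ 2).
  have cE : c = (c / 2) *+ 2 by lra.
  by rewrite {1}cE cos_mulr2n cos2sin2; ring.
rewrite normrN ger0_norm; last by rewrite mulr_ge0 // sqr_ge0.
rewrite -[_ ^+ 2]real_normK ?num_real //.
have h1 := norm_sin_le (c / 2); have h2 := sin_max (c / 2).
rewrite (@ger0_norm _ (c / 2)) ?divr_ge0 // in h1.
by have := normr_ge0 (sin (c / 2)); nra.
Qed.

Lemma expint_sub_le t h : normc (expint t h - h%:C%C) <= 24 * `|t| * h ^+ 2.
Proof.
rewrite /expint; case: eqVneq => [->|t0].
  by rewrite subrr normc0 normr0 mulr0 mul0r.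
have t1 : 0 < `|t| by rewrite normr_gt0.
have pp := pi4; have p4 := @pi_lt4 R.
have nz : (0 +i* (2 * pi * t))%C != 0.
  by rewrite eq_complex /= eqxx /= mulf_neq0 // gt_eqF //; lra.
have -> : (expi (t * h) - 1) / (0 +i* (2 * pi * t))%C - h%:C%C =
    (expi (t * h) - 1 - (0 +i* (2 * pi * (t * h)))%C) / (0 +i* (2 * pi * t))%C.
  apply: (mulIf nz); rewrite mulrBl !divfK //; congr (_ - _).
  by apply/eqP; rewrite eq_complex /=; apply/andP; split; apply/eqP; ring.
rewrite normc_div normc_im normrM [`|2 * pi|]ger0_norm; last by lra.
rewrite ler_pdivrMr ?mulr_gt0 //; last by lra.
pose y := 2 * pi * (t * h).
have -> : expi (t * h) - 1 - (0 +i* (2 * pi * (t * h)))%C = ((cos y - 1) +i* (sin y - y))%C.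
  by apply/eqP; rewrite eq_complex /= -/y; apply/andP; split; apply/eqP; ring.
apply: (le_trans (normc_le_add _ _)).
have h1 := sin_sub_le y.
have h2 : `|cos y - 1| <= y ^+ 2.
  have -> : cos y - 1 = - (2 * sin (y / 2) ^+ 2).
    have yE : y = (y / 2) *+ 2 by lra.
    by rewrite {1}yE cos_mulr2n cos2sin2; ring.
  rewrite normrN ger0_norm; last by rewrite mulr_ge0 // sqr_ge0.
  have h3 := norm_sin_le (y / 2).
  have : sin (y / 2) ^+ 2 <= (y / 2) ^+ 2 by rewrite -[X in X <= _]real_normK ?num_real // -[leRHS]real_normK ?num_real // lerXn2r ?nnegrE.
  rewrite expr_div_n; have := sqr_ge0 y; lra.
apply: (@le_trans _ _ (2 * y ^+ 2)); first by lra.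
have -> : y ^+ 2 = (2 * pi) ^+ 2 * (`|t| ^+ 2 * h ^+ 2).
  by rewrite real_normK ?num_real // /y; ring.
have : 0 <= `|t| ^+ 2 * h ^+ 2 by apply: mulr_ge0; exact: sqr_ge0.
have -> : 24 * `|t| * h ^+ 2 * (2 * pi * `|t|) = 24 * (2 * pi) * (`|t| ^+ 2 * h ^+ 2) by ring.
set Z := `|t| ^+ 2 * h ^+ 2 => Z0.
have : 0 <= (2 * pi * Z) * (12 - 2 * pi) by apply: mulr_ge0; [apply: mulr_ge0 => //; lra | lra].
by clear; lra.
Qed.

(* [w] is the weight a'(n), [v] and [v'] stand for a(n) and a(n+1). *)
Lemma euler_maclaurin_term t w v v' : normc (w%:C%C * expi (t * v) - (expint t v' - expint t v))
  <= `|w - (v' - v)| + 24 * `|t| * (v' - v) ^+ 2.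
Proof.
have -> : expint t v' = expint t v + expi (t * v) * expint t (v' - v).
  by rewrite -expintD addrC subrK.
have -> : w%:C%C * expi (t * v) - (expint t v + expi (t * v) * expint t (v' - v) - expint t v) =
    expi (t * v) * ((w - (v' - v))%:C%C - (expint t (v' - v) - (v' - v)%:C%C)).
  by rewrite rmorphB /=; ring.
rewrite normcM normc_expi mul1r; apply: (le_trans (normcB_le _ _)).
by rewrite normc_real lerD2l expint_sub_le.
Qed.

End ExponentialIntegral.

(** * Estimates on one block and their summation *)

Section Blocks.
Context {R : realType}.
Implicit Types (t tau eps delta eta rho : R).

Lemma block_increments (a a1 : R -> R) (M L : nat) (A0 : R) eps (n : nat) :
  (forall y : R, M%:R <= y -> is_derive y 1 a (a1 y)) ->
  (forall y, M%:R <= y -> y <= (M + L)%:R -> `|a1 y - A0| <= eps * A0) -> (n < L)%N ->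
  `|a (M + n.+1)%:R - a (M + n)%:R - A0| <= eps * A0.
Proof.
move=> da ha nL.
have h0 : M%:R <= (M + n)%:R :> R by rewrite ler_nat leq_addr.
have h1 : (M + n)%:R <= (M + n.+1)%:R :> R by rewrite ler_nat leq_add2l.
have [c /andP[c1 c2] ->] := mvt_ge da h0 h1.
have -> : (M + n.+1)%:R - (M + n)%:R = 1 :> R by rewrite addnS -natr1; ring.
rewrite mulr1; apply: ha; first exact: le_trans c1.
by apply: (le_trans c2); rewrite ler_nat leq_add2l.
Qed.

Lemma telescope_block (V : zmodType) (F : nat -> V) (M L : nat) :
  F (M + L)%N - F M = \sum_(n < L) (F (M + n.+1)%N - F (M + n)%N).
Proof.
have := telescope_sumr (fun n => F (M + n)%N) (leq0n L).
by rewrite addn0 big_mkord => ->.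
Qed.

(** Converts the weight A0 L of a block into an increment of a, so that the errors of consecutive
    blocks telescope. *)
Lemma block_length_le (a a1 : R -> R) (M L : nat) (A0 : R) eps :
  (forall y : R, M%:R <= y -> is_derive y 1 a (a1 y)) ->
  (forall y, M%:R <= y -> y <= (M + L)%:R -> `|a1 y - A0| <= eps * A0) ->
  0 < A0 -> eps <= 2^-1 -> A0 * L%:R <= 2 * (a (M + L)%:R - a M%:R).
Proof.
move=> da ha A00 e2; rewrite (@telescope_block R (fun n => a n%:R)).
rewrite mulr_sumr mulr_natr -[X in _ *+ X]card_ord -sumr_const; apply: ler_sum => n _.
have := block_increments da ha (ltn_ord n); rewrite ler_norml => /andP[h _].
have := ler_wpM2r (ltW A00) e2; lra.
Qed.

(** The phase is slow: terms are compared with integrals one by one, and |t| (a(n+1) - a(n))^2 <= 4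
    tau A0 explains 96 = 24 * 4. *)
Lemma block_euler_maclaurin (a a1 : R -> R) (M L : nat) (A0 : R) eps tau t :
  (forall y : R, M%:R <= y -> is_derive y 1 a (a1 y)) ->
  (forall y, M%:R <= y -> y <= (M + L)%:R -> `|a1 y - A0| <= eps * A0) ->
  0 < A0 -> eps <= 2^-1 -> `|t| * A0 <= tau ->
  normc (\sum_(n < L) (a1 (M + n)%:R)%:C%C * expi (t * a (M + n)%:R) -
    (expint t (a (M + L)%:R) - expint t (a M%:R))) <= (2 * eps + 96 * tau) * (A0 * L%:R).
Proof.
move=> da ha A00 e2 tA.
rewrite (@telescope_block _ (fun n => expint t (a n%:R))) -sumrB.
apply: (le_trans (normc_sum_le _ _ _)).
rewrite mulrA mulr_natr -[X in _ *+ X]card_ord -sumr_const; apply: ler_sum => n _.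
apply: (le_trans (euler_maclaurin_term _ _ _ _)).
have h := block_increments da ha (ltn_ord n).
have h1 : `|a1 (M + n)%:R - A0| <= eps * A0.
  by apply: ha; rewrite ler_nat ?leq_addr // leq_add2l ltnW.
set D := a _ - a _ in h *.
have eA : eps * A0 <= A0 / 2 by have := ler_wpM2r (ltW A00) e2; lra.
move: h h1; rewrite !ler_norml => /andP[d1 d2] /andP[w1 w2].
have w : `|a1 (M + n)%:R - D| <= 2 * (eps * A0) by rewrite ler_norml; apply/andP; split; lra.
have D0 : 0 <= D by lra.
have D2 : D ^+ 2 <= 4 * A0 * A0.
  rewrite expr2; apply: (@le_trans _ _ ((2 * A0) * (2 * A0))); first by apply: ler_pM => //; lra.
  by lra.
have t0 := normr_ge0 t.
have h2 : `|t| * D ^+ 2 <= `|t| * A0 * (4 * A0).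
  by have := ler_wpM2l t0 D2; lra.
have h3 : `|t| * A0 * (4 * A0) <= tau * (4 * A0) by rewrite ler_wpM2r // mulr_ge0 // ltW.
by lra.
Qed.

(** The phase is fast: the sum is small by assumption once the weights are replaced by A0, and each
    of the two values of [expint] is at most 1 / |t| <= delta A0 L. *)
Lemma block_cancellation (a a1 : R -> R) (M L : nat) (A0 : R) eps tau delta t :
  (forall y, M%:R <= y -> y <= (M + L)%:R -> `|a1 y - A0| <= eps * A0) ->
  0 < A0 -> 0 < tau -> tau < `|t| * A0 -> 1 <= delta * tau * L%:R ->
  normc (\sum_(n < L) expi (t * a (M + n)%:R)) <= delta * L%:R ->
  normc (\sum_(n < L) (a1 (M + n)%:R)%:C%C * expi (t * a (M + n)%:R) -
    (expint t (a (M + L)%:R) - expint t (a M%:R))) <= (eps + 3 * delta) * (A0 * L%:R).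
Proof.
move=> ha A00 tau0 tA dL hS.
have t0 : t != 0 by apply: contraTneq tA => ->; rewrite normr0 mul0r -leNgt ltW.
have tp : 0 < `|t| by rewrite normr_gt0.
have b x : normc (expint t x) <= delta * (A0 * L%:R).
  rewrite -(ler_pM2r tp); apply: (le_trans (expint_bound _ t0)).
  apply: (le_trans dL).
  have d0 : 0 <= delta.
    by rewrite leNgt; apply/negP => d0; have := mulr_le0_ge0 (mulr_le0_ge0 (ltW d0) (ltW tau0)) (ler0n R L); lra.
  by have := ler_wpM2l (mulr_ge0 d0 (ler0n R L)) (ltW tA); lra.
rewrite (_ : \sum_(n < L) _ = \sum_(n < L) (a1 (M + n)%:R - A0)%:C%C * expi (t * a (M + n)%:R)
   + A0%:C%C * \sum_(n < L) expi (t * a (M + n)%:R)); last first.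
  by rewrite mulr_sumr -big_split /=; apply: eq_bigr => n _; rewrite rmorphB /=; ring.
apply: (le_trans (normcB_le _ _)).
have h1 := normcD_le (\sum_(n < L) (a1 (M + n)%:R - A0)%:C%C * expi (t * a (M + n)%:R))
   (A0%:C%C * \sum_(n < L) expi (t * a (M + n)%:R)).
have h2 : normc (\sum_(n < L) (a1 (M + n)%:R - A0)%:C%C * expi (t * a (M + n)%:R)) <= eps * (A0 * L%:R).
  apply: (le_trans (normc_sum_le _ _ _)).
  rewrite mulrA mulr_natr -[X in _ *+ X]card_ord -sumr_const; apply: ler_sum => n _.
  rewrite normcM normc_expi mulr1 normc_real.
  by apply: ha; rewrite ler_nat ?leq_addr // leq_add2l ltnW.
have h3 : normc (A0%:C%C * \sum_(n < L) expi (t * a (M + n)%:R)) <= delta * (A0 * L%:R).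
  rewrite normcM normc_real gtr0_norm // mulrCA.
  by rewrite ler_wpM2l // ltW.
have h4 := normcB_le (expint t (a (M + L)%:R)) (expint t (a M%:R)).
have := b (a (M + L)%:R); have := b (a M%:R).
by lra.
Qed.

(* Through the maximum of |g| on [x, y]. *)
Lemma relative_variation (g g' : R -> R) (C : R) : evy (fun x => is_derive x 1 g (g' x)) ->
  evy (fun x => `|x * g' x| <= C * `|g x|) ->
  forall eps, 0 < eps -> exists rho, [/\ 0 < rho, rho <= 1 &
    evy (fun x => forall y, x <= y -> y <= (1 + rho) * x -> `|g y - g x| <= eps * `|g x|)].
Proof.
move=> dg hg eps e0; pose D := `|C| + 1; have D1 : 1 <= D by rewrite lerDr.
pose rho := Num.min (1 / (2 * D)) (eps / (2 * D)).
have r0 : 0 < rho by rewrite lt_min !divr_gt0 // mulr_gt0 //; lra.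
have D0 : 0 < 2 * D by lra.
have r1 : D * rho <= 2^-1.
  have : rho <= 1 / (2 * D) by rewrite ge_min lexx.
  by rewrite ler_pdivlMr //; lra.
have r2 : 2 * (D * rho) <= eps.
  have : rho <= eps / (2 * D) by rewrite ge_min lexx orbT.
  by rewrite ler_pdivlMr //; lra.
exists rho; split => //; first by have := ler_wpM2r (ltW r0) D1; lra.
have [A hA] := evy_and (evy_ge 1) (evy_and dg hg).
exists A => x Ax y xy yx; have [x1 _] := hA x Ax; have x0 : 0 < x by lra.
have dgA z : A <= z -> is_derive z 1 g (g' z) by move=> /hA[_ []].
have cont : {within `[x, y], continuous (fun z => `|g z|)}.
  have cg : {within `[x, y], continuous g}.
    apply: derivable_within_continuous => z /[!in_itv]/= /andP[xz _].
    by have [] := dgA z (le_trans Ax xz).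
  by move=> z; apply: cvg_norm; exact: cg.
have [m /[!in_itv]/= /andP[xm my] hm] := @EVT_max R (fun z => `|g z|) x y xy cont.
have step z : x <= z -> z <= y -> `|g z - g x| <= D * rho * `|g m|.
  move=> xz zy; have [c /andP[xc cz] ->] := mvt_ge dgA Ax xz.
  have [c1 [_ hc]] := hA c (le_trans Ax xc); have c0 : 0 < c by lra.
  rewrite normrM (ger0_norm (_ : 0 <= z - x)) ?subr_ge0 //.
  rewrite normrM gtr0_norm // in hc.
  have gc : `|g c| <= `|g m| by apply: hm; rewrite in_itv /=; apply/andP; split; lra.
  have h1 : c * `|g' c| <= D * `|g m|.
    apply: (le_trans hc); apply: (@le_trans _ _ (D * `|g c|)).
      by rewrite ler_wpM2r // /D; have := ler_norm C; lra.
    by rewrite ler_wpM2l //; lra.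
  have h2 : x * `|g' c| <= D * `|g m| by apply: le_trans h1; rewrite ler_wpM2r.
  have h3 : `|g' c| * (z - x) <= `|g' c| * (rho * x) by rewrite ler_wpM2l //; lra.
  have := ler_wpM2l (ltW r0) h2; lra.
have gm : `|g m| <= 2 * `|g x|.
  have := step m xm my; have := lerB_normD (g m - g x) (g x).
  have : `|g m| <= `|g m - g x| + `|g x| by have := ler_normD (g m - g x) (g x); rewrite subrK.
  have := ler_wpM2r (normr_ge0 (g m)) r1; lra.
apply: (le_trans (step y xy (lexx _))).
have Dr0 : 0 <= D * rho by rewrite mulr_ge0 //; lra.
have := ler_wpM2l Dr0 gm; have := ler_wpM2r (normr_ge0 (g x)) r2; lra.
Qed.

(** Strong induction on N, removing a last block that begins near N / (1 + rho). N1 depends on rho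
    and M0 only, so that for families indexed by t the initial range can be bounded uniformly. *)
Lemma sum_over_blocks rho (M0 : nat) : 0 < rho -> rho <= 1 -> (0 < M0)%N ->
  exists N1 : nat, forall (z F : nat -> R[i]) (v : nat -> R) eta (C : R),
    (forall M L, (M0 <= M)%N -> rho / 2 * M%:R <= L%:R -> L%:R <= rho * M%:R ->
      normc (\sum_(n < L) z (M + n)%N - (F (M + L)%N - F M)) <= eta * (v (M + L)%N - v M)) ->
    (forall N, (M0 <= N <= N1)%N ->
      normc (\sum_(M0 <= n < N) z n - (F N - F M0)) <= C + eta * (v N - v M0)) ->
    forall N, (M0 <= N)%N ->
      normc (\sum_(M0 <= n < N) z n - (F N - F M0)) <= C + eta * (v N - v M0).
Proof.
move=> r0 r1 M00; have [X X0 hX] := nat_above (6 / rho).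
exists (2 * M0 + X)%N => z F v eta C blk base.
elim/ltn_ind => N IH MN; have [NN1|N1N] := leqP N (2 * M0 + X)%N.
  by apply: base; rewrite MN.
have rr : 0 < 1 + rho by lra.
have NX : 6 <= rho * N%:R.
  rewrite mulrC -ler_pdivrMr //; apply: (le_trans hX); rewrite ler_nat.
  by apply: leq_trans (ltnW N1N); rewrite leq_addl.
have N2M : 2 * M0%:R <= N%:R :> R.
  rewrite -natrM ler_nat; by apply: leq_trans (ltnW N1N); rewrite leq_addr.
pose w := N%:R / (1 + rho); have w0 : 0 <= w by rewrite divr_ge0 // ltW.
have wE : w * (1 + rho) = N%:R by rewrite divfK // gt_eqF.
(* Rounding up gives L <= rho M exactly; rho N >= 6 covers the resulting loss in the lower bound for
   L. *)
pose M := (Num.truncn w).+1.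
have M1 : w < M%:R by exact: truncnS_gt.
have M2 : M%:R <= w + 1 by rewrite /M -natr1 lerD2r truncn_le.
have NM : (M <= N)%N by rewrite -(ler_nat R); nra.
have LE : (N - M)%:R = N%:R - M%:R :> R by rewrite natrB.
have L1 : rho / 2 * M%:R <= (N - M)%:R.
  rewrite LE; have : rho * M%:R <= rho * (w + 1) by rewrite ler_wpM2l // ltW.
  have : rho * w * 2 >= rho * N%:R.
    have : rho * w * (1 + rho) <= rho * w * 2 by apply: ler_wpM2l; [nneg | lra].
    by rewrite -wE; lra.
  by lra.
have L2 : (N - M)%:R <= rho * M%:R.
  have : w * (1 + rho) <= M%:R * (1 + rho) by rewrite ler_wpM2r // ltW.
  by rewrite LE wE; lra.
have M0M : (M0 <= M)%N by rewrite -(ler_nat R); nra.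
have L0 : (0 < N - M)%N.
  by rewrite -(ltr_nat R); apply: lt_le_trans L1; rewrite mulr_gt0 ?divr_gt0.
have MlN : (M < N)%N by rewrite -subn_gt0.
have := blk M (N - M)%N M0M L1 L2; rewrite subnKC // => h1.
have h2 := IH M MlN M0M.
have -> : \sum_(M0 <= n < N) z n - (F N - F M0) =
  (\sum_(M0 <= n < M) z n - (F M - F M0)) + (\sum_(n < N - M) z (M + n)%N - (F N - F M)).
  rewrite (@big_cat_nat _ _ _ M) //= -{2}[M]add0n big_addn big_mkord.
  under [X in _ + X - _]eq_bigr do rewrite addnC.
  by ring.
apply: (le_trans (normcD_le _ _)); lra.
Qed.

End Blocks.

(** * Cancellation on blocks in the van der Corput case *)

Section Cancellation.
Context {R : realType}.
Implicit Types (t tau eps delta eta rho : R).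

Lemma evy_all (n : nat) (P : nat -> R -> Prop) : (forall i, (i < n)%N -> evy (P i)) ->
  evy (fun x => forall i, (i < n)%N -> P i x).
Proof.
elim: n => [|n IHn] h; first by exists 0.
have h1 := IHn (fun i ni => h i (ltnW ni)).
apply: evy_imp (evy_and h1 (h n (ltnSn n))) _ => x [h2 h3] i.
by rewrite ltnS leq_eqVlt => /predU1P[->|/h2].
Qed.

Lemma uniform_small (n : nat) (Q : nat -> R -> Prop) :
  (forall i c c', Q i c -> 0 < c' -> c' <= c -> Q i c') ->
  (forall i, (i < n)%N -> exists2 c, 0 < c & Q i c) ->
  exists2 c, 0 < c & forall i, (i < n)%N -> Q i c.
Proof.
move=> mono; elim: n => [|n IHn] h; first by exists 1.
have [c1 c10 h1] := IHn (fun i ni => h i (ltnW ni)).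
have [c2 c20 h2] := h n (ltnSn n).
have c0 : 0 < Num.min c1 c2 by rewrite lt_min c10.
exists (Num.min c1 c2) => // i; rewrite ltnS leq_eqVlt => /predU1P[->|/h1 h3].
  by apply: mono h2 _ _ => //; rewrite ge_min lexx orbT.
by apply: mono h3 _ _ => //; rewrite ge_min lexx.
Qed.

(** The test with eps in place of 1 / C. In this form it passes to smaller eps, so one eps serves
    finitely many orders. *)
Definition difference_test_holds delta (k : nat) eps : Prop :=
  forall (L : nat) lam (u : nat -> R), 0 < lam -> lam <= eps ->
    1 <= eps * (lam * L%:R ^+ k.+1) ->
    (forall n, (n + k.+1 < L)%N -> `|iter k.+1 fdiff u n - lam| <= eps * lam) ->
    normc (\sum_(n < L) expi (u n)) <= delta * L%:R.

Lemma difference_test_eps (n : nat) delta : 0 < delta ->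
  exists2 eps, 0 < eps & forall k, (k < n)%N -> difference_test_holds delta k eps.
Proof.
move=> d0; apply: uniform_small => [k c c' h c0 cc L lam u l0 lc Lc hu|k _].
  apply: (h L lam u l0 (le_trans lc cc)).
    by apply: (le_trans Lc); rewrite ler_wpM2r // mulr_ge0 ?exprn_ge0 // ltW.
  by move=> m hm; apply: (le_trans (hu m hm)); rewrite ler_wpM2r // ltW.
have [C C1 h] := @difference_test R k delta d0; have C0 : 0 < C by lra.
exists C^-1; first by rewrite invr_gt0.
move=> L lam u l0 lC CL hu; apply: (h L lam u l0).
- by rewrite -ler_pdivlMr // mul1r.
- by rewrite -[leLHS]mulr1 -ler_pdivlMl.
- by move=> m hm; apply: (le_trans (hu m hm)); rewrite mulrC.
Qed.

Lemma iter_fdiff_translate (u : nat -> R) (k m n : nat) :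
  iter k fdiff u (m + n)%N = iter k fdiff (fun i => u (i + n)%N) m.
Proof. by elim: k m => // k IH m; rewrite !iterS /fdiff -!IH addSn. Qed.

Lemma iter_fdiff_near (f : nat -> R -> R) (M k n : nat) (s b lam : R) :
  (forall i (y : R), (i < k)%N -> M%:R <= y -> is_derive y 1 (f i) (f i.+1 y)) ->
  (forall y : R, M%:R <= y -> y <= (M + n + k)%:R -> `|s * f k y - lam| <= b) ->
  `|iter k fdiff (fun n => s * f 0%N (M + n)%:R) n - lam| <= b.
Proof.
move=> df hf; have := iter_fdiff_translate (fun n => s * f 0%N (M + n)%:R) k 0 n.
rewrite add0n => ->.
have -> : (fun i => s * f 0%N (M + (i + n))%:R) = (fun i => s * f 0%N ((M + n)%:R + 1 * i%:R)).
  by apply/funext => i; rewrite mul1r -natrD; congr (_ * f _ _%:R); lia.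
have [i y ik Xy|||z /andP[z1 z2] ->] := @iter_fdiff_mvt R k (fun i y => s * f i y) M%:R (M + n)%:R 1.
- by apply: der_scale; exact: df.
- by rewrite ler_nat leq_addr.
- exact: ler01.
rewrite expr1n mul1r; apply: hf; first by apply: le_trans z1; rewrite ler_nat leq_addr.
by apply: (le_trans z2); rewrite mulr1 -natrD.
Qed.

Definition block_cancels (a a1 : R -> R) : Prop :=
  forall (K : R) delta tau, 0 < K -> 0 < delta -> 0 < tau ->
  exists2 rho1 : R, 0 < rho1 & forall rho, 0 < rho -> rho <= rho1 -> rho <= 1 ->
  evy (fun x : R => forall (M L : nat) t, x = M%:R -> rho / 2 * M%:R <= L%:R -> L%:R <= rho * M%:R ->
    `|t| <= K -> tau < `|t| * a1 M%:R ->
    normc (\sum_(n < L) expi (t * a (M + n)%:R)) <= delta * L%:R).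

Lemma normc_expi_sum_opp (L : nat) (u : nat -> R) :
  normc (\sum_(n < L) expi (- u n)) = normc (\sum_(n < L) expi (u n)).
Proof.
rewrite -[RHS]normc_conj rmorph_sum /=; congr normc.
by apply: eq_bigr => n _; rewrite expiN.
Qed.

(** i is the least order >= 1 with |t f i(M)| <= tau'. It is at least 2 by the assumption on |t|
    a'(M), and minimality gives |t| f i.-1(M) > tau', so the growth clause makes |t f i(M)| L^i
    large: the test of order i applies. *)
Lemma van_der_corput_case_cancels (f : nat -> R -> R) :
  (forall i, evy (fun x => is_derive x 1 (f i) (f i.+1 x))) -> van_der_corput_case f ->
  block_cancels (f 0%N) (f 1%N).
Proof.
move=> df [j [j1 tj pos ratio growth]] K delta tau K0 d0 tau0.
have [eps e0 test] := difference_test_eps j d0.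
have [rho1 r10 hr] : exists2 rho1, 0 < rho1 & forall k, (k < j)%N ->
    evy (fun x => forall y, x <= y -> y <= (1 + rho1) * x -> `|f k.+1 y - f k.+1 x| <= eps * `|f k.+1 x|).
  apply: uniform_small => [k c c' h c'0 cc|k kj].
    apply: evy_imp (evy_and (evy_ge 0) h) _ => x [x0 hx] y xy yx; apply: hx => //.
    by apply: (le_trans yx); rewrite ler_wpM2r // lerD2l.
  have [C hC] := ratio k.+1 kj.
  by have [c [c0 _ hc]] := relative_variation (df k.+1) hC e0; exists c.
exists rho1 => // rho r0 rr1 rle1.
pose tau' := Num.min tau eps.
have tau'0 : 0 < tau' by rewrite lt_min tau0.
have t1 : tau' <= tau by rewrite ge_min lexx.
have t2 : tau' <= eps by rewrite ge_min lexx orbT.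
have rh : 0 < rho / 2 by rewrite divr_gt0.
(* With this B the growth clause yields eps lam L^i >= 1 for L >= rho M / 2. *)
pose B := (eps * tau' * (rho / 2) ^+ j)^-1.
have B0 : 0 < B by rewrite invr_gt0 !mulr_gt0 // exprn_gt0.
have BE : eps * (B * tau' * (rho / 2) ^+ j) = 1.
  have -> : eps * (B * tau' * (rho / 2) ^+ j) = B * (eps * tau' * (rho / 2) ^+ j) by ring.
  by rewrite mulVf // gt_eqF // !mulr_gt0 // exprn_gt0.
have tK0 : 0 < tau' / K by rewrite divr_gt0.
have dfall := evy_all (fun i (_ : (i < j.+1)%N) => df i).
have hrall := evy_all hr.
have posall : evy (fun x => forall i, (i < j)%N -> (0 < i)%N -> 0 < f i x).
  apply: evy_all => i ij; have [->|i0] := posnP i; first by exists 0.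
  have [|c c0 hc] := pos i; first by rewrite i0.
  by apply: evy_imp hc _ => x hx _; apply: lt_le_trans hx.
have growall : evy (fun x => forall i, (i < j.+1)%N -> (1 < i)%N -> B * f i.-1 x <= x ^+ i * `|f i x|).
  apply: evy_all => i ij; have [i1|i1] := ltnP 1 i; last by exists 0.
  by apply: evy_imp (growth i B _) _ => [|x //]; rewrite i1.
have [A hA] := dfall.
apply: evy_imp (evy_and (evy_ge (Num.max A 1)) (evy_and hrall (evy_and posall
  (evy_and growall (tj _ tK0))))) _.
move=> x [xA [hvar [hpos [hgrow htj]]]] M L t xM L1 L2 tK ht; rewrite xM in xA hvar hpos hgrow htj.
rewrite ge_max in xA; have /andP[MA M1] := xA.
have M0 := lt_le_trans ltr01 M1.
have t0 : 0 < `|t|.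
  by rewrite normr_gt0; apply: contraTneq ht => ->; rewrite normr0 mul0r -leNgt ltW.
have exi : exists i, [&& (0 < i)%N, (i <= j)%N & `|t| * `|f i M%:R| <= tau'].
  exists j; rewrite leqnn (ltnW j1) /=.
  apply: (@le_trans _ _ (K * (tau' / K))); first by apply: ler_pM.
  by rewrite mulrC divfK // gt_eqF.
case: (ex_minnP exi) => i /and3P[i0 ij hi] mini.
have i1 : (1 < i)%N.
  rewrite ltn_neqAle i0 andbT; apply/eqP => E; move: hi; rewrite -E leNgt => /negP; apply.
  by apply: (le_lt_trans t1); rewrite (gtr0_norm (hpos 1%N j1 isT)).
have hprev : tau' < `|t| * f i.-1 M%:R.
  have pi1 : (0 < i.-1)%N by rewrite -ltnS prednK.
  have ilt : (i.-1 < i)%N by rewrite prednK.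
  have pip : 0 < f i.-1 M%:R by apply: hpos => //; exact: leq_trans ij.
  rewrite ltNge; apply/negP => h; have := mini i.-1.
  rewrite pi1 (leq_trans (ltnW ilt) ij) (gtr0_norm pip) h.
  by move=> /(_ isT); rewrite leqNgt ilt.
have hg := hgrow i ij i1.
have prevpos : 0 < f i.-1 M%:R by have := lt_trans tau'0 hprev; rewrite pmulr_rgt0.
have fi0 : 0 < `|f i M%:R|.
  have : 0 < M%:R ^+ i * `|f i M%:R| by apply: lt_le_trans hg; rewrite mulr_gt0.
  by rewrite pmulr_rgt0 // exprn_gt0.
pose lam := `|t * f i M%:R|.
have lE : lam = `|t| * `|f i M%:R| by rewrite /lam normrM.
have l0 : 0 < lam by rewrite lE mulr_gt0.
(* Changing the sign of t conjugates the sum, so s may replace t; it has s f i(M) = lam > 0. *)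
pose s := Num.sg (t * f i M%:R) * t.
have sE : s * f i M%:R = lam by rewrite /s -mulrA -normrEsg.
have sn : `|s| = `|t|.
  by rewrite /s normrM normr_sg -[_ != 0]normr_gt0 l0 mul1r.
have -> : normc (\sum_(n < L) expi (t * f 0%N (M + n)%:R)) = normc (\sum_(n < L) expi (s * f 0%N (M + n)%:R)).
  have nz : t * f i M%:R != 0 by rewrite -normr_gt0.
  rewrite /s; have [h|h|h] := ltgtP (t * f i M%:R) 0; last by rewrite h eqxx in nz.
  - rewrite ltr0_sg //; under [in RHS]eq_bigr do rewrite mulN1r mulNr.
    by rewrite (@normc_expi_sum_opp L (fun n => t * f 0%N (M + n)%:R)).
  - by rewrite gtr0_sg // mul1r.
have ik : i = i.-1.+1 by rewrite prednK.
have ij1 : (i.-1 < j)%N by rewrite -ik.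
apply: (test i.-1 ij1 L lam (fun n => s * f 0%N (M + n)%:R)) => //.
- by rewrite lE; apply: (le_trans hi).
- rewrite -ik.
  have hL : (rho / 2 * M%:R) ^+ i <= L%:R ^+ i by rewrite lerXn2r ?nnegrE //; nneg.
  have h1 : lam * (rho / 2 * M%:R) ^+ i <= lam * L%:R ^+ i by rewrite ler_wpM2l // ltW.
  have h2 : (rho / 2) ^+ j <= (rho / 2) ^+ i.
    by apply: ler_wiXn2l; [exact: ltW | clear -rle1 r0; lra | exact: ij].
  have h3 : (rho / 2) ^+ i * (`|t| * (B * f i.-1 M%:R)) <= (rho / 2) ^+ i * (`|t| * (M%:R ^+ i * `|f i M%:R|)).
    by rewrite ler_wpM2l ?exprn_ge0 ?(ltW rh) // ler_wpM2l.
  have h4 : (rho / 2) ^+ i * (B * tau') <= (rho / 2) ^+ i * (B * (`|t| * f i.-1 M%:R)).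
    by rewrite ler_wpM2l ?exprn_ge0 ?(ltW rh) // ler_wpM2l ?(ltW B0) // ltW.
  have h5 : (rho / 2) ^+ j * (B * tau') <= (rho / 2) ^+ i * (B * tau').
    by rewrite ler_wpM2r // mulr_ge0 // ltW.
  apply: (@le_trans _ _ (eps * (B * tau' * (rho / 2) ^+ j))); first by rewrite BE.
  rewrite ler_wpM2l ?(ltW e0) //; apply: le_trans h1.
  have -> : lam * (rho / 2 * M%:R) ^+ i = (rho / 2) ^+ i * (`|t| * (M%:R ^+ i * `|f i M%:R|)).
    by rewrite lE exprMn; ring.
  clear -h3 h4 h5; lra.
move=> n hn; rewrite -ik; apply: iter_fdiff_near.
  move=> m y mi My; have := hA y (le_trans MA My) m; apply.
  by rewrite ltnS ltnW // (leq_trans mi).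
move=> y My yM; rewrite -sE -mulrBr normrM sn sE lE mulrCA ler_wpM2l //.
have := hvar i.-1; rewrite prednK // => /(_ ij y My); apply.
apply: (le_trans yM); apply: (@le_trans _ _ ((1 + rho) * M%:R)); last first.
  by rewrite ler_wpM2r // lerD2l.
rewrite mulrDl mul1r -addnA natrD lerD2l; apply: le_trans L2; rewrite ler_nat.
by rewrite ik ltnW.
Qed.

End Cancellation.

(** * Cancellation on blocks in the polynomial case *)

Section PolynomialCancellation.
Context {R : realType}.
Implicit Types (t tau eps delta eta rho : R).

Lemma derivable_sum_ord (n : nat) (G : nat -> R -> R) (x : R) :
  (forall i, derivable (G i) x 1) -> derivable (fun y => \sum_(i < n) G i y) x 1.
Proof.
move=> dG; elim: n => [|n IHn].
  rewrite (_ : (fun _ => _) = (fun _ => 0)); last by apply/funext => y; rewrite big_ord0.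
  exact: derivable_cst.
rewrite (_ : (fun _ => _) = (fun y => \sum_(i < n) G i y) + G n); last first.
  by apply/funext => y; rewrite big_ord_recr.
by apply: derivableD; [exact: IHn | exact: dG].
Qed.

Lemma expi_eq1_int (x : R) : cos (2 * pi * x) = 1 -> exists k : int, x = k%:~R.
Proof.
move=> hc; have [k hk] := near_int_half x; exists k.
apply/eqP; rewrite -subr_eq0 -normr_le0; apply: (le_trans (expiB1_ge hk)).
have -> : expi (x - k%:~R) = expi x by rewrite expiD -intrN expi_int mulr1.
have hs : sin (2 * pi * x) = 0.
  by apply/eqP; rewrite -sqrf_eq0 sin2cos2 hc expr1n subrr.
have -> : expi x = 1 by rewrite /expi hc hs.
by rewrite subrr normc0.
Qed.

(* Compactness of kappa0 <= |kappa| <= B. *)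
Lemma irrational_coef_gap (P : {poly R}) (B : R) :
  (forall kappa, kappa != 0 -> ~ (forall i, (0 < i)%N -> exists k : int, kappa * P`_i = k%:~R)) ->
  exists2 e : R, 0 < e & forall kappa, `|kappa| <= B ->
    (forall i, (0 < i < size P)%N -> near_int (kappa * P`_i) e) ->
    forall i, (0 < i)%N -> `|kappa * P`_i| <= 2^-1.
Proof.
move=> irr; pose S : R := 1 + \sum_(i < size P) `|P`_i|.
have SP i : `|P`_i| <= S.
  have [iP|Pi] := ltnP i (size P); last first.
    by rewrite nth_default // normr0 /S addr_ge0 // sumr_ge0.
  rewrite /S (bigD1 (Ordinal iP)) //= addrCA lerDl addr_ge0 // sumr_ge0 //.
have S1 : 1 <= S by rewrite /S lerDl sumr_ge0.
(* For |kappa| <= k0 the conclusion is immediate from the size of the coefficients, which leaves a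
   compact range of |kappa|. *)
pose k0 := (2 * S)^-1; have k00 : 0 < k0 by rewrite invr_gt0; lra.
have small kappa : `|kappa| <= k0 -> forall i, `|kappa * P`_i| <= 2^-1.
  move=> hk i; rewrite normrM; apply: (@le_trans _ _ (k0 * S)); first by apply: ler_pM.
  by rewrite /k0 invfM -mulrA mulVf ?mulr1 // gt_eqF //; lra.
(* F, the sum of the [G i], is continuous and vanishes exactly where all x P_i with i > 0 are
   integers, so by [irr] it has a positive minimum on [k0, B]. *)
pose G i (x : R) : R := if (0 < i)%N then 1 - cos (2 * pi * (x * P`_i)) else 0.
pose F x := \sum_(i < size P) G i x.
have G0 i x : 0 <= G i x by rewrite /G; case: ifP => // _; rewrite subr_ge0 cos_le1.
have [Bk|kB] := leP B k0.
  by exists 1 => // kappa kB _ i _; apply: small; exact: le_trans Bk.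
have dG i x : derivable (G i) x 1.
  rewrite /G; case: (0 < i)%N; last exact: derivable_cst.
  have dx := @is_derive1_comp R (@cos R) (fun y => 2 * pi * (y * P`_i)) x _ _
     (is_derive_cos _) (der_scale (2 * pi) (der_mul (der_id x) (der_cst P`_i x))).
  by have [] := der_sub (der_cst 1 x) dx.
have cF : {within `[k0, B], continuous F}.
  by apply: derivable_within_continuous => x _; exact: derivable_sum_ord.
have [m /[!in_itv]/= /andP[k0m mB] hm] := EVT_min (ltW kB) cF.
have Fm : 0 < F m.
  rewrite lt_def sumr_ge0 ?andbT //; apply/eqP => F0.
  have m0 : m != 0 by rewrite gt_eqF // (lt_le_trans k00).
  apply: (irr m m0) => i i0; have [iP|Pi] := ltnP i (size P); last first.
    by exists 0; rewrite nth_default // mulr0.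
  have := @psumr_eq0P _ _ xpredT (fun j : 'I_(size P) => G j m) (fun j _ => G0 j m) F0 (Ordinal iP) isT.
  by rewrite /G /= i0 => /eqP; rewrite subr_eq0 => /eqP/esym/expi_eq1_int.
have sz0 : 0 < (size P)%:R + 1 :> R by rewrite ltr_wpDl.
pose e := F m / (16 * ((size P)%:R + 1)).
have e0 : 0 < e by rewrite divr_gt0 // mulr_gt0.
exists e => // kappa kB' near; have [h|h] := leP `|kappa| k0.
  by move=> i _; exact: small.
exfalso; have Fk : F kappa = F `|kappa|.
  apply: eq_bigr => i _; rewrite /G; case: ifP => // _; congr (1 - _).
  have [k_ge0|k_lt0] := leP 0 kappa; first by rewrite ger0_norm.
  by rewrite ltr0_norm // mulNr mulrN cosN.
have h1 : F m <= F kappa by rewrite Fk; apply: hm; rewrite in_itv /= (ltW h).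
have h2 : F kappa <= (size P)%:R * (8 * e).
  rewrite mulr_natl -[X in _ *+ X]card_ord -sumr_const; apply: ler_sum => i _.
  rewrite /G; case: ifPn => i0; last by rewrite mulr_ge0 // ltW.
  have [|k hk] := near i; first by rewrite i0 ltn_ord.
  set x := kappa * _ in hk *.
  have : 1 - cos (2 * pi * x) <= normc (expi x - 1).
    rewrite -normc_opp opprB; apply: (le_trans (ler_norm _)).
    rewrite -(ler_pXn2r (ltn0Sn 1)) ?nnegrE ?normc_ge0 // normc_sqrE /=.
    by rewrite real_normK ?num_real // lerDl sqr_ge0.
  move/le_trans; apply; have -> : expi x = expi (x - k%:~R).
    by rewrite expiD -intrN expi_int mulr1.
  by apply: (le_trans (expiB1_le _)); rewrite ler_wpM2l.
have h3 : 16 * ((size P)%:R + 1) * e = F m by rewrite /e mulrC divfK // gt_eqF // mulr_gt0.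
have : 0 <= (size P)%:R * e by rewrite mulr_ge0 // ltW.
by lra.
Qed.

Lemma perturbed_sum_le (L : nat) (u v : nat -> R) (b E : R) :
  (forall n, (n < L)%N -> `|u n - v n - b| <= E) ->
  normc (\sum_(n < L) expi (u n)) <= normc (\sum_(n < L) expi (v n)) + 8 * E * L%:R.
Proof.
move=> h; have -> : normc (\sum_(n < L) expi (v n)) = normc (\sum_(n < L) expi (b + v n)).
  under [in RHS]eq_bigr do rewrite expiD.
  by rewrite -mulr_sumr normcM normc_expi mul1r.
have -> : \sum_(n < L) expi (u n) = \sum_(n < L) expi (b + v n) +
   \sum_(n < L) (expi (u n) - expi (b + v n)).
  by rewrite -big_split /=; apply: eq_bigr => n _; rewrite addrC subrK.
apply: (le_trans (normcD_le _ _)); rewrite lerD2l.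
apply: (le_trans (normc_sum_le _ _ _)).
rewrite mulr_natr -[X in _ *+ X]card_ord -sumr_const; apply: ler_sum => n _.
apply: (le_trans (expi_lip _ _)); rewrite ler_wpM2l //.
by have := h n (ltn_ord n); rewrite opprD addrA addrAC.
Qed.

(** If a block did not cancel, [polynomial_weyl_inverse] would put q t P_i within Q / L^i of an
    integer. [irrational_coef_gap] with kappa = q t forces this integer to be 0, so |t P_i| <= Q /
    L^i and t a'(M) = O(1 / L), which is below tau for large M. *)
Lemma polynomial_case_cancels (a a1 : R -> R) (P : {poly R}) (C : R) :
  evy (fun x => is_derive x 1 a (a1 x)) -> evy (fun x => `|a1 x - P^`().[x]| <= C / x) ->
  (forall kappa, kappa != 0 -> ~ (forall i, (0 < i)%N -> exists k : int, kappa * P`_i = k%:~R)) ->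
  block_cancels a a1.
Proof.
move=> da ha irr K delta tau K0 d0 tau0.
pose D := `|C| + 1; have D1 : 1 <= D by rewrite lerDr.
have Dge0 : 0 <= D by lra.
have KD : 0 < K * D by rewrite mulr_gt0 //; lra.
(* a - P changes by at most D rho on a block; this choice makes the loss 8 K D rho at most delta /
   2. *)
exists (delta / (16 * (K * D))); first by rewrite divr_gt0 // mulr_gt0.
move=> rho r0 rr1 rle1.
have rK : 16 * (K * D * rho) <= delta.
  by move: rr1; rewrite ler_pdivlMr ?mulr_gt0 //; lra.
have [D0 D00 hD0] := nat_above (2 / rho).
have d20 : 0 < delta / 2 by rewrite divr_gt0.
have [Q Q0 W] := polynomial_weyl_inverse (size P) d20 D00.
have Qr : 1 <= Q%:R :> R by rewrite ler1n.
have [e e0 gap] := irrational_coef_gap (Q%:R * K) irr.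
(* Y bounds L |t P'(M)|, given |t P_(i+1)| <= Q / L^(i+1) and M <= (2 / rho) L. *)
pose Y : R := \sum_(i < size P) i.+1%:R * Q%:R * (2 / rho) ^+ i.
have Y0 : 0 <= Y by apply: sumr_ge0 => i _; nneg.
(* The summands serve, in turn, Q / L <= e, Q / L < 1/2 and (Y + K D) / L <= tau. *)
pose Z : R := 1 + Q%:R / e + 4 * Q%:R + 4 * (Y + K * D) / tau.
have Qe0 : 0 <= Q%:R / e by nneg.
have YK0 : 0 <= 4 * (Y + K * D) / tau by nneg.
have Z1 : 1 + Q%:R / e <= Z by rewrite /Z; lra.
have Z2 : 4 * Q%:R <= Z by rewrite /Z; lra.
have Z3 : 4 * (Y + K * D) / tau <= Z by rewrite /Z; lra.
have [A hA] := evy_and da ha.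
have dA z : A <= z -> is_derive z 1 a (a1 z) by move=> /hA[].
apply: evy_imp (evy_and (evy_ge (2 * Z / rho)) (evy_ge (Num.max A 1))) _.
move=> x [xZ xA] M L t xM L1 L2 tK ht; rewrite xM in xZ xA.
have {xA}[MA M1] : A <= M%:R /\ 1 <= M%:R :> R by move: xA; rewrite ge_max => /andP[].
have M0 := lt_le_trans ltr01 M1.
have LZ : Z <= L%:R.
  apply: le_trans L1; move: xZ; rewrite ler_pdivrMr //; clear; lra.
have Z0 : 1 <= Z by apply: le_trans Z1; rewrite lerDl; nneg.
have Lr1 := le_trans Z0 LZ.
have L0 := lt_le_trans ltr01 Lr1.
rewrite leNgt; apply/negP => hS.
have per : normc (\sum_(n < L) expi (t * a (M + n)%:R)) <=
    normc (\sum_(n < L) expi ((t *: P).[1%:R * n%:R + M%:R])) + 8 * (K * D * rho) * L%:R.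
  apply: (@perturbed_sum_le L (fun n => t * a (M + n)%:R) (fun n => (t *: P).[1%:R * n%:R + M%:R])
    (t * (a M%:R - P.[M%:R]))) => n nL.
  have Mn : M%:R <= (M + n)%:R :> R by rewrite ler_nat leq_addr.
  have [|c /andP[c1 c2] E] := @mvt_ge R (fun z => a z - P.[z]) (fun z => a1 z - P^`().[z]) A M%:R (M + n)%:R _ MA Mn.
    by move=> z /dA dz; apply: der_sub => //; exact: der_horner.
  have -> : 1%:R * n%:R + M%:R = (M + n)%:R :> R by rewrite mul1r addrC natrD.
  rewrite hornerZ.
  have -> : t * a (M + n)%:R - t * P.[(M + n)%:R] - t * (a M%:R - P.[M%:R]) =
     t * ((a1 c - P^`().[c]) * ((M + n)%:R - M%:R)) by rewrite -E; ring.
  rewrite natrD addrAC subrr add0r !normrM (ger0_norm (ler0n R n)).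
  rewrite -[leRHS]mulrA; apply: ler_pM; [nneg | nneg | exact: tK |].
  have [_ hc] := hA c (le_trans MA c1); have c0 := lt_le_trans M0 c1.
  apply: (@le_trans _ _ (D / M%:R * (rho * M%:R))); last first.
    by rewrite le_eqVlt; apply/orP; left; apply/eqP; field; rewrite gt_eqF.
  apply: ler_pM => //.
    apply: (le_trans hc); apply: (@le_trans _ _ (D / c)).
      by rewrite ler_wpM2r ?invr_ge0 ?(ltW c0) // /D; have := ler_norm C; clear; lra.
    by rewrite ler_wpM2l ?lef_pV2 ?posrE //; lra.
  by apply: le_trans L2; rewrite ler_nat ltnW.
have hP : delta / 2 * L%:R <= normc (\sum_(n < L) expi ((t *: P).[1%:R * n%:R + M%:R])).
  have := ler_wpM2r (ltW L0) rK; move: hS per; clear; lra.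
have MD : (M <= D0 * L)%N.
  rewrite -(ler_nat R) natrM; apply: (@le_trans _ _ (2 / rho * L%:R)); last by rewrite ler_wpM2r.
  rewrite mulrAC ler_pdivlMr //; clear -L1; lra.
have [|||q /andP[q0 qQ] hq] := W (t *: P) L 1%N M _ _ _ MD hP.
- by apply: leq_trans (size_scale_leq _ _) _.
- by rewrite -(ltr_nat R).
- by rewrite D00.
have q1 : 1 <= q%:R :> R by rewrite ler1n.
have kB : `|q%:R * t| <= Q%:R * K.
  by rewrite normrM ger0_norm //; apply: ler_pM => //; rewrite ler_nat.
have near i : (0 < i < size P)%N -> near_int (q%:R * t * P`_i) (Q%:R / L%:R ^+ i).
  by move=> /andP[i0 iP]; have := hq i; rewrite i0 ltnW // coefZ mulrA; apply.
have Lpow i : (0 < i)%N -> L%:R <= L%:R ^+ i :> R by move=> i0; rewrite ler_eXnr.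
have QL i : (0 < i)%N -> Q%:R / L%:R ^+ i <= Q%:R / L%:R :> R.
  by move=> i0; apply: ler_wpM2l => //; rewrite lef_pV2 ?posrE ?exprn_gt0 ?Lpow.
have QLe : Q%:R / L%:R <= e.
  rewrite ler_pdivrMr // mulrC -ler_pdivrMr //; apply: le_trans LZ; clear -Z1; lra.
have QL2 : Q%:R / L%:R < 2^-1 :> R by rewrite ltr_pdivrMr //; clear -Z2 LZ Qr; lra.
have half := gap _ kB (fun i hi => near_intW (le_trans (QL i (andP hi).1) QLe) (near i hi)).
have coef i : (0 < i < size P)%N -> `|t * P`_i| <= Q%:R / L%:R ^+ i.
  move=> hi; have i0 := (andP hi).1.
  have := near_int_small (near i hi) (le_lt_trans (QL i i0) QL2) (half i i0).
  rewrite -mulrA normrM ger0_norm //; apply: le_trans.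
  by rewrite ler_peMl.
have hP' : `|t * P^`().[M%:R]| <= Y / L%:R.
  rewrite (horner_coef_wide _ (_ : size P^`() <= size P)%N); last first.
    have [->|nz] := eqVneq P 0; first by rewrite deriv0.
    by rewrite ltnW // lt_size_deriv.
  rewrite mulr_sumr /Y mulr_suml; apply: (le_trans (ler_norm_sum _ _ _)).
  apply: ler_sum => i _; rewrite coef_deriv mulrA normrM -[_ *+ i.+1]mulr_natl mulrCA normrM.
  rewrite ger0_norm // (ger0_norm (exprn_ge0 _ (ler0n R M))) -!mulrA ler_wpM2l //.
  have [iP|Pi] := ltnP i.+1 (size P); last first.
    by rewrite nth_default // mulr0 normr0 mul0r; nneg.
  have h1 := coef i.+1 iP.
  apply: (@le_trans _ _ (Q%:R / L%:R ^+ i.+1 * (2 / rho * L%:R) ^+ i)).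
    apply: ler_pM; [nneg | nneg | exact: h1 |].
    rewrite lerXn2r ?nnegrE //; first by nneg.
    by rewrite mulrAC ler_pdivlMr //; clear -L1; lra.
  rewrite exprMn exprS le_eqVlt; apply/orP; left; apply/eqP; field.
  by rewrite !gt_eqF // exprn_gt0.
have h1 : `|t| * a1 M%:R <= Y / L%:R + K * (D / M%:R).
  have [_ hM] := hA _ MA.
  have h2 : `|a1 M%:R - P^`().[M%:R]| <= D / M%:R.
    by apply: (le_trans hM); rewrite ler_wpM2r ?invr_ge0 // /D; have := ler_norm C; clear; lra.
  apply: (@le_trans _ _ (`|t * a1 M%:R|)).
    by rewrite normrM ler_wpM2l // ler_norm.
  have -> : t * a1 M%:R = t * P^`().[M%:R] + t * (a1 M%:R - P^`().[M%:R]) by ring.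
  apply: (le_trans (ler_normD _ _)); rewrite normrM in hP'; apply: lerD; first by rewrite normrM.
  by rewrite normrM; apply: ler_pM.
have LM : L%:R <= M%:R :> R by apply: (le_trans L2); rewrite ler_piMl.
have h2 : K * (D / M%:R) <= K * D / L%:R.
  by rewrite mulrA ler_wpM2l ?(ltW KD) // lef_pV2 ?posrE.
have h3 : (Y + K * D) / L%:R <= tau.
  rewrite ler_pdivrMr //; have := le_trans Z3 LZ; rewrite ler_pdivrMr //.
  have : 0 <= Y + K * D by nneg.
  by clear; lra.
by move: h1 h2 h3 ht; rewrite mulrDl; clear; lra.
Qed.

End PolynomialCancellation.

(** * Weighted exponential sums with real frequency *)

Section ExponentialSumEstimate.
Context {R : realType}.
Implicit Types (t tau eps delta eta rho : R).

(** For x > 1 the punctured neighbourhoods of x within [1, +oo[ are the usual ones. *)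
Lemma deriv_ge1_derive (a : R -> R) (x d : R) : 1 < x -> is_derive x 1 a d -> deriv_ge1 a x = d.
Proof.
move=> x1 [da dE]; rewrite /deriv_ge1.
have -> : within `[1, +oo[ x^' = x^'.
  apply/funext => P; apply/propext; rewrite /dnbhs /within /=; split.
    move=> /nbhs_ballP[r r0 hr]; apply/nbhs_ballP.
    exists (Num.min r (x - 1)); first by rewrite /= lt_min r0 subr_gt0.
    move=> y; rewrite /ball /= lt_min => /andP[xy xy1] yx; apply: hr => //.
    by rewrite in_itv /= andbT; move: xy1; rewrite ltr_norml => /andP[_]; lra.
  by move=> /nbhs_ballP[r r0 hr]; apply/nbhs_ballP; exists r => // y xy yx _; exact: hr.
apply: cvg_lim => //.
have hd : (h^-1 *: (a (h *: 1 + x) - a x) @[h --> 0^'] --> d)%classic.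
  by rewrite -dE; exact: da.
apply/cvgrPdist_lt => e e0; move/cvgrPdist_lt: hd => /(_ e e0).
rewrite /dnbhs /within /= => /nbhs_ballP[r r0 hr].
apply/nbhs_ballP; exists r => //= y xy yx.
have := hr (y - x); rewrite /ball /= sub0r normrN subr_eq0 distrC.
rewrite /ball /= in xy.
move=> /(_ xy yx); rewrite /diff_quotient.
by rewrite /GRing.scale /= mulr1 subrK mulrC.
Qed.

(** As a' is nonincreasing, |a'(n) - (a(n+1) - a(n))| <= a'(n) - a'(n+1), which telescopes to at
    most a'(M0); the quadratic error is at most eta (a(n+1) - a(n)) once K a' is small. *)
Lemma sublinear_case_sum (f : nat -> R -> R) :
  (forall i, evy (fun x => is_derive x 1 (f i) (f i.+1 x))) ->
  evy (fun x => 0 < f 0%N x) ->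
  evy (fun x => 0 < f 1%N x) -> sublinear_case f -> forall (K : R) eta, 0 < K -> 0 < eta ->
  evy (fun x : R => forall M0 : nat, x = M0%:R -> exists C : R, forall (N : nat) t, (M0 <= N)%N -> `|t| <= K ->
    normc (\sum_(M0 <= n < N) (f 1%N n%:R)%:C%C * expi (t * f 0%N n%:R) -
      (expint t (f 0%N N%:R) - expint t (f 0%N M0%:R))) <= C + eta * f 0%N N%:R).
Proof.
move=> df f0pos pos [t0 neg] K eta K0 eta0; have e0 : 0 < eta / (24 * K) by rewrite divr_gt0 // mulr_gt0.
have [A hA] := evy_and (df 0%N) (evy_and (df 1%N) (evy_and pos (evy_and neg (evy_and (t0 _ e0) f0pos)))).
exists A => x Ax M0 xM; exists (f 1%N M0%:R) => N t MN tK; rewrite xM in Ax.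
have anti (y z : R) : A <= y -> y <= z -> f 1%N z <= f 1%N y.
  by apply: (@der_le0_mono R (f 1%N) (f 2%N) A) => // w /hA[_ [? [? []]]].
have -> : \sum_(M0 <= n < N) (f 1%N n%:R)%:C%C * expi (t * f 0%N n%:R) -
      (expint t (f 0%N N%:R) - expint t (f 0%N M0%:R)) =
   \sum_(M0 <= n < N) ((f 1%N n%:R)%:C%C * expi (t * f 0%N n%:R) -
      (expint t (f 0%N n.+1%:R) - expint t (f 0%N n%:R))).
  by rewrite sumrB (telescope_sumr (fun n => expint t (f 0%N n%:R))).
apply: (le_trans (normc_sum_le _ _ _)).
have term (n : nat) : (M0 <= n < N)%N -> normc ((f 1%N n%:R)%:C%C * expi (t * f 0%N n%:R) -
      (expint t (f 0%N n.+1%:R) - expint t (f 0%N n%:R))) <=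
   - (f 1%N n.+1%:R - f 1%N n%:R) + eta * (f 0%N n.+1%:R - f 0%N n%:R).
  move=> /andP[Mn nN]; apply: (le_trans (euler_maclaurin_term _ _ _ _)).
  have An : A <= n%:R by apply: (le_trans Ax); rewrite ler_nat.
  have nn : n%:R <= n.+1%:R :> R by rewrite ler_nat.
  have [c /andP[c1 c2] E] := mvt_ge (fun z h => (hA z h).1) An nn.
  have nE : n.+1%:R - n%:R = 1 :> R by rewrite -natr1; ring.
  rewrite nE mulr1 in E; rewrite E.
  have Ac := le_trans An c1.
  have [_ [_ [cpos [_ [csmall _]]]]] := hA c Ac; rewrite (gtr0_norm cpos) in csmall.
  have h1 := anti _ _ An c1; have h2 := anti _ _ Ac c2.
  apply: lerD; first by rewrite ger0_norm ?subr_ge0 //; lra.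
  have h3 : `|t| * f 1%N c <= K * (eta / (24 * K)).
    by apply: ler_pM => //; exact: ltW.
  have h4 : K * (eta / (24 * K)) * 24 = eta by field; rewrite gt_eqF.
  rewrite expr2 mulrA ler_wpM2r ?(ltW cpos) //; lra.
rewrite big_nat_cond; apply: le_trans (ler_sum _ (fun n hn => term n (andP hn).1)) _.
rewrite -big_nat_cond big_split /= -mulr_sumr sumrN.
rewrite !(telescope_sumr (fun n => f _ n%:R)) //.
have AN : A <= N%:R by apply: (le_trans Ax); rewrite ler_nat.
have [_ [_ [p1 [_ [_ p2]]]]] := hA _ Ax; have [_ [_ [p3 _]]] := hA _ AN.
have := mulr_gt0 eta0 p2; lra.
Qed.

(** Each block is slow or fast according to |t| a'(M) <= tau; in both cases its error is at most eta
    times the increment of a over it. *)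
Lemma block_case_sum (a a1 a2 : R -> R) (C1 : R) :
  evy (fun x => is_derive x 1 a (a1 x)) -> evy (fun x => is_derive x 1 a1 (a2 x)) ->
  evy (fun x => 0 < a x) -> evy (fun x => 0 < a1 x) ->
  evy (fun x => `|x * a2 x| <= C1 * `|a1 x|) -> block_cancels a a1 ->
  forall (K : R) eta, 0 < K -> 0 < eta ->
  evy (fun x : R => forall M0 : nat, x = M0%:R -> exists C : R, forall (N : nat) t, (M0 <= N)%N -> `|t| <= K ->
    normc (\sum_(M0 <= n < N) (a1 n%:R)%:C%C * expi (t * a n%:R) -
      (expint t (a N%:R) - expint t (a M0%:R))) <= C + eta * a N%:R).
Proof.
move=> da da1 apos a1pos hr canc K eta0 K0 eta00; pose eta := Num.min eta0 1.
have e0 : 0 < eta by rewrite lt_min eta00 ltr01.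
have e1 : eta <= 1 by rewrite ge_min lexx orbT.
have ee : eta <= eta0 by rewrite ge_min lexx.
(* The block errors 2 eps + 96 tau and eps + 3 eps are both below eta / 2; [block_length_le] costs a
   factor 2. *)
pose eps := eta / 16; pose tau := eps / 64.
have ep0 : 0 < eps by rewrite divr_gt0.
have ta0 : 0 < tau by rewrite divr_gt0.
have [rho2 [r20 r21 hrv]] := relative_variation da1 hr ep0.
have [rho1 r10 hc] := canc K eps tau K0 ep0 ta0.
pose rho := Num.min rho1 rho2.
have r0 : 0 < rho by rewrite lt_min r10.
have rr1 : rho <= rho1 by rewrite ge_min lexx.
have rr2 : rho <= rho2 by rewrite ge_min lexx orbT.
have rle1 : rho <= 1 by apply: le_trans rr2 r21.
have Z0 : 0 < rho * eps * tau by rewrite !mulr_gt0.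
have [A hA] := evy_and da (evy_and apos (evy_and a1pos (evy_and hrv (hc rho r0 rr1 rle1)))).
apply: evy_imp (evy_and (evy_ge A) (evy_and (evy_ge 1) (evy_ge (2 / (rho * eps * tau))))) _.
move=> x [xA [x1 xZ]] M0 xM; rewrite xM in xA x1 xZ.
have M00 : (0 < M0)%N by rewrite -(ltr_nat R); lra.
have amono (y z : R) : A <= y -> y <= z -> a y <= a z.
  by apply: (@der_ge0_mono R a a1 A) => w /hA[? [? [? _]]] //; exact: ltW.
have [N1 hN1] := sum_over_blocks r0 rle1 M00.
(* The trivial bound for all N <= N1, independent of t. *)
pose C := \sum_(M0 <= n < N1) `|a1 n%:R| + 2 * a N1%:R.
exists C => N t MN tK.
have AM (M : nat) : (M0 <= M)%N -> A <= M%:R.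
  by move=> h; apply: (le_trans xA); rewrite ler_nat.
have := hN1 (fun n => (a1 n%:R)%:C%C * expi (t * a n%:R)) (fun n => expint t (a n%:R)) (fun n => a n%:R) eta C.
move=> /(_ _ _ N MN) H.
have {}H := le_trans (H _ _) (_ : _ <= C + eta0 * a N%:R); apply: H; last first.
- have [_ [aN _]] := hA _ (AM N MN); have [_ [aM _]] := hA _ xA.
  have := ler_wpM2r (ltW aN) ee; have := mulr_gt0 e0 aM; clear; lra.
- move=> n /andP[Mn nN1].
  have an0 : 0 <= eta * (a n%:R - a M0%:R).
    by rewrite mulr_ge0 ?(ltW e0) // subr_ge0 amono // ler_nat.
  apply: (@le_trans _ _ C); last by rewrite lerDl.
  apply: (le_trans (normcB_le _ _)); apply: lerD.
    apply: (le_trans (normc_sum_le _ _ _)).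
    rewrite [leRHS](@big_cat_nat _ _ _ n) //= ler_wpDr ?sumr_ge0 //.
    apply: ler_sum => k _; rewrite -[leLHS]/(normc ((a1 k%:R)%:C%C * expi (t * a k%:R))).
    by rewrite normcM normc_expi mulr1 normc_real.
  apply: (le_trans (normcB_le _ _)).
  have b (k : nat) : (M0 <= k)%N -> (k <= N1)%N -> normc (expint t (a k%:R)) <= a N1%:R.
    move=> k1 k2; apply: (le_trans (expint_le _ _)).
    have [_ [ak _]] := hA _ (AM k k1); rewrite gtr0_norm //.
    by apply: amono; [exact: AM | rewrite ler_nat].
  have := b n Mn nN1; have := b M0 (leqnn _) (leq_trans Mn nN1); clear; lra.
move=> M L M0M L1 L2; have AMM := AM M M0M.
have MM : M0%:R <= M%:R :> R by rewrite ler_nat.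
have Mp := lt_le_trans ltr01 (le_trans x1 MM).
have [_ [_ [A00 [hv hcan]]]] := hA _ AMM.
have dM (y : R) : M%:R <= y -> is_derive y 1 a (a1 y).
  by move=> My; have [] := hA y (le_trans AMM My).
have ha (y : R) : M%:R <= y -> y <= (M + L)%:R -> `|a1 y - a1 M%:R| <= eps * a1 M%:R.
  move=> My yL; rewrite -{2}(gtr0_norm A00); apply: hv => //; apply: (le_trans yL).
  have := ler_wpM2r (ltW Mp) rr2; rewrite natrD mulrDl mul1r; clear -L2; lra.
have eps2 : eps <= 2^-1 by rewrite /eps; clear -e1; lra.
have len := block_length_le dM ha A00 eps2.
have AL0 : 0 <= a1 M%:R * L%:R by rewrite mulr_ge0 // ltW.
have fin (c : R) : 2 * c <= eta -> c * (a1 M%:R * L%:R) <= eta * (a (M + L)%:R - a M%:R).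
  move=> hc2; have : 2 * c * (a1 M%:R * L%:R) <= eta * (a1 M%:R * L%:R) by rewrite ler_wpM2r.
  by have := ler_wpM2l (ltW e0) len; clear; lra.
have [small|big] := leP (`|t| * a1 M%:R) tau.
  apply: (le_trans (block_euler_maclaurin dM ha A00 eps2 small)).
  by apply: fin; rewrite /tau /eps; clear -e0; lra.
have Lbig : 1 <= eps * tau * L%:R.
  have h1 : 2 <= M%:R * (rho * eps * tau) by rewrite -ler_pdivrMr // (le_trans xZ).
  have h2 : eps * tau * (rho / 2 * M%:R) <= eps * tau * L%:R by rewrite ler_wpM2l // mulr_ge0 // ltW.
  by clear -h1 h2; lra.
apply: (le_trans (block_cancellation ha A00 ta0 big Lbig (hcan M L t erefl L1 L2 tK big))).
by apply: fin; rewrite /eps; clear -e0; lra.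
Qed.

End ExponentialSumEstimate.

(** * Fejer means on a finite grid *)

Section Fejer.
Context {R : realType}.
Implicit Types (t theta eps delta eta : R).

(** The ratio e(d / M) is not 1, because 0 < |d / M| < 1, while its M-th power is 1. *)
Lemma root_of_unity_sum (M : nat) (d : R) (k : int) : (0 < M)%N -> d = k%:~R ->
  k != 0 -> `|d| < M%:R -> \sum_(i < M) expi (d * (i%:R / M%:R)) = 0.
Proof.
move=> M0 dk k0 dM; have Mp : 0 < M%:R :> R by rewrite ltr0n.
have E : \sum_(i < M) expi (d * (i%:R / M%:R)) * (expi (d / M%:R) - 1) = 0.
  have h (i : nat) : expi (d * (i%:R / M%:R)) * (expi (d / M%:R) - 1) =
      expi (d * (i.+1%:R / M%:R)) - expi (d * (i%:R / M%:R)).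
    rewrite mulrBr mulr1 -expiD; congr (expi _ - _).
    by rewrite -natr1; ring.
  under eq_bigr do rewrite h.
  rewrite -(big_mkord xpredT (fun i => expi (d * (i.+1%:R / M%:R)) - expi (d * (i%:R / M%:R)))).
  rewrite (telescope_sumr (fun i => expi (d * (i%:R / M%:R)))) // mul0r mulr0 divff ?gt_eqF //.
  by rewrite mulr1 dk expi_int expi0 subrr.
rewrite -mulr_suml in E; move/eqP: E; rewrite mulf_eq0 => /orP[/eqP //|].
rewrite subr_eq0 => /eqP E; exfalso.
have [l ld] : exists l : int, d / M%:R = l%:~R.
  by apply: expi_eq1_int; have := congr1 (@complex.Re R) E; rewrite /expi.
have : `|l%:~R : R| < 1 by rewrite -ld normrM normfV (ger0_norm (ltW Mp)) ltr_pdivrMr ?mul1r.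
have : l != 0.
  apply: contraNneq k0 => l0; have : d = 0.
    by rewrite -[d](divfK (_ : M%:R != 0)) ?gt_eqF // ld l0 mul0r.
  by rewrite dk => /eqP; rewrite intr_eq0.
by move=> l0; rewrite -intr_norm ltrz1; case: l {ld} l0 => [[|n]|n].
Qed.

Definition dirichlet (J : nat) (x : R) : R[i] := \sum_(j < J) expi (j%:R * x).

Lemma dirichlet_sqr (J : nat) (x : R) : (normc (dirichlet J x) ^+ 2)%:C%C =
  \sum_(j < J) \sum_(k < J) expi ((j%:R - k%:R) * x).
Proof.
rewrite normc_sqr /dirichlet rmorph_sum /= mulr_suml; apply: eq_bigr => j _.
rewrite mulr_sumr; apply: eq_bigr => k _.
by rewrite -[X in _ * X]/((expi (k%:R * x))^*)%C -expiN -expiD; congr expi; ring.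
Qed.

(** Off-diagonal terms vanish by orthogonality on the grid i / J, so J^-2 |dirichlet|^2 has total
    mass exactly 1 on it, and the Fejer mean is a finite sum. *)
Lemma fejer_average (J : nat) (v : R) : (0 < J)%N ->
  \sum_(i < J) normc (dirichlet J (v - i%:R / J%:R)) ^+ 2 = J%:R ^+ 2.
Proof.
move=> J0; apply: (@complexI R); rewrite rmorph_sum /=.
under eq_bigr do rewrite dirichlet_sqr.
rewrite exchange_big /=; under eq_bigr do rewrite exchange_big /=.
have key (j k : 'I_J) : \sum_(i < J) expi ((j%:R - k%:R) * (v - i%:R / J%:R)) =
    if j == k then J%:R else 0 :> R[i].
  have [->|jk] := eqVneq j k.
    under eq_bigr do rewrite subrr mul0r expi0.
    by rewrite sumr_const card_ord.
  have -> : \sum_(i < J) expi ((j%:R - k%:R) * (v - i%:R / J%:R)) =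
      expi ((j%:R - k%:R) * v) * \sum_(i < J) expi ((k%:R - j%:R) * (i%:R / J%:R)).
    rewrite mulr_sumr; apply: eq_bigr => i _; rewrite -expiD; congr expi; ring.
  rewrite (@root_of_unity_sum J _ (k%:Z - j%:Z)) ?mulr0 //.
  - by rewrite intrB.
  - by rewrite subr_eq0 eqz_nat eq_sym.
  - have := ltn_ord j; have := ltn_ord k; rewrite -!(ltr_nat R) ltr_norml => h1 h2.
    by have := ler0n R k; have := ler0n R j; lra.
under eq_bigr => j _ do under eq_bigr => k _ do rewrite key.
have h (j : 'I_J) : \sum_(k < J) (if j == k then J%:R else 0) = J%:R :> R[i].
  by rewrite -big_mkcond /= (eq_bigl (fun k => k == j)) ?big_pred1_eq // => k; rewrite eq_sym.
under eq_bigr do rewrite h.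
by rewrite sumr_const card_ord rmorphXn /= rmorph_nat expr2 mulr_natl.
Qed.

Lemma dirichlet_far (J : nat) (x r : R) : 0 < r -> ~ near_int x r ->
  normc (dirichlet J x) ^+ 2 <= 16 / r ^+ 2.
Proof.
move=> r0 nx; have [k hk] := near_int_half x.
have rk : r < `|x - k%:~R| by rewrite ltNge; apply/negP => h; apply: nx; exists k.
have h1 := geometric_sum J x 0.
have -> : dirichlet J x = \sum_(n < J) expi (0 + x * n%:R).
  by apply: eq_bigr => n _; rewrite add0r mulrC.
set S := normc _ in h1 *; have S0 : 0 <= S by exact: normc_ge0.
have h2 : r <= normc (expi x - 1).
  have -> : expi x = expi (x - k%:~R) by rewrite expiD -intrN expi_int mulr1.
  by apply: le_trans (expiB1_ge hk); exact: ltW.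
have h3 : S * r <= 4 by apply: le_trans h1; rewrite ler_wpM2l.
rewrite ler_pdivlMr ?exprn_gt0 // -exprMn.
have -> : 16 = 4 ^+ 2 :> R by rewrite expr2; lra.
by rewrite lerXn2r ?nnegrE // mulr_ge0 // ltW.
Qed.

(** The phases j x stay within 1/8 of an integer, so each term has real part at least cos 1 >=
    1/2. *)
Lemma dirichlet_near (J : nat) (x : R) : (0 < J)%N -> near_int x (8 * J%:R)^-1 ->
  J%:R ^+ 2 <= 4 * normc (dirichlet J x) ^+ 2.
Proof.
move=> J0 [k hk]; have Jp : 0 < J%:R :> R by rewrite ltr0n.
pose y := x - k%:~R; rewrite -/y in hk.
have -> : dirichlet J x = dirichlet J y.
  apply: eq_bigr => j _; have -> : j%:R * x = j%:R * y + (j%:Z * k)%:~R.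
    by rewrite intrM /y -[(j%:Z)%:~R]/(j%:R); ring.
  by rewrite expiD expi_int mulr1.
have re : J%:R / 2 <= complex.Re (dirichlet J y).
  have -> : complex.Re (dirichlet J y) = \sum_(j < J) cos (2 * pi * (j%:R * y)).
    rewrite /dirichlet; elim/big_rec2: _ => // j a b _ <-.
    by case: b.
  rewrite mulr_natl -[X in _ *+ X]card_ord -sumr_const; apply: ler_sum => j _.
  rewrite -cos_norm; apply: (le_trans (@cos1_ge_half R)).
  have hj : `|j%:R * y| <= 8^-1.
    rewrite normrM ger0_norm //; apply: (@le_trans _ _ (J%:R * (8 * J%:R)^-1)).
      by apply: ler_pM => //; rewrite ler_nat ltnW.
    by rewrite invfM mulrCA divff ?mulr1 // gt_eqF.
  have pp := @pi_lt4 R; have p2 := pi_ge2 R.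
  have n1 : `|2 * pi * (j%:R * y)| = 2 * pi * `|j%:R * y|.
    by rewrite normrM ger0_norm //; lra.
  rewrite n1; have hj0 := normr_ge0 (j%:R * y).
  by apply: cos_mono_ge; nra.
have h : (J%:R / 2) ^+ 2 <= normc (dirichlet J y) ^+ 2.
  rewrite normc_sqrE ler_wpDr ?sqr_ge0 // lerXn2r ?nnegrE ?divr_ge0 //.
  by apply: le_trans re; rewrite divr_ge0.
by move: h; rewrite expr_div_n; lra.
Qed.

Lemma frac_partP (v : R) : 0 <= frac_part v < 1.
Proof.
have /andP[h1 h2] := floor_itv v; rewrite /frac_part; apply/andP; split.
  by rewrite subr_ge0.
by rewrite ltrBlDl; move: h2; rewrite intrD.
Qed.

(* The 1-periodic function v -> e(- theta {v}) jumps at the integers only; near them, where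
   its Fejer mean is a poor approximation, [dirichlet J0 v] is large. *)
Lemma fejer_approximation (theta : R) (J0 : nat) (v : R) (J := ((16 * J0) ^ 3)%N) :
  0 <= theta <= 1 -> (0 < J0)%N ->
  normc (expi (- theta * frac_part v) -
    (J%:R ^- 2)%:C%C * \sum_(i < J) expi (- theta * (i%:R / J%:R)) *
      (normc (dirichlet J (v - i%:R / J%:R)) ^+ 2)%:C%C)
  <= 2 / J0%:R + 8 / J0%:R ^+ 2 * normc (dirichlet J0 v) ^+ 2.
Proof.
(* r is the radius of the excluded neighbourhood of the integers. Outside it the error is 8 r + 32 /
   (r^2 J), and the cube in J makes this 3 / (2 J0). *)
move=> /andP[th0 th1] J00; pose r : R := (8 * J0%:R)^-1.
have J0p : 0 < J0%:R :> R by rewrite ltr0n.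
have r0 : 0 < r by rewrite invr_gt0 mulr_gt0.
have JJ : (0 < J)%N by rewrite expn_gt0 muln_gt0 J00.
have Jp : 0 < J%:R :> R by rewrite ltr0n.
have J2 : 0 < J%:R ^+ 2 :> R by rewrite exprn_gt0.
pose k i := normc (dirichlet J (v - i%:R / J%:R)) ^+ 2.
have k0 i : 0 <= k i by exact: sqr_ge0.
have ksum : \sum_(i < J) k i = J%:R ^+ 2 by exact: fejer_average.
pose G x := expi (- theta * x).
have -> : expi (- theta * frac_part v) - (J%:R ^- 2)%:C%C * \sum_(i < J) G (i%:R / J%:R) * (k i)%:C%C =
    (J%:R ^- 2)%:C%C * \sum_(i < J) (G (frac_part v) - G (i%:R / J%:R)) * (k i)%:C%C.
  under [in RHS]eq_bigr do rewrite mulrBl.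
  rewrite sumrB -mulr_sumr -rmorph_sum /= ksum [RHS]mulrBr.
  rewrite (_ : (J%:R ^- 2)%:C%C * (G (frac_part v) * (J%:R ^+ 2)%:C%C) = G (frac_part v)) //.
  by rewrite mulrCA -rmorphM /= mulVf ?gt_eqF // mulr1.
rewrite normcM normc_real gtr0_norm ?invr_gt0 //.
have trivial_bound : J%:R ^- 2 * normc (\sum_(i < J) (G (frac_part v) - G (i%:R / J%:R)) * (k i)%:C%C) <= 2.
  rewrite mulrC ler_pdivrMr //; apply: (le_trans (normc_sum_le _ _ _)).
  rewrite -ksum mulr_sumr; apply: ler_sum => i _.
  rewrite normcM normc_real (ger0_norm (k0 i)) ler_wpM2r //.
  by apply: (le_trans (normcB_le _ _)); rewrite !normc_expi; lra.
have [nv|fv] := EM (near_int v r).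
  apply: (le_trans trivial_bound); have := dirichlet_near J00 nv.
  have : 0 <= 2 / J0%:R :> R by rewrite divr_ge0.
  have J0s : 0 < J0%:R ^+ 2 :> R by rewrite exprn_gt0.
  set X := normc _ ^+ 2 => h1 h2.
  have : 2 <= 8 / J0%:R ^+ 2 * X by rewrite mulrAC ler_pdivlMr //; lra.
  lra.
have /andP[f0 f1] := frac_partP v.
have lo : r < frac_part v.
  rewrite ltNge; apply/negP => h; apply: fv; exists (Num.floor v).
  by rewrite -/(frac_part v) ger0_norm.
have hi : frac_part v < 1 - r.
  rewrite ltNge; apply/negP => h; apply: fv; exists (Num.floor v + 1).
  rewrite intrD opprD addrA -/(frac_part v) distrC ger0_norm; lra.
(* Grid points within r of {v} are treated by continuity; at the others the kernel is at most 16 /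
   r^2. As {v} lies in (r, 1 - r), no grid point is near it across an integer. *)
have term (i : 'I_J) : normc ((G (frac_part v) - G (i%:R / J%:R)) * (k i)%:C%C) <=
    8 * r * k i + 32 / r ^+ 2.
  rewrite normcM normc_real (ger0_norm (k0 i)).
  have q0 : 0 <= i%:R / J%:R :> R by rewrite divr_ge0.
  have q1 : i%:R / J%:R < 1 :> R by rewrite ltr_pdivrMr // mul1r ltr_nat.
  have [cl|far] := leP `|frac_part v - i%:R / J%:R| r.
    apply: ler_wpDr; first by rewrite divr_ge0 // exprn_ge0 // ltW.
    rewrite ler_wpM2r //; apply: (le_trans (expi_lip _ _)).
    rewrite -mulrBr normrM normrN (ger0_norm th0) ler_wpM2l //.
    by apply: le_trans cl; rewrite ler_piMl.
  apply: ler_wpDl; first by nneg.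
  have -> : 32 / r ^+ 2 = 2 * (16 / r ^+ 2) by ring.
  apply: ler_pM; [exact: normc_ge0 | exact: k0 | |].
    by apply: (le_trans (normcB_le _ _)); rewrite !normc_expi; lra.
  apply: dirichlet_far => // -[m hm].
  pose z : int := m - Num.floor v.
  have hz : `|frac_part v - i%:R / J%:R - z%:~R| <= r.
    have E : v - i%:R / J%:R - m%:~R = frac_part v - i%:R / J%:R - z%:~R.
      by rewrite /frac_part /z intrB; ring.
    by rewrite -E.
  have z1 : z%:~R < 1 :> R by move: hz; rewrite ler_norml => /andP[]; lra.
  have z2 : -1 < z%:~R :> R by move: hz; rewrite ler_norml => /andP[]; lra.
  have z0 : z = 0.
    have z2' : (- 1%:Z)%:~R < z%:~R :> R by rewrite intrN.
    by move: z1 z2'; rewrite ltrz1 ltr_int; case: (z) => [[|n]|[|n]].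
  by move: hz far; rewrite z0 subr0 => h1 h2; have := le_lt_trans h1 h2; rewrite ltxx.
have tot : J%:R ^- 2 * normc (\sum_(i < J) (G (frac_part v) - G (i%:R / J%:R)) * (k i)%:C%C) <=
    8 * r + 32 / (r ^+ 2 * J%:R).
  rewrite mulrC ler_pdivrMr //; apply: (le_trans (normc_sum_le _ _ _)).
  apply: (le_trans (ler_sum _ (fun i _ => term i))).
  have -> : \sum_(i < J) (8 * r * k i + 32 / r ^+ 2) = 8 * r * J%:R ^+ 2 + 32 / r ^+ 2 * J%:R.
    by rewrite big_split /= -mulr_sumr ksum sumr_const card_ord (mulr_natr (32 / r ^+ 2) J).
  rewrite le_eqVlt; apply/orP; left; apply/eqP; field.
  by rewrite !gt_eqF.
apply: (le_trans tot); apply: (@le_trans _ _ (2 / J0%:R)); last first.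
  by rewrite lerDl mulr_ge0 // ?sqr_ge0 // divr_ge0 // sqr_ge0.
have -> : J%:R = (16 * J0%:R) ^+ 3 :> R by rewrite natrX natrM.
have -> : 8 * r + 32 / (r ^+ 2 * (16 * J0%:R) ^+ 3) = (3 / 2) / J0%:R.
  by rewrite /r; field; rewrite gt_eqF.
by rewrite ler_wpM2r ?invr_ge0 //; lra.
Qed.

End Fejer.

(** * From real values to their integer parts *)

Section FloorTransfer.
Context {R : realType}.
Implicit Types (t theta eps delta eta : R).

Lemma normc_real_sum (r : seq nat) (P : pred nat) (x : nat -> R) : (forall n, P n -> 0 <= x n) ->
  \sum_(n <- r | P n) x n = normc (\sum_(n <- r | P n) (x n)%:C%C).
Proof. by move=> h; rewrite -rmorph_sum normc_real ger0_norm // sumr_ge0. Qed.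

(* The comparison term depends on the family (w, v) only through X: two families whose
   exponential sums are close to the same X can be compared. *)
Lemma floor_transfer (J0 : nat) (J := ((16 * J0) ^ 3)%N) (X : R -> R[i]) (alpha eta' : R)
    (theta : R) (r : seq nat) (P : pred nat) (w v : nat -> R) : (0 < J0)%N -> 0 <= theta <= 1 ->
  (forall n, P n -> 0 <= w n) ->
  (forall t, `|t| <= J%:R + 1 ->
     normc (\sum_(n <- r | P n) (w n)%:C%C * expi (t * v n) - X t) <= eta') ->
  normc (X 0) <= alpha -> (forall k : int, k != 0 -> normc (X k%:~R) <= 1) ->
  normc (\sum_(n <- r | P n) (w n)%:C%C * expi (theta * (Num.floor (v n))%:~R) -
     (J%:R ^- 2)%:C%C * \sum_(i < J) \sum_(j < J) \sum_(k < J)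
        expi (- theta * (i%:R / J%:R) - (j%:R - k%:R) * (i%:R / J%:R)) * X (theta + (j%:R - k%:R)))
  <= 10 / J0%:R * alpha + 8 + (10 + J%:R) * eta'.
Proof.
move=> J00 th w0 hX hX0 hXk; have /andP[th0 th1] := th.
pose mu t := \sum_(n <- r | P n) (w n)%:C%C * expi (t * v n).
have J0p : 1 <= J0%:R :> R by rewrite ler1n.
have J0J : (J0 <= J)%N.
  by rewrite /J expnS (leq_trans (leq_pmull J0 (isT : (0 < 16)%N))) // leq_pmulr // expn_gt0 muln_gt0 J00.
have Jp : 1 <= J%:R :> R by rewrite ler1n (leq_trans J00).
have J0Jr : J0%:R <= J%:R :> R by rewrite ler_nat.
have eta0 : 0 <= eta' by apply: le_trans (hX 0 _); [exact: normc_ge0 | rewrite normr0; lra].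
have mu_le t : `|t| <= J%:R + 1 -> normc (mu t) <= normc (X t) + eta'.
  move=> ht; have := normcD_le (mu t - X t) (X t); rewrite subrK.
  by have := hX t ht; rewrite -/(mu t); lra.
pose sigma x := (J%:R ^- 2)%:C%C * \sum_(i < J) expi (- theta * (i%:R / J%:R)) *
      (normc (dirichlet J (x - i%:R / J%:R)) ^+ 2)%:C%C.
(* Expanding the squared kernel leaves the frequencies theta + j - k, of modulus at most J + 1. *)
have mainE : \sum_(n <- r | P n) (w n)%:C%C * (expi (theta * v n) * sigma (v n)) =
   (J%:R ^- 2)%:C%C * \sum_(i < J) \sum_(j < J) \sum_(k < J)
     expi (- theta * (i%:R / J%:R) - (j%:R - k%:R) * (i%:R / J%:R)) * mu (theta + (j%:R - k%:R)).
  have termE n : (w n)%:C%C * (expi (theta * v n) * sigma (v n)) =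
      (J%:R ^- 2)%:C%C * \sum_(i < J) \sum_(j < J) \sum_(k < J)
      expi (- theta * (i%:R / J%:R) - (j%:R - k%:R) * (i%:R / J%:R)) *
        ((w n)%:C%C * expi ((theta + (j%:R - k%:R)) * v n)).
    rewrite /sigma !(mulrCA _ (J%:R ^- 2)%:C%C); congr (_ * _).
    rewrite !mulr_sumr; apply: eq_bigr => i _.
    rewrite dirichlet_sqr !mulr_sumr; apply: eq_bigr => j _.
    rewrite !mulr_sumr; apply: eq_bigr => k _.
    rewrite [RHS]mulrCA; congr (_ * _); rewrite -!expiD; congr expi; ring.
  under eq_bigr do rewrite termE.
  rewrite -mulr_sumr; congr (_ * _); rewrite exchange_big /=; apply: eq_bigr => i _.
  rewrite exchange_big /=; apply: eq_bigr => j _.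
  rewrite exchange_big /=; apply: eq_bigr => k _.
  by rewrite -mulr_sumr.
have approx : normc (\sum_(n <- r | P n) (w n)%:C%C * expi (theta * (Num.floor (v n))%:~R) -
    \sum_(n <- r | P n) (w n)%:C%C * (expi (theta * v n) * sigma (v n))) <=
   2 / J0%:R * (alpha + eta') + 8 / J0%:R ^+ 2 * (J0%:R * alpha + J0%:R ^+ 2 * (1 + eta')).
  have W : \sum_(n <- r | P n) w n <= alpha + eta'.
    rewrite (normc_real_sum r w0).
    have -> : \sum_(n <- r | P n) (w n)%:C%C = mu 0.
      by apply: eq_bigr => n _; rewrite mul0r expi0 mulr1.
    by apply: (le_trans (mu_le 0 _)); [rewrite normr0; lra | lra].
  (* The weight near the integers: each of the J0 diagonal terms gives alpha + eta', and off the
     diagonal j - k is a nonzero integer, where |X| <= 1. *)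
  have D : \sum_(n <- r | P n) w n * normc (dirichlet J0 (v n)) ^+ 2 <= J0%:R * alpha + J0%:R ^+ 2 * (1 + eta').
    have w0' n : P n -> 0 <= w n * normc (dirichlet J0 (v n)) ^+ 2.
      by move=> Pn; rewrite mulr_ge0 ?w0 // sqr_ge0.
    rewrite (normc_real_sum r w0').
    have -> : \sum_(n <- r | P n) (w n * normc (dirichlet J0 (v n)) ^+ 2)%:C%C =
        \sum_(j < J0) \sum_(k < J0) mu (j%:R - k%:R).
      under eq_bigr => n _ do rewrite rmorphM /= dirichlet_sqr mulr_sumr.
      rewrite exchange_big /=; apply: eq_bigr => j _.
      under eq_bigr => n _ do rewrite mulr_sumr.
      by rewrite exchange_big.
    apply: (le_trans (normc_sum_le _ _ _)).
    have -> : J0%:R * alpha + J0%:R ^+ 2 * (1 + eta') =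
       \sum_(j < J0) \sum_(k < J0) ((if j == k then alpha else 0) + (1 + eta')).
      under eq_bigr => j _.
        rewrite big_split /= -big_mkcond /= (eq_bigl (fun k => k == j)); last by move=> k; rewrite eq_sym.
        rewrite big_pred1_eq sumr_const card_ord; over.
      by rewrite sumr_const card_ord -[RHS]mulr_natl -[(1 + eta') *+ J0]mulr_natl; ring.
    apply: ler_sum => j _; apply: (le_trans (normc_sum_le _ _ _)); apply: ler_sum => k _.
    have jk : `|j%:R - k%:R : R| <= J%:R + 1.
      have := ltn_ord j; have := ltn_ord k; rewrite -!(ltr_nat R) ler_norml => h1 h2.
      by have := ler0n R k; have := ler0n R j; lra.
    apply: (le_trans (mu_le _ jk)); rewrite addrA lerD2r.
    have [->|njk] := eqVneq j k; first by rewrite subrr; lra.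
    rewrite add0r -[j%:R]/(j%:Z%:~R) -[k%:R]/(k%:Z%:~R) -intrB; apply: hXk.
    by rewrite subr_eq0 eqz_nat.
  rewrite -sumrB; apply: (le_trans (normc_sum_le _ _ _)).
  apply: (@le_trans _ _ (\sum_(n <- r | P n) (2 / J0%:R * w n +
      8 / J0%:R ^+ 2 * (w n * normc (dirichlet J0 (v n)) ^+ 2)))); last first.
    rewrite big_split /= -!mulr_sumr; apply: lerD; apply: ler_wpM2l => //; nneg.
  apply: ler_sum => n Pn; rewrite -mulrBr normcM normc_real ger0_norm ?w0 //.
  have -> : expi (theta * (Num.floor (v n))%:~R) - expi (theta * v n) * sigma (v n) =
     expi (theta * v n) * (expi (- theta * frac_part (v n)) - sigma (v n)).
    by rewrite mulrBr -expiD; congr (expi _ - _); rewrite /frac_part; ring.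
  rewrite normcM normc_expi mul1r.
  have := ler_wpM2l (w0 n Pn) (fejer_approximation (v n) th J00); rewrite -/J -/(sigma (v n)).
  by move/le_trans; apply; rewrite le_eqVlt; apply/orP; left; apply/eqP; ring.
rewrite mainE in approx.
set Y := _ * \sum_(i < J) \sum_(j < J) \sum_(k < J) _ * X _.
set Z := (_ * \sum_(i < J) _) in approx.
(* J^3 terms with error eta' each, against the factor J^-2. *)
have YZ : normc (Z - Y) <= J%:R * eta'.
  rewrite /Z /Y -mulrBr normcM normc_real gtr0_norm; last first.
    by rewrite invr_gt0 exprn_gt0 //; lra.
  rewrite mulrC ler_pdivrMr ?exprn_gt0 //; last by lra.
  rewrite -sumrB; apply: (le_trans (normc_sum_le _ _ _)).
  have -> : J%:R * eta' * J%:R ^+ 2 = \sum_(i < J) \sum_(j < J) \sum_(k < J) eta'.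
    by rewrite !sumr_const card_ord -[RHS]mulr_natl -[eta' *+ J *+ J]mulr_natl -[eta' *+ J]mulr_natl; ring.
  apply: ler_sum => i _; rewrite -sumrB; apply: (le_trans (normc_sum_le _ _ _)).
  apply: ler_sum => j _; rewrite -sumrB; apply: (le_trans (normc_sum_le _ _ _)).
  apply: ler_sum => k _; rewrite -mulrBr normcM normc_expi mul1r.
  apply: hX.
  have := ltn_ord j; have := ltn_ord k; rewrite -!(ltr_nat R) ler_norml => h1 h2.
  by have := ler0n R k; have := ler0n R j; lra.
set T := \sum_(n <- r | P n) _ in approx *.
have -> : T - Y = (T - Z) + (Z - Y) by rewrite subrKA.
apply: (le_trans (normcD_le _ _)).
have alpha0 : 0 <= alpha by apply: le_trans hX0; exact: normc_ge0.
have e1 : 2 / J0%:R * (alpha + eta') + 8 / J0%:R ^+ 2 * (J0%:R * alpha + J0%:R ^+ 2 * (1 + eta')) =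
   10 / J0%:R * alpha + 2 * eta' / J0%:R + 8 * (1 + eta').
  by field; rewrite gt_eqF //; lra.
rewrite e1 in approx.
have : 2 * eta' / J0%:R <= 2 * eta' by rewrite ler_pdivrMr ?ler_peMr //; [nneg | lra].
by lra.
Qed.

End FloorTransfer.

(** * The estimate on the unit circle *)

Section SupEstimate.
Context {R : realType}.
Implicit Types (t theta eps eta : R).

(** All three cases give the same bound on [M0, N). Constants attached to M0 are absorbed by a(N) ->
    oo, and the last term by a'(N) <= |C1| a(N) / N. *)
Lemma weighted_exponential_sum (a : R -> R) : subpolynomial a -> (forall x, 1 <= x -> 0 < a x) ->
  (forall kappa, 0 < kappa -> uniformly_distributed_mod1 (fun n => kappa * a n%:R)) ->
  (forall B, evy (fun x => B <= a x)) ->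
  forall K eta, 0 < K -> 0 < eta -> exists M0 : nat,
    [/\ (0 < M0)%N, forall n, (M0 <= n)%N -> 0 < deriv_ge1 a n%:R
      & exists N0 : nat, forall N t, (N0 <= N)%N -> `|t| <= K -> (M0 <= N.+1)%N /\
        normc (\sum_(M0 <= n < N.+1) (deriv_ge1 a n%:R)%:C%C * expi (t * a n%:R) - expint t (a N%:R))
          <= eta * a N%:R].
Proof.
move=> sub apos ud ainf K eta K0 eta0.
have [] := derivative_trichotomy sub apos ainf.
set f := fun i => iter i _ a => df [C1 hC1] pos cases.
have apos' : evy (fun x => 0 < a x) by exists 1.
have core : forall eta, 0 < eta ->
    evy (fun x : R => forall M0 : nat, x = M0%:R -> exists C : R, forall (N : nat) t, (M0 <= N)%N -> `|t| <= K ->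
    normc (\sum_(M0 <= n < N) (f 1%N n%:R)%:C%C * expi (t * a n%:R) -
      (expint t (a N%:R) - expint t (a M0%:R))) <= C + eta * a N%:R).
  case: cases => [h|h|[[p [C hp]] _ [C2 h2]]] e e0.
  - exact: (sublinear_case_sum df apos' pos h K0 e0).
  - have h' := van_der_corput_case_cancels df h.
    case: h => j [j1 _ _ ratio _]; have [C2 h2] := ratio 1%N (ltnW j1).
    exact: (block_case_sum (df 0%N) (df 1%N) apos' pos h2 h' K0 e0).
  have [P PE] := poly_antiderivative p; rewrite -PE in hp.
  have h' := polynomial_case_cancels (df 0%N) hp (ud_irrational_coef ud (df 0%N) hp).
  exact: (block_case_sum (df 0%N) (df 1%N) apos' pos h2 h' K0 e0).
have e4 : 0 < eta / 4 by rewrite divr_gt0.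
have [A hA] := evy_and (core _ e4) (evy_and (df 0%N) (evy_and pos (evy_and hC1 (evy_ge 2)))).
have [M0 M00 AM] := nat_above A.
have AMn n : (M0 <= n)%N -> A <= n%:R by move=> h; apply: (le_trans AM); rewrite ler_nat.
have dE n : (M0 <= n)%N -> deriv_ge1 a n%:R = f 1%N n%:R.
  by move=> /AMn/hA[_ [d1 [_ [_ n2]]]]; apply: deriv_ge1_derive => //; lra.
exists M0; split => // [n hn|].
  by rewrite dE //; have [_ [_ []]] := hA _ (AMn _ hn).
have [C hC] := (hA _ AM).1 M0 erefl.
pose D := Num.max 0 (C + a M0%:R).
have [A2 hA2] := evy_and (ainf (2 * D / eta)) (evy_ge (4 * `|C1| / eta)).
have [N1 _ AN1] := nat_above A2.
exists (maxn M0 N1) => N t; rewrite geq_max => /andP[MN N1N] tK; split; first exact: leqW.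
have [aN NC] : 2 * D / eta <= a N%:R /\ 4 * `|C1| / eta <= N%:R.
  by apply: hA2; apply: (le_trans AN1); rewrite ler_nat.
rewrite ler_pdivrMr // in aN; rewrite ler_pdivrMr // in NC.
have Da : C + a M0%:R <= D by rewrite le_max lexx orbT.
rewrite big_nat_recr //=.
rewrite (eq_big_nat _ _ (F2 := fun n => (f 1%N n%:R)%:C%C * expi (t * a n%:R))); last first.
  by move=> n /andP[hn _]; rewrite dE.
set S := \sum_(M0 <= n < N) _.
have -> : S + (deriv_ge1 a N%:R)%:C%C * expi (t * a N%:R) - expint t (a N%:R) =
  (S - (expint t (a N%:R) - expint t (a M0%:R))) +
    ((deriv_ge1 a N%:R)%:C%C * expi (t * a N%:R) - expint t (a M0%:R)) by ring.
apply: (le_trans (normcD_le _ _)).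
have b1 := hC N t MN tK; rewrite -/S in b1.
have b2 := normcB_le ((deriv_ge1 a N%:R)%:C%C * expi (t * a N%:R)) (expint t (a M0%:R)).
rewrite normcM normc_expi mulr1 normc_real in b2.
have b3 := expint_le t (a M0%:R).
have M01 : 1 <= M0%:R :> R by rewrite ler1n.
rewrite [`|a _|]gtr0_norm ?apos // in b3.
have [_ [_ [pN [cN N2]]]] := hA _ (AMn _ MN).
have aNp : 0 < a N%:R by apply: apos; lra.
have Np : 0 < N%:R :> R by lra.
have b4 : `|deriv_ge1 a N%:R| <= eta / 4 * a N%:R.
  rewrite dE // -(ler_pM2l Np); rewrite normrM (gtr0_norm Np) (gtr0_norm aNp) in cN.
  apply: (le_trans cN).
  have h1 : C1 * a N%:R <= `|C1| * a N%:R by rewrite ler_wpM2r ?ler_norm // ltW.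
  have := ler_wpM2r (ltW aNp) NC; clear -h1; lra.
clear -b1 b2 b3 b4 Da aN; lra.
Qed.

(** A Riemann sum of mesh 1 / B for the integral up to the integer part of y; the summand 1 bounds
    the integral over the rest. *)
Lemma uniform_exponential_sum (y : R) (B : nat) t : (0 < B)%N -> 0 <= y ->
  normc (\sum_(0 <= n < Num.truncn y * B) (B%:R^-1)%:C%C * expi (t * (n%:R / B%:R)) - expint t y)
    <= 24 * `|t| * y / B%:R + 1.
Proof.
move=> B0 y0; have Bp : 0 < B%:R :> R by rewrite ltr0n.
have /andP[Ay yA] := truncn_itv y0; set A := Num.truncn y in Ay yA *.
have AE : (A * B)%:R / B%:R = A%:R :> R by rewrite natrM mulfK // gt_eqF.
have -> : \sum_(0 <= n < A * B) (B%:R^-1)%:C%C * expi (t * (n%:R / B%:R)) - expint t y =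
   \sum_(0 <= n < A * B) ((B%:R^-1)%:C%C * expi (t * (n%:R / B%:R)) -
      (expint t (n.+1%:R / B%:R) - expint t (n%:R / B%:R))) - (expint t y - expint t A%:R).
  rewrite sumrB (telescope_sumr (fun n => expint t (n%:R / B%:R))) // AE mul0r expint0; ring.
apply: (le_trans (normcB_le _ _)); apply: lerD.
  apply: (le_trans (normc_sum_le _ _ _)).
  apply: (@le_trans _ _ (\sum_(0 <= n < A * B) (24 * `|t| * (B%:R^-1) ^+ 2))).
    apply: ler_sum => n _; apply: (le_trans (euler_maclaurin_term _ _ _ _)).
    have -> : n.+1%:R / B%:R - n%:R / B%:R = B%:R^-1 :> R.
      by rewrite -natr1; field; rewrite gt_eqF.
    by rewrite subrr normr0 add0r.
  rewrite big_const_nat subn0 iter_addr_0 -[leLHS]mulr_natl natrM.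
  have -> : A%:R * B%:R * (24 * `|t| * B%:R^-1 ^+ 2) = 24 * `|t| * A%:R / B%:R.
    by field; rewrite gt_eqF.
  by rewrite ler_wpM2r ?invr_ge0 ?(ltW Bp) // ler_wpM2l // mulr_ge0.
have -> : expint t y - expint t A%:R = expi (t * A%:R) * expint t (y - A%:R).
  have := expintD t A%:R (y - A%:R); rewrite [A%:R + _]addrC subrK => ->.
  ring.
rewrite normcM normc_expi mul1r; apply: (le_trans (expint_le _ _)).
rewrite ger0_norm ?subr_ge0 //; move: yA; rewrite -natr1; lra.
Qed.

(** Each m < A is the floor of exactly B points n / B, of total weight 1. *)
Lemma uniform_floor_sum (A B : nat) theta : (0 < B)%N ->
  \sum_(0 <= n < A * B) (B%:R^-1)%:C%C * expi (theta * (Num.floor (n%:R / B%:R : R))%:~R) =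
  \sum_(0 <= m < A) expi (theta * m%:R).
Proof.
move=> B0; have Bp : 0 < B%:R :> R by rewrite ltr0n.
rewrite !big_mkord (sum_ord_mul A B (fun n => (B%:R^-1)%:C%C * expi (theta * (Num.floor (n%:R / B%:R : R))%:~R))).
apply: eq_bigr => m _.
rewrite (eq_bigr (fun _ => (B%:R^-1)%:C%C * expi (theta * m%:R))); last first.
  move=> j _; rewrite (@floor_def _ _ m%:Z) //.
  rewrite addrC -intS -!pmulrn ler_pdivlMr // ltr_pdivrMr // -!natrM ler_nat ltr_nat leq_addr /=.
  by rewrite mulSn addnC ltn_add2r.
rewrite sumr_const card_ord -[LHS]mulr_natl mulrA -[B%:R]/(B%:R : R[i]).
rewrite -(rmorph_nat (real_complex R)) -rmorphM divff ?mul1r // gt_eqF //.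
Qed.

(** [floor_transfer] is applied with one and the same X to the values a(n) with weights a'(n) and to
    the points n / B with weights 1 / B; the main terms cancel. *)
Theorem sup_estimate (a : R -> R) : subpolynomial a -> (forall x, 1 <= x -> 0 < a x) ->
  (forall kappa, 0 < kappa -> uniformly_distributed_mod1 (fun n => kappa * a n%:R)) ->
  forall eps, 0 < eps -> exists N0 : nat, forall N theta, (N0 <= N)%N -> 0 <= theta <= 1 ->
  normc (\sum_(1 <= n < N.+1) (deriv_ge1 a n%:R)%:C%C * expi (theta * (Num.truncn (a n%:R))%:R) -
    \sum_(1 <= m < (Num.truncn (a N%:R)).+1) expi (theta * m%:R)) <= eps * a N%:R.
Proof.
move=> sub apos ud eps eps0.
have ainf := ud_tends_to_infinity sub apos (ud 1 ltr01).
have [J0 J00 hJ0] := nat_above (80 / eps).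
have J0p : 0 < J0%:R :> R by rewrite ltr0n.
have hJ1 : 10 / J0%:R <= eps / 8.
  by rewrite ler_pdivrMr //; move: hJ0; rewrite ler_pdivrMr //; lra.
pose J := ((16 * J0) ^ 3)%N.
have Jge0 : 0 <= J%:R :> R by [].
pose eta := eps / (8 * (10 + J%:R)).
have eta0 : 0 < eta by rewrite divr_gt0 // mulr_gt0 //; lra.
have etaE : (10 + J%:R) * eta = eps / 8 by rewrite /eta; field; lra.
have K0 : 0 < J%:R + 1 :> R by lra.
have [M0 [M00 wpos [N0 hN0]]] := weighted_exponential_sum sub apos ud ainf K0 eta0.
have [B B0 hB] := nat_above (24 * (J%:R + 1) / eta).
have Bp : 0 < B%:R :> R by rewrite ltr0n.
have hB1 : 24 * (J%:R + 1) / B%:R <= eta.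
  by rewrite ler_pdivrMr // [leRHS]mulrC -ler_pdivrMr.
pose D := \sum_(1 <= n < M0) `|deriv_ge1 a n%:R|.
(* The bounded contributions: D from n < M0, 2 from the end points of the second sum, 8 from each
   transfer, and 10 + J from the summand 1 in [uniform_exponential_sum]. *)
pose D2 := D + 2 + 16 + (10 + J%:R).
have [A2 hA2] := ainf (4 * D2 / eps).
have [N1 N10 AN1] := nat_above A2.
exists (maxn N0 N1) => N theta; rewrite geq_max => /andP[N0N N1N] th.
have aN : 4 * D2 / eps <= a N%:R.
  by apply: hA2; apply: (le_trans AN1); rewrite ler_nat.
rewrite ler_pdivrMr // in aN.
have aNp : 0 < a N%:R by apply: apos; rewrite ler1n (leq_trans N10).
pose X t := expint t (a N%:R).
have hX0 : normc (X 0) <= a N%:R by apply: (le_trans (expint_le _ _)); rewrite gtr0_norm.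
have hXk (k : int) : k != 0 -> normc (X k%:~R) <= 1.
  move=> k0; have k0' : k%:~R != 0 :> R by rewrite intr_eq0.
  have := expint_bound (a N%:R) k0'.
  have k1 : 1 <= `|k%:~R : R|.
    by rewrite -intr_norm -[1]/(1%:~R) ler_int -gtz0_ge1 normr_gt0.
  by move/(le_trans _); apply; rewrite ler_peMr // normc_ge0.
have M0N : (M0 <= N.+1)%N.
  have h0 : `|0 : R| <= J%:R + 1 by rewrite normr0; lra.
  by have [] := hN0 N 0 N0N h0.
(* [floor_transfer] wants nonnegative weights under its predicate, so the lower limit M0 is repeated
   as a predicate. *)
have EM (F : nat -> R[i]) : \sum_(n <- index_iota M0 N.+1 | (M0 <= n)%N) F n = \sum_(M0 <= n < N.+1) F n.
  by rewrite big_nat_cond [RHS]big_nat_cond; apply: eq_bigl => n; case: (M0 <= n)%N.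
have H1 := @floor_transfer _ J0 X (a N%:R) (eta * a N%:R) theta (index_iota M0 N.+1)
  (fun n => (M0 <= n)%N) (fun n => deriv_ge1 a n%:R) (fun n => a n%:R) J00 th.
have {}H1 := H1 (fun n h => ltW (wpos n h)) _ hX0 hXk.
rewrite -/J in H1; have {}H1 : normc (\sum_(M0 <= n < N.+1) (deriv_ge1 a n%:R)%:C%C * expi (theta * (Num.floor (a n%:R))%:~R) -
     (J%:R ^- 2)%:C%C * \sum_(i < J) \sum_(j < J) \sum_(k < J)
        expi (- theta * (i%:R / J%:R) - (j%:R - k%:R) * (i%:R / J%:R)) * X (theta + (j%:R - k%:R)))
  <= 10 / J0%:R * a N%:R + 8 + (10 + J%:R) * (eta * a N%:R).
  by rewrite -EM; apply: H1 => t tJ; rewrite EM; have [] := hN0 N t N0N tJ.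
pose A := Num.truncn (a N%:R).
have H2 := @floor_transfer _ J0 X (a N%:R) (eta * a N%:R + 1) theta (index_iota 0 (A * B))
  predT (fun _ => B%:R^-1) (fun n => n%:R / B%:R) J00 th.
have {}H2 := H2 _ _ hX0 hXk; rewrite -/J uniform_floor_sum // in H2.
have {}H2 : normc (\sum_(0 <= m < A) expi (theta * m%:R) -
     (J%:R ^- 2)%:C%C * \sum_(i < J) \sum_(j < J) \sum_(k < J)
        expi (- theta * (i%:R / J%:R) - (j%:R - k%:R) * (i%:R / J%:R)) * X (theta + (j%:R - k%:R)))
  <= 10 / J0%:R * a N%:R + 8 + (10 + J%:R) * (eta * a N%:R + 1).
  apply: H2 => [n _|t tJ]; first by rewrite invr_ge0 ltW.
  apply: (le_trans (uniform_exponential_sum t B0 (ltW aNp))); rewrite lerD2r.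
  apply: (@le_trans _ _ (24 * (J%:R + 1) / B%:R * a N%:R)); last by rewrite ler_wpM2r // ltW.
  have -> : 24 * `|t| * a N%:R / B%:R = (24 * a N%:R / B%:R) * `|t| by ring.
  have -> : 24 * (J%:R + 1) / B%:R * a N%:R = (24 * a N%:R / B%:R) * (J%:R + 1) by ring.
  by rewrite ler_wpM2l // !mulr_ge0 ?invr_ge0 // ltW.
set Y := _ * \sum_(i < J) _ in H1 H2.
have E1 : \sum_(1 <= n < N.+1) (deriv_ge1 a n%:R)%:C%C * expi (theta * (Num.truncn (a n%:R))%:R) =
   \sum_(1 <= n < M0) (deriv_ge1 a n%:R)%:C%C * expi (theta * (Num.truncn (a n%:R))%:R) +
   \sum_(M0 <= n < N.+1) (deriv_ge1 a n%:R)%:C%C * expi (theta * (Num.floor (a n%:R))%:~R).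
  rewrite (@big_cat_nat _ _ _ M0) //=; congr (_ + _).
  apply: eq_big_nat => n /andP[Mn _]; congr (_ * expi (theta * _)).
  have an0 : 0 <= a n%:R by apply/ltW/apos; rewrite ler1n (leq_trans M00).
  by rewrite truncn_floor an0 pmulrn gez0_abs // floor_ge0.
(* The points n / B yield m = 0, ..., A - 1, whereas the average runs over 1, ..., A; the difference
   has modulus at most 2. *)
have E2 : \sum_(1 <= m < A.+1) expi (theta * m%:R) =
    \sum_(0 <= m < A) expi (theta * m%:R) + (expi (theta * A%:R) - 1).
  have h : \sum_(0 <= m < A) expi (theta * m%:R) + expi (theta * A%:R) =
      1 + \sum_(1 <= m < A.+1) expi (theta * m%:R).
    by rewrite -(big_nat_recr A 0 (fun m => expi (theta * m%:R))) //= big_ltn // mulr0 expi0.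
  by rewrite addrA h; ring.
rewrite E1 E2.
set s0 := \sum_(1 <= n < M0) _; set s1 := \sum_(M0 <= n < N.+1) _ in H1 *.
set s2 := \sum_(0 <= m < A) _ in H2 *.
have -> : s0 + s1 - (s2 + (expi (theta * A%:R) - 1)) =
   ((s1 - Y) - (s2 - Y)) + (s0 - (expi (theta * A%:R) - 1)) by ring.
apply: (le_trans (normcD_le _ _)).
have b1 := normcB_le (s1 - Y) (s2 - Y).
have b2 := normcB_le s0 (expi (theta * A%:R) - 1).
have b3 := normcB_le (expi (theta * A%:R)) 1; rewrite normc_expi normc1 in b3.
have b4 : normc s0 <= D.
  apply: (le_trans (normc_sum_le _ _ _)); apply: ler_sum => n _.
  by rewrite normcM normc_expi mulr1 normc_real.
have b5 := ler_wpM2r (ltW aNp) hJ1.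
have b6 : (10 + J%:R) * (eta * a N%:R) = eps / 8 * a N%:R by rewrite mulrA etaE.
rewrite mulrDr b6 mulr1 in H2; rewrite b6 in H1.
have b7 := mulr_gt0 eps0 aNp.
rewrite /D2 in aN; clear -H1 H2 b1 b2 b3 b4 b5 b7 aN; lra.
Qed.

End SupEstimate.

(** * Finite Fourier analysis along an orbit segment *)

Section FiniteSpectralBound.
Context {R : realType}.
Implicit Types (c g b : nat -> R[i]).

Lemma root_of_unity_orthogonality (M i j : nat) : (i < M)%N -> (j < M)%N ->
  \sum_(k < M) expi ((i%:R - j%:R) * (k%:R / M%:R)) = if i == j then M%:R else 0 :> R[i].
Proof.
move=> iM jM; case: eqVneq => [->|ij].
  by under eq_bigr do rewrite subrr mul0r expi0; rewrite sumr_const card_ord.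
apply: (@root_of_unity_sum R M _ (i%:Z - j%:Z)); first exact: leq_ltn_trans iM.
- by rewrite intrB.
- by rewrite subr_eq0 eqz_nat.
- move: iM jM; rewrite -!(ltr_nat R) ltr_norml => h1 h2.
  by have := ler0n R i; have := ler0n R j; lra.
Qed.

Lemma parseval (M : nat) c :
  \sum_(k < M) normc (\sum_(j < M) c j * expi (j%:R * (k%:R / M%:R))) ^+ 2 =
  M%:R * \sum_(j < M) normc (c j) ^+ 2.
Proof.
apply: (@complexI R); rewrite rmorphM rmorph_nat !rmorph_sum /=.
transitivity (\sum_(i < M) \sum_(j < M) c i * (c j)^*%C *
    \sum_(k < M) expi ((i%:R - j%:R) * (k%:R / M%:R))).
  under eq_bigr => k _.
    rewrite -[(_ ^+ 2)%:C%C]/((normc _ ^+ 2)%:C%C) normc_sqr rmorph_sum /= mulr_suml.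
    over.
  rewrite exchange_big /=; apply: eq_bigr => i _.
  under eq_bigr do rewrite mulr_sumr.
  rewrite exchange_big /=; apply: eq_bigr => j _.
  rewrite mulr_sumr; apply: eq_bigr => k _.
  have -> : (c j * expi (j%:R * (k%:R / M%:R)))^*%C = (c j)^*%C * expi (- (j%:R * (k%:R / M%:R))).
    by rewrite expiN; exact: rmorphM.
  rewrite mulrBl expiD; ring.
rewrite mulr_sumr; apply: eq_bigr => i _.
under eq_bigr => j _ do rewrite root_of_unity_orthogonality //.
rewrite (bigD1 i) //= eqxx big1 ?addr0; last first.
  by move=> j ji; case: eqVneq => [E|]; rewrite ?mulr0 //; case/eqP: ji; apply/val_inj.
by rewrite -normc_sqr mulrC.
Qed.

Lemma fourier_inversion (M : nat) g : exists c, forall k, (k < M)%N ->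
  g k = \sum_(j < M) c j * expi (j%:R * (k%:R / M%:R)).
Proof.
exists (fun j => M%:R^-1 * \sum_(l < M) g l * expi (- (j%:R * (l%:R / M%:R)))) => k kM.
have M0 : M%:R != 0 :> R[i] by rewrite pnatr_eq0; case: M kM.
under eq_bigr do rewrite -mulrA mulr_suml.
rewrite -mulr_sumr exchange_big /=.
transitivity (M%:R^-1 * \sum_(l < M) g l * \sum_(j < M) expi ((k%:R - l%:R) * (j%:R / M%:R))); last first.
  congr (_ * _); apply: eq_bigr => l _; rewrite mulr_sumr; apply: eq_bigr => j _.
  by rewrite -mulrA -expiD; congr (_ * expi _); ring.
under eq_bigr => l _ do rewrite root_of_unity_orthogonality //.
rewrite (bigD1 (Ordinal kM)) //= eqxx big1 ?addr0; first by rewrite mulrCA mulVf ?mulr1.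
by move=> l lk; case: eqVneq => [E|]; rewrite ?mulr0 //; case/eqP: lk; apply/val_inj.
Qed.

(** Modulo M = K + D there is no wrap-around for k < K, so the left side is part of a cyclic
    convolution. Its multiplier consists of values of the polynomial b at roots of unity, bounded by
    S, and Parseval is applied on both sides. *)
Lemma convolution_bound (D K : nat) b g (S : R) :
  (forall theta, 0 <= theta <= 1 -> normc (\sum_(i < D) b i * expi (theta * i%:R)) <= S) ->
  \sum_(k < K) normc (\sum_(i < D) b i * g (k + i)%N) ^+ 2 <= S ^+ 2 * \sum_(k < K + D) normc (g k) ^+ 2.
Proof.
move=> hS; set M := (K + D)%N.
case: (posnP M) => [M0|M0].
  have K0 : K = 0%N by apply/eqP; rewrite -leqn0 -M0 leq_addr.
  rewrite K0 big_ord0 mulr_ge0 ?sqr_ge0 ?sumr_ge0 // => i _; exact: sqr_ge0.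
have Mp : 0 < M%:R :> R by rewrite ltr0n.
have [c gE] := fourier_inversion M g.
pose p (j : nat) := \sum_(i < D) b i * expi (j%:R / M%:R * i%:R).
pose h (k : nat) := \sum_(j < M) (c j * p j) * expi (j%:R * (k%:R / M%:R)).
have hE (k : nat) : (k < K)%N -> \sum_(i < D) b i * g (k + i)%N = h k.
  move=> kK; rewrite /h.
  transitivity (\sum_(i < D) \sum_(j < M) b i * (c j * expi (j%:R * ((k + i)%:R / M%:R)))).
    apply: eq_bigr => i _; rewrite gE ?mulr_sumr //.
    by rewrite /M -addnS leq_add // ltnW // ltnS ltnW.
  rewrite exchange_big /=; apply: eq_bigr => j _.
  rewrite /p [RHS]mulrAC mulr_sumr; apply: eq_bigr => i _.
  have -> : j%:R * ((k + i)%:R / M%:R) = j%:R * (k%:R / M%:R) + j%:R / M%:R * i%:R :> R.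
    by rewrite natrD; ring.
  by rewrite expiD; ring.
apply: (@le_trans _ _ (\sum_(k < M) normc (h k) ^+ 2)).
  rewrite /M big_split_ord /= ler_wpDr ?sumr_ge0 // => [i _|]; first exact: sqr_ge0.
  by apply: ler_sum => k _; rewrite hE.
rewrite (parseval M (fun j => c j * p j)).
have -> : \sum_(k < M) normc (g k) ^+ 2 = M%:R * \sum_(j < M) normc (c j) ^+ 2.
  by rewrite -parseval; apply: eq_bigr => k _; rewrite gE.
rewrite mulrCA ler_wpM2l ?(ltW Mp) // mulr_sumr; apply: ler_sum => j _.
rewrite normcM exprMn mulrC ler_wpM2r ?sqr_ge0 //.
have pS : normc (p j) <= S.
  apply: hS; rewrite divr_ge0 //= ler_pdivrMr // mul1r ler_nat.
  exact: ltnW.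
by rewrite lerXn2r ?nnegrE ?normc_ge0 // (le_trans (normc_ge0 _) pS).
Qed.

Lemma sum_by_value (I : Type) (r : seq I) (P : pred I) (e : I -> nat) (c : I -> R[i]) (D : nat) (F : nat -> R[i]) :
  (forall n, P n -> (e n < D)%N) ->
  \sum_(n <- r | P n) c n * F (e n) = \sum_(i < D) (\sum_(n <- r | P n && (e n == i)) c n) * F i.
Proof.
move=> eD; under [RHS]eq_bigr do rewrite mulr_suml.
rewrite (exchange_big_dep P) //= => [|i n _ /andP[] //]; apply: eq_bigr => n Pn.
rewrite (big_pred1 (Ordinal (eD n Pn))) // => i; rewrite Pn /= -val_eqE eq_sym.
by [].
Qed.

End FiniteSpectralBound.

(** * From the unit circle to the Koopman operator *)

Section Transference.
Context {R : realType} {d : measure_display} {X : measurableType d}.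
Variables (mu : probability X R).
Implicit Types (f g : X -> R[i]).

Definition complex_measurable f : Prop :=
  measurable_fun [set: X] (fun x => complex.Re (f x)) /\
  measurable_fun [set: X] (fun x => complex.Im (f x)).

Lemma complex_measurable_scale (z : R[i]) f : complex_measurable f ->
  complex_measurable (fun x => z * f x).
Proof.
move=> [fr fi]; split.
  have -> : (fun x => complex.Re (z * f x)) =
      (fun x => complex.Re z * complex.Re (f x) - complex.Im z * complex.Im (f x)).
    by apply/funext => x; case: z => a b; case: (f x).
  by apply: measurable_funB; apply: measurable_funM.
have -> : (fun x => complex.Im (z * f x)) =
    (fun x => complex.Re z * complex.Im (f x) + complex.Im z * complex.Re (f x)).
  by apply/funext => x; case: z => a b; case: (f x).
by apply: measurable_funD; apply: measurable_funM.
Qed.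

Lemma complex_measurable_sum (D : nat) (F : nat -> X -> R[i]) :
  (forall i, complex_measurable (F i)) -> complex_measurable (fun x => \sum_(i < D) F i x).
Proof.
move=> hF; elim: D => [|D [ir ii]].
  by split; under eq_fun do rewrite big_ord0; exact: measurable_cst.
have [fr fi] := hF D; split; under eq_fun do rewrite big_ord_recr raddfD /=;
  exact: measurable_funD.
Qed.

Lemma complex_measurable_comp (T : X -> X) f : measurable_fun [set: X] T ->
  complex_measurable f -> complex_measurable (f \o T).
Proof.
by move=> mT [fr fi]; split; [apply: (measurableT_comp fr mT) | apply: (measurableT_comp fi mT)].
Qed.

Definition energy f : \bar R := (\int[mu]_x ((normc (f x)) ^+ 2)%:E)%E.

Lemma energy_ge0 f : (0 <= energy f)%E.
Proof. by apply: integral_ge0 => x _; rewrite lee_fin sqr_ge0. Qed.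

Lemma measurable_sqr_normc f : complex_measurable f ->
  measurable_fun [set: X] (fun x => ((normc (f x)) ^+ 2)%:E).
Proof.
move=> [fr fi]; apply/measurable_EFinP; under eq_fun do rewrite normc_sqrE.
by apply: measurable_funD; apply: measurable_funX.
Qed.

Lemma L2norm_energy f : L2norm mu f = (energy f `^ 2^-1)%E.
Proof.
rewrite /L2norm unlock /energy; congr (_ `^ _)%E; apply: eq_integral => x _.
rewrite -[LHS]/((`|normc (f x)|%:E `^ 2)%E) ger0_norm ?normc_ge0 //.
by rewrite poweR_EFin powR_mulrn ?normc_ge0.
Qed.

Lemma measurable_iter (T : X -> X) (n : nat) : measurable_fun [set: X] T -> measurable_fun [set: X] (iter n T).
Proof.
move=> mT; elim: n => [|n IHn]; first exact: measurable_id.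
exact: (measurableT_comp mT IHn).
Qed.

(** The invariance of mu is stated for direct images; as T is onto, A = T(T^-1 A), so mu equals its
    pushforward. *)
Lemma energy_comp (T : X -> X) f : measure_preserving_system mu T -> complex_measurable f ->
  energy (f \o T) = energy f.
Proof.
move=> [mT [S mS [TS ST]] hT] mf; rewrite /energy.
rewrite [RHS](@eq_measure_integral _ _ _ setT (pushforward mu T) mu); last first.
  move=> A mA _; rewrite /pushforward /= -[RHS]hT; last first.
    by rewrite -[X in measurable X]setTI; exact: mT.
  congr (mu _); rewrite image_preimage // -subTset => x _.
  by exists (S x) => //; exact: ST.
rewrite (ge0_integral_pushforward mT) //; first exact: measurable_sqr_normc.
by move=> x _; rewrite lee_fin sqr_ge0.
Qed.

Lemma energy_iter (T : X -> X) f (n : nat) : measure_preserving_system mu T -> complex_measurable f ->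
  energy (f \o iter n T) = energy f.
Proof.
move=> hT mf; elim: n => [|n IHn]; first by [].
have -> : f \o iter n.+1 T = (f \o iter n T) \o T by apply/funext => x /=; rewrite -iterSr.
have [mT _ _] := hT.
by rewrite energy_comp //; apply: complex_measurable_comp => //; exact: measurable_iter.
Qed.

Lemma sum_ereal_cst (n : nat) (x : \bar R) : (0 <= x)%E -> (\sum_(k < n) x = n%:R%:E * x)%E.
Proof.
move=> x0; elim: n => [|n IHn]; first by rewrite big_ord0 mul0e.
by rewrite big_ord_recr /= IHn -natr1 EFinD ge0_muleDl ?mul1e // lee_fin.
Qed.

Lemma le_of_averages (p q : R) (D : nat) : 0 <= p -> (forall K : nat, (0 < K)%N -> K%:R * q <= (K + D)%:R * p) ->
  q <= p.
Proof.
move=> p0 h; rewrite leNgt; apply/negP => pq.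
have [K K0] := nat_above ((D%:R * p + 1) / (q - p)); rewrite ler_pdivrMr ?subr_gt0 // => hK.
by have := h K K0; rewrite natrD; lra.
Qed.

(** [convolution_bound] is integrated over the starting point of an orbit segment. As all iterates
    have the same energy, K energy(Q) <= S^2 (K + D) energy(f), and K -> oo removes D. *)
Theorem transference (T : X -> X) f (D : nat) (b : nat -> R[i]) (S : R) :
  measure_preserving_system mu T -> L2 mu f ->
  (forall theta, 0 <= theta <= 1 -> normc (\sum_(i < D) b i * expi (theta * i%:R)) <= S) ->
  (L2norm mu (fun x => (\sum_(i < D) b i * f (iter i T x))%R) <= S%:E * L2norm mu f)%E.
Proof.
move=> hT [fr fi fn] hS; have mf : complex_measurable f by [].
have [mT _ _] := hT.
have S0 : 0 <= S by apply: le_trans (hS 0 _); [exact: normc_ge0 | rewrite lexx ler01].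
pose Q x := \sum_(i < D) b i * f (iter i T x).
have mfi n : complex_measurable (f \o iter n T).
  by apply: complex_measurable_comp => //; exact: measurable_iter.
have mQ : complex_measurable Q.
  apply: (complex_measurable_sum D (F := fun i x => b i * f (iter i T x))) => i.
  exact: (complex_measurable_scale (b i) (mfi i)).
have mQi n : complex_measurable (Q \o iter n T).
  by apply: complex_measurable_comp => //; exact: measurable_iter.
have sq0 g x : (0 <= (normc (g x) ^+ 2)%:E)%E by rewrite lee_fin sqr_ge0.
have avg (K : nat) : (K%:R%:E * energy Q <= (S ^+ 2 * (K + D)%:R)%:E * energy f)%E.
  have sumE (L : nat) g : complex_measurable g -> (forall n, complex_measurable (g \o iter n T)) ->
      (L%:R%:E * energy g = \int[mu]_x (\sum_(k < L) (normc (g (iter k T x)) ^+ 2)%:E))%E.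
    move=> mg mgi; rewrite (ge0_integral_sum mu _ (f := fun (k : 'I_L) x => (normc (g (iter k T x)) ^+ 2)%:E)) //.
    - rewrite (eq_bigr (fun _ => energy g)) ?sum_ereal_cst ?energy_ge0 // => k _.
      exact: (energy_iter k hT mg).
    - by move=> k; exact: (measurable_sqr_normc (mgi k)).
  rewrite EFinM -muleA !sumE // -ge0_integralZl_EFin ?sqr_ge0 //.
  - apply: ge0_le_integral => //.
    + by move=> x _; apply: sume_ge0 => k _; exact: (sq0 (Q \o iter k T) x).
    + by apply: emeasurable_sum => k; exact: (measurable_sqr_normc (mQi k)).
    + apply: measurable_funeM; apply: emeasurable_sum => k; exact: (measurable_sqr_normc (mfi k)).
    move=> x _; rewrite !sumEFin -EFinM lee_fin.
    have := @convolution_bound R D K b (fun k => f (iter k T x)) S hS.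
    apply: le_trans; rewrite le_eqVlt; apply/orP; left; apply/eqP; apply: eq_bigr => k _.
    by congr (normc _ ^+ 2); apply: eq_bigr => i _; rewrite addnC iterD.
  - by move=> x _; apply: sume_ge0 => k _; exact: (sq0 (f \o iter k T) x).
  - by apply: emeasurable_sum => k; exact: (measurable_sqr_normc (mfi k)).
have fE : (energy f < +oo)%E.
  by rewrite L2norm_energy in fn; apply: lty_poweRy fn; rewrite invr_neq0.
(* Finiteness, from the case K = 1, allows the passage from extended to real numbers. *)
have QE : (energy Q < +oo)%E.
  have := avg 1%N; rewrite mul1e; move/le_lt_trans; apply.
  by rewrite lte_mul_pinfty // lee_fin mulr_ge0 ?sqr_ge0.
have := energy_ge0 f; have := energy_ge0 Q; move: avg fE QE.
rewrite !L2norm_energy -/Q.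
case: (energy Q) => [q| |] //; case: (energy f) => [p| |] // avg _ _; rewrite !lee_fin => q0 p0.
have qp : q <= S ^+ 2 * p.
  apply: (@le_of_averages _ _ D); first by rewrite mulr_ge0 ?sqr_ge0.
  move=> K _; have := avg K; rewrite -!EFinM lee_fin => /le_trans; apply.
  by rewrite le_eqVlt; apply/orP; left; apply/eqP; ring.
have -> : S * p `^ 2^-1 = (S ^+ 2 * p) `^ 2^-1.
  rewrite powRM ?sqr_ge0 // -powR_mulrn // -powRrM divff // powRr1 //.
by apply: ge0_ler_powR => //; rewrite ?nnegrE ?mulr_ge0 ?sqr_ge0.
Qed.

End Transference.

(** * Construction of w and conclusion *)

Section Conclusion.
Context {R : realType}.

(** v N is the infimum of the bounds valid from N on, and tends to 0. Adding 1 / (N + 1) makes it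
    positive and strictly decreasing, and makes it a valid bound even if the infimum is not
    attained. *)
Lemma decreasing_majorant (B : nat -> R -> Prop) :
  (forall n s s', s <= s' -> B n s -> B n s') -> (forall n, exists s, B n s) ->
  (forall eps, 0 < eps -> exists N0, forall n, (N0 <= n)%N -> B n eps) ->
  exists w : nat -> R, [/\ forall N, 0 < w N, forall M N, (M < N)%N -> w N < w M,
    w N @[N --> \oo] --> (0 : R) & forall N, B N (w N)].
Proof.
move=> up ex small.
pose E N := [set s : R | 0 <= s /\ forall n, (N <= n)%N -> B n s].
have E0 N : has_inf (E N).
  split; last by exists 0 => s [].
  have [s hs] := choice ex; have [N0 hN0] := small 1 ltr01.
  exists (1 + \sum_(n < N0) `|s n|); split; first by rewrite addr_ge0 ?sumr_ge0.
  move=> n _; have [nN0|N0n] := ltnP n N0.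
    apply: up (hs n); rewrite (bigD1 (Ordinal nN0)) //=.
    have : 0 <= \sum_(i < N0 | i != Ordinal nN0) `|s i| by exact: sumr_ge0.
    by have := ler_norm (s n); lra.
  by apply: up (hN0 n N0n); rewrite lerDl sumr_ge0.
pose v N := inf (E N).
have v0 N : 0 <= v N by apply: lb_le_inf; [have [] := E0 N | move=> s []].
have vmono M N : (M <= N)%N -> v N <= v M.
  move=> MN; apply: lb_le_inf; first by have [] := E0 M.
  move=> s [s0 hs]; apply: ge_inf; first by have [] := E0 N.
  by split=> // n Nn; apply: hs; exact: leq_trans Nn.
exists (fun N => v N + N.+1%:R^-1); split.
- by move=> N; rewrite ltr_wpDl // invr_gt0.
- by move=> M N MN; rewrite ler_ltD ?vmono ?(ltnW MN) // ltf_pV2 ?posrE // ltr_nat.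
- have vlim : v N @[N --> \oo] --> (0 : R).
    apply/cvgrPdist_le => eps eps0; have [N0 hN0] := small eps eps0.
    exists N0 => // N /= N0N; rewrite sub0r normrN ger0_norm //.
    apply: ge_inf; first by have [] := E0 N.
    by split=> [|n Nn]; [exact: ltW | apply: hN0; exact: leq_trans Nn].
  by rewrite -[X in _ --> X]addr0; apply: cvgD vlim _; exact: cvg_harmonic.
move=> N; have N1 : 0 < N.+1%:R^-1 :> R by rewrite invr_gt0.
have [s [_ hs] sv] := inf_adherent N1 (E0 N).
by apply: up (ltW sv) (hs N (leqnn N)).
Qed.

Lemma iter_koopman (X : Type) (T : X -> X) (f : X -> R[i]) (m : nat) (x : X) :
  iter m (koopman T) f x = f (iter m T x).
Proof. by elim: m x => [//|m IHm] x; rewrite /= /koopman /= IHm -iterSr. Qed.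

(** The coefficients b do not depend on F: powers of e(theta) and iterates of the operator can be
    inserted into the same polynomial. *)
Lemma averages_as_polynomial (a : R -> R) (N : nat) : exists (D : nat) (b : nat -> R[i]), forall F : nat -> R[i],
  ((a N%:R)^-1)%:C%C * (\sum_(1 <= n < N.+1) (deriv_ge1 a n%:R)%:C%C * F (Num.truncn (a n%:R))) -
  ((a N%:R)^-1)%:C%C * (\sum_(1 <= m < (Num.truncn (a N%:R)).+1) F m) = \sum_(i < D) b i * F i.
Proof.
pose e n := Num.truncn (a n%:R); set A := Num.truncn (a N%:R).
pose D := (maxn (\max_(n < N.+1) e n) A).+1.
pose w1 (n : nat) := (deriv_ge1 a n%:R)%:C%C; pose w2 (n : nat) : R[i] := 1.
pose b1 i := \sum_(n <- index_iota 1 N.+1 | (n < N.+1)%N && (e n == i)) w1 n.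
pose b2 i := \sum_(n <- index_iota 1 A.+1 | (n < A.+1)%N && (n == i)) w2 n.
exists D, (fun i => ((a N%:R)^-1)%:C%C * (b1 i - b2 i)) => F.
under [RHS]eq_bigr do rewrite -mulrA mulrBl.
rewrite -mulr_sumr sumrB mulrBr; congr (_ * _ - _ * _).
  rewrite -(@sum_by_value _ _ _ (fun n => (n < N.+1)%N) e w1 D F); last first.
    move=> n nN; rewrite ltnS leq_max; apply/orP; left.
    exact: (@leq_bigmax _ (fun n : 'I_N.+1 => e n) (Ordinal nN)).
  rewrite big_nat_cond [RHS]big_nat_cond; apply: eq_bigl => n.
  by case: (n < N.+1)%N; rewrite ?andbT ?andbF.
rewrite -(@sum_by_value _ _ _ (fun n => (n < A.+1)%N) id w2 D F); last first.
  by move=> n; rewrite ltnS => nA; rewrite ltnS leq_max nA orbT.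
rewrite big_nat_cond [RHS]big_nat_cond; apply: eq_big => [n|n _]; last by rewrite mul1r.
by case: (n < A.+1)%N; rewrite ?andbT ?andbF.
Qed.

End Conclusion.

Theorem theorem1p16 (R : realType) (a : R -> R)
    (a_subpoly : subpolynomial a)
    (a_pos : forall x : R, 1 <= x -> 0 < a x)
    (a_diff : derivable_ge1 a)
    (a_ud : forall kappa : R, 0 < kappa ->
      uniformly_distributed_mod1 (fun n : nat => kappa * a n%:R)) :
  exists w : nat -> R,
    [/\ forall N : nat, (0 < N)%N -> 0 < w N,
        forall M N : nat, (0 < M)%N -> (M < N)%N -> w N < w M,
        w N @[N --> \oo] --> (0 : R)
      & forall N : nat, (0 < N)%N ->
        forall (d : measure_display) (X : measurableType d)
          (mu : probability X R) (T : X -> X),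
        measure_preserving_system mu T ->
        forall f : X -> R[i], L2 mu f ->
        (L2norm mu (fun x => weighted_average a T f N x -
                             uniform_average a T f N x)%R
          <= (w N)%:E * L2norm mu f)%E].
Proof.
(* Vacuous at N = 0, where a 0 is not controlled. No measure-preserving system occurs in it, so w is
   the same for all of them. *)
pose B (N : nat) (s : R) := (0 < N)%N -> forall theta : R, 0 <= theta <= 1 ->
  normc (((a N%:R)^-1)%:C%C * (\sum_(1 <= n < N.+1)
           (deriv_ge1 a n%:R)%:C%C * expi (theta * (Num.truncn (a n%:R))%:R)) -
         ((a N%:R)^-1)%:C%C * (\sum_(1 <= m < (Num.truncn (a N%:R)).+1) expi (theta * m%:R))) <= s.
have [|N|eps eps0|w [w0 wdec wlim wB]] := @decreasing_majorant R B.
- by move=> n s s' ss h n0 theta th; apply: le_trans ss; exact: h.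
- have [D [b hb]] := averages_as_polynomial a N.
  exists (\sum_(i < D) normc (b i)) => N0 theta th.
  rewrite (hb (fun m => expi (theta * m%:R))); apply: (le_trans (normc_sum_le _ _ _)).
  by apply: ler_sum => i _; rewrite normcM normc_expi mulr1.
- have [N0 hN0] := sup_estimate a_subpoly a_pos a_ud eps0.
  exists N0 => N N0N Ng0 theta th; have aN : 0 < a N%:R by apply: a_pos; rewrite ler1n.
  rewrite -mulrBr normcM normc_real gtr0_norm ?invr_gt0 //.
  by rewrite mulrC ler_pdivrMr // hN0.
exists w; split=> // [M N _|N N0 d X mu T hT f hf]; first exact: wdec.
have [D [b hb]] := averages_as_polynomial a N.
have -> : (fun x => weighted_average a T f N x - uniform_average a T f N x) =
    (fun x => \sum_(i < D) b i * f (iter i T x)).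
  apply/funext => x; rewrite -(hb (fun m => f (iter m T x))); congr (_ * _ - _ * _);
  by apply: eq_bigr => n _; rewrite iter_koopman.
apply: transference => // theta th.
by rewrite -(hb (fun m => expi (theta * m%:R))); exact: wB.
Qed.
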